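(* Let $G$ be a finite simple planar graph with maximum degree $\Delta(G)\geq 17$ and girth $g(G)\geq 6$. Then $G$ admits a list $2$-distance $(\Delta(G)+2)$-coloring, i.e. for every assignment of a list $L(v)$ of $\Delta(G)+2$ colors to each vertex $v$, there is a choice of colors $c(v)\in L(v)$ such that any two distinct vertices that are adjacent or have a common neighbor receive distinct colors.
   Context: All graphs are finite and simple. The girth of a graph is the length of a shortest cycle. A $2$-distance coloring is a vertex coloring in which any two vertices at distance at most $2$ (adjacent or with a common neighbor) get different colors; the list version requires each vertex to get a color from its own prescribed list. *)

(* Defs.v *)
From mathcomp Require Import all_boot all_order all_algebra.
From mathcomp Require Import all_classical all_reals all_analysis.
Import Order.TTheory GRing.Theory Num.Theory.
Import numFieldNormedType.Exports.

Set Implicit Arguments.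
Unset Strict Implicit.
Unset Printing Implicit Defensive.

(* A finite simple graph is a symmetric irreflexive relation e on a finType;
   an undirected edge appears as the two ordered pairs (u, v) and (v, u). *)

Section Graph.
Variables (V : finType) (e : rel V).
Local Open Scope nat_scope.

Definition degree (v : V) : nat := #|[pred w | e v w]|.

Definition max_degree : nat := \max_(v : V) degree v.

(* Closed walks of length 2 traverse a single edge twice, so they are excluded;
   length is the number of vertices, i.e. of edges. *)
Definition graph_cycle (c : seq V) : bool :=
  [&& 3 <= size c, uniq c & cycle e c].

(* The girth of an acyclic graph is infinite. *)
Definition girth_at_least (g : nat) : Prop :=
  forall c : seq V, graph_cycle c -> g <= size c.

Definition adj_or_common_neighbor (u v : V) : bool :=
  e u v || [exists w, e u w && e w v].

Definition two_distance_coloring (C : eqType) (c : V -> C) : Prop :=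
  forall u v : V, u != v -> adj_or_common_neighbor u v -> c u != c v.

(* Lists are duplicate-free sequences over an arbitrary type of colors. *)
Definition list_two_distance_colorable (k : nat) : Prop :=
  forall (C : eqType) (L : V -> seq C),
    (forall v, uniq (L v)) -> (forall v, size (L v) = k) ->
    exists c : V -> C,
      (forall v, c v \in L v) /\ two_distance_coloring c.

End Graph.

Section Planarity.
Variable R : realType.
Local Open Scope classical_set_scope.
Local Open Scope ring_scope.

Definition arc_between (A : set (R * R)) (p q : R * R) : Prop :=
  exists f : R -> R * R,
    [/\ {within `[0, 1], continuous f}, set_inj `[0, 1] f,
        f 0 = p, f 1 = q & A = f @` `[0, 1]].

(* A point shared by the arcs of two distinct edges is required to be the
   image of a vertex, which by drawing_avoid is then an end of both edges. *)
Record plane_drawing (V : finType) (e : rel V)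
    (pos : V -> R * R) (arc : V -> V -> set (R * R)) : Prop := {
  drawing_inj : injective pos;
  drawing_sym : forall u v, e u v -> arc u v = arc v u;
  drawing_arc : forall u v, e u v -> arc_between (arc u v) (pos u) (pos v);
  drawing_avoid : forall u v w,
    e u v -> arc u v (pos w) -> w = u \/ w = v;
  drawing_disjoint : forall u v x y, e u v -> e x y ->
    (u, v) != (x, y) -> (u, v) != (y, x) ->
    arc u v `&` arc x y `<=` range pos
}.

Definition planar (V : finType) (e : rel V) : Prop :=
  exists (pos : V -> R * R) (arc : V -> V -> set (R * R)),
    plane_drawing e pos arc.

End Planarity.

(* Main.v *)
Require Import Defs.
From mathcomp Require Import all_boot zify.
Set Implicit Arguments.
Unset Strict Implicit.
Unset Printing Implicit Defensive.

(* Put k = max_degree e and take a counterexample with the fewest edges, with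
   lists of size k + 2.  Call a vertex light when its neighbours' degrees sum to
   at most k + 1; light vertices can be coloured last.  Minimality then forbids
   adjacent light vertices, bounds from below the neighbour degrees of every
   other vertex, and, since an even cycle that is not a clique is colorable from
   lists at least as large as the degrees, restricts even cycles of the square
   of the graph through tight vertices.
   By Euler's formula and the girth hypothesis the charges deg v - 3 have a
   negative sum.  After discharging only three kinds of vertices of degree 2 can
   remain negative, and only vertices of degree k have a guaranteed surplus.
   The negative vertices yield disjoint connectors between vertices of degree k,
   and a cycle formed by connectors would be a forbidden even cycle; so the
   connectors form a forest, which bounds the deficit by the surplus.
   Euler's formula is obtained from plane arcs without the Jordan curve theorem:
   a fine grid contains the graph as a minor, every closed mod 2 chain of the
   grid is a sum of unit squares, hence the cycle space of the graph is spanned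
   by the boundaries of faces, which are classes of unit squares. *)

(** * List coloring along even cycles *)

(** Charges are counted in tenths. A vertex of degree d can give 6 to every neighbour once 10d - 30
    >= 6d, and 8 once 10d - 30 >= 8d, hence the thresholds 8 and 15. A vertex of degree k keeps 2k -
    30, which is at least 4 because k >= 17, while a negative vertex lacks at most 2. So it is
    enough to find at most two negative vertices per vertex of degree k. The obstacle is that an
    even cycle of the square may be a clique: a 4-clique can meet the neighbourhoods of two vertices
    of degree k in two vertices each. Such cliques are set apart as a core. A vertex of degree k
    adjacent to the core has at most two neighbours in it, so the core pays for itself, and the
    forest argument is applied outside it. *)

Lemma size_filter_neq (C : eqType) (c : C) (s : seq C) :
  uniq s -> size s <= (size [seq x <- s | x != c]).+1.
Proof.
move=> us; have := count_predC (pred1 c) s; rewrite size_filter.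
have -> : count (predC (pred1 c)) s = count (fun x => x != c) s by apply: eq_count.
by rewrite (count_uniq_mem _ us); case: (c \in s) => /= <-; rewrite ?addSn ?add0n.
Qed.

Section ListColoring.
Variables (T : finType) (q : rel T) (C : eqType).
Hypothesis q_sym : symmetric q.
Hypothesis q_irr : irreflexive q.
Implicit Types (F : {set T}) (L : T -> seq C).

Definition colorable_on F L : Prop :=
  exists c : T -> C, {in F, forall v, c v \in L v} /\
    {in F &, forall u v, q u v -> c u != c v}.

Definition degin F (v : T) : nat := #|[set w in F | q v w]|.

Lemma degin_rem F v w : w \in F -> degin F v = (q v w + degin (F :\ w) v)%N.
Proof.
move=> wF; rewrite /degin; rewrite (cardsD1 w) inE wF /=; congr (_ + _)%N.
by apply: eq_card => x; rewrite !inE andbA.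
Qed.

(* Colour a vertex of largest rank first: its parent keeps one colour in reserve. *)
Lemma greedy_coloring (c0 : T -> C) F r (rk : T -> nat) L :
  {in F, forall v, v != r -> exists2 w, w \in F & q v w && (rk w < rk v)} ->
  {in F, forall v, uniq (L v)} ->
  {in F, forall v, degin F v + (v == r) <= size (L v)} ->
  colorable_on F L.
Proof.
elim: {F}#|F| {-2}F (erefl #|F|) L => [|n IH] F cF L par unL szL.
  have F0 x : x \in F = false by rewrite (cards0_eq cF) inE.
  by exists c0; split=> [v|u v]; rewrite F0.
case: (set_0Vmem (F :\ r)) => [F0|[v1 v1F]].
  have Fr x : x \in F -> x = r.
    move=> xF; apply/eqP; apply/negPn/negP => xr.
    have : x \in F :\ r by rewrite !inE xr xF.
    by rewrite F0 inE.
  have [y yF] : exists y, y \in F by apply/set0Pn; rewrite -card_gt0 cF.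
  have rF : r \in F by rewrite -(Fr y yF).
  have := szL r rF; rewrite eqxx addn1; case E : (L r) => [//|a l] _.
  exists (fun=> a); split=> [v vF|u v uF vF].
    by rewrite (Fr v vF) E inE eqxx.
  by rewrite (Fr u uF) (Fr v vF) q_irr.
have [v vF vmax] := arg_maxnP (fun x => rk x) (v1F : (fun x => x \in F :\ r) v1).
move: vF; rewrite !inE => /andP[vr vF].
have [w wF /andP[qvw wlt]] := par v vF vr.
have := szL v vF; rewrite (negbTE vr) addn0.
have : 0 < degin F v by rewrite card_gt0; apply/set0Pn; exists w; rewrite inE wF.
case E : (L v) => [|a l]; first by rewrite leqn0 => /[swap] /eqP ->.
move=> _ _; pose L' x := if q v x then [seq y <- L x | y != a] else L x.
have cF' : #|F :\ v| = n by move: cF; rewrite (cardsD1 v) vF add1n => -[].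
case: (IH (F :\ v) cF' L').
- move=> x; rewrite !inE => /andP[xv xF] xr.
  have [y yF /andP[qxy ylt]] := par x xF xr; exists y; last by rewrite qxy.
  rewrite !inE yF andbT; apply: contraTneq ylt => ->; rewrite -leqNgt.
  by apply: vmax; rewrite !inE xr.
- move=> x; rewrite !inE => /andP[_ xF]; rewrite /L'; case: ifP => _; last exact: unL.
  by apply: filter_uniq; apply: unL.
- move=> x; rewrite !inE => /andP[xv xF].
  have := szL x xF; rewrite (degin_rem x vF) /L' q_sym; case: ifP => _ //.
  move=> H; rewrite -ltnS -addSn -add1n; exact: leq_trans H (size_filter_neq a (unL x xF)).
move=> c [cL cq]; exists (fun x => if x == v then a else c x); split.
  move=> x xF; case: eqVneq => [->|xv]; first by rewrite E inE eqxx.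
  have := cL x; rewrite !inE xv xF /L' => /(_ isT); case: ifP => // _.
  by rewrite mem_filter => /andP[].
have aux y : y \in F -> y != v -> q v y -> c y != a.
  move=> yF yv qvy; have := cL y; rewrite !inE yv yF /L' qvy => /(_ isT).
  by rewrite mem_filter => /andP[].
move=> x y xF yF; case: (eqVneq x v) => [->|xv]; case: (eqVneq y v) => [->|yv].
- by rewrite q_irr.
- by move=> ?; rewrite eq_sym; apply: aux.
- by rewrite q_sym => ?; apply: aux.
- by apply: cq; rewrite !inE ?xv ?yv.
Qed.

(** The far end of the path is colored first: the predecessor of each vertex is still uncolored and
    spares it one color, and [a], which comes last, has a spare color of its own. *)
Lemma path_coloring (c0 : T -> C) a p L :
  uniq (a :: p) -> path q a p ->
  {in a :: p, forall v, uniq (L v)} ->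
  {in a :: p, forall v, degin [set x in a :: p] v + (v == a) <= size (L v)} ->
  colorable_on [set x in a :: p] L.
Proof.
move=> us pp unL szL; apply: (@greedy_coloring c0 _ a (index^~ (a :: p))).
- move=> v; rewrite inE => vs va.
  move: (vs); rewrite inE (negbTE va) /= => vp.
  have iv : index v (a :: p) = (index v p).+1 by rewrite /= eq_sym (negbTE va).
  have ltv : index v p < size p by rewrite index_mem.
  set w := nth a (a :: p) (index v p); exists w.
    by rewrite inE mem_nth //= ltnS ltnW.
  suff: q v w && (index w (a :: p) < index v (a :: p)) by [].
  have iw : index w (a :: p) = index v p by rewrite index_uniq //= ltnS ltnW.
  rewrite iw iv ltnS leqnn andbT.
  by have /(pathP a) /(_ _ ltv) := pp; rewrite q_sym nth_index.
- by move=> v; rewrite inE; apply: unL.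
- by move=> v; rewrite inE; apply: szL.
Qed.

(** Giving [a] and [b] the same color [c] removes two neighbours of [v] at the price of one color.
    The color so gained makes [v] a root for [greedy_coloring] on the rest. *)
Lemma subset_same_coloring (c0 : T -> C) F L a b v (rk : T -> nat) c :
  a \in F -> b \in F -> v \in F -> a != b -> ~~ q a b -> q v a -> q v b ->
  {in F, forall x, c \in L x} ->
  {in F, forall x, uniq (L x)} ->
  {in F, forall x, degin F x <= size (L x)} ->
  {in F :\ a :\ b, forall x, x != v ->
     exists2 w, w \in F :\ a :\ b & q x w && (rk w < rk x)} ->
  colorable_on F L.
Proof.
move=> aF bF vF ab nab qva qvb cL unL szL par.
pose L' x := if q a x || q b x then [seq y <- L x | y != c] else L x.
have bF' : b \in F :\ a by rewrite !inE eq_sym ab.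
case: (@greedy_coloring c0 (F :\ a :\ b) v rk L' par).
- move=> x; rewrite !inE => /and3P[_ _ xF]; rewrite /L'; case: ifP => _; last exact: unL.
  by apply: filter_uniq; apply: unL.
- move=> x; rewrite !inE => /and3P[xb xa xF].
  have := szL x xF; rewrite (degin_rem x aF) (degin_rem x bF') /L' ![q _ x]q_sym.
  have := size_filter_neq c (unL x xF); case: (eqVneq x v) => [->|xv].
    by rewrite qva qvb /= addn1 !add1n => H1 H2; rewrite -ltnS (leq_trans H2).
  rewrite addn0; case: (q x a); case: (q x b) => /= H1 H2 //; rewrite -ltnS;
    by rewrite (leq_trans _ H1) // (leq_trans _ H2) // ?add0n ?add1n // ltnW.
move=> f [fL fq]; exists (fun x => if (x == a) || (x == b) then c else f x); split.
  move=> x xF; case: ifP => [_|/negbT]; first exact: cL.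
  rewrite negb_or => /andP[xa xb]; have := fL x; rewrite !inE xa xb xF /L' => /(_ isT).
  by case: ifP => // _; rewrite mem_filter => /andP[].
have aux y : y \in F -> ~~ ((y == a) || (y == b)) -> q a y || q b y -> f y != c.
  rewrite negb_or => yF /andP[ya yb] qy; have := fL y; rewrite !inE ya yb yF /L' qy => /(_ isT).
  by rewrite mem_filter => /andP[].
move=> x y xF yF; case: ifP => [xab|/negbT xab]; case: ifP => [yab|/negbT yab].
- case/orP: xab => /eqP->; case/orP: yab => /eqP->; rewrite ?q_irr // ?(negbTE nab) //.
  by rewrite q_sym (negbTE nab).
- move=> qxy; rewrite eq_sym; apply: aux => //.
  by case/orP: xab qxy => /eqP-> ->; rewrite ?orbT.
- move=> qxy; apply: aux => //.
  by rewrite ![q _ x]q_sym; case/orP: yab qxy => /eqP-> ->; rewrite ?orbT.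
- by move: xab yab; rewrite !negb_or => /andP[xa xb] /andP[ya yb]; apply: fq; rewrite !inE ?xa ?xb ?ya ?yb.
Qed.

End ListColoring.

Section EvenCycle.
Variables (T : finType) (q : rel T) (C : eqType).
Hypothesis q_sym : symmetric q.
Hypothesis q_irr : irreflexive q.
Variables (c0 : T -> C) (s : seq T) (L : T -> seq C).
Hypothesis s_uniq : uniq s.
Hypothesis s_cycle : cycle q s.
Hypothesis s_even : ~~ odd (size s).
Hypothesis L_uniq : {in s, forall v, uniq (L v)}.
Let F := [set x in s].
Hypothesis L_size : {in s, forall v, degin q F v <= size (L v)}.

Let rotF i : [set x in rot i s] = F.
Proof. by apply/setP => x; rewrite !inE mem_rot. Qed.

Lemma cycle_slack_coloring v : v \in s -> degin q F v < size (L v) -> colorable_on q F L.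
Proof.
move=> vs slack; case: (rot_to vs) => i p Ei.
have F' : [set x in v :: p] = F by rewrite -Ei rotF.
have mem x : (x \in v :: p) = (x \in s) by rewrite -Ei mem_rot.
rewrite -F'; apply: (path_coloring q_sym q_irr c0).
- by rewrite -Ei rot_uniq.
- by have := s_cycle; rewrite -(rot_cycle i) Ei /= rcons_path => /andP[].
- by move=> x; rewrite mem; apply: L_uniq.
- move=> x; rewrite mem F' => xs; case: eqP => [->|_]; first by rewrite addn1.
  by rewrite addn0 L_size.
Qed.

(** Coloring [v] with [a] takes one neighbour but no color away from the next vertex, which becomes
    the root with a spare color of the remaining path. *)
Lemma cycle_diff_coloring v a : v \in s -> next s v != v -> a \in L v -> a \notin L (next s v) ->
  colorable_on q F L.
Proof.
move=> vs nv av anw; case: (rot_to vs) => i p Ei.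
have F' : [set x in v :: p] = F by rewrite -Ei rotF.
have mem x : (x \in v :: p) = (x \in s) by rewrite -Ei mem_rot.
have vF : v \in F by rewrite inE.
have up : uniq (v :: p) by rewrite -Ei rot_uniq.
have nE : next s v = head v p by rewrite -(next_rot i s_uniq) Ei; case: (p) => [|y p'] /=; rewrite ?eqxx.
case: p Ei F' mem up nE => [|w p] Ei F' mem up nE /=; first by move: nv; rewrite nE /= eqxx.
rewrite /= in nE; rewrite nE in anw nv.
pose L' x := if q v x then [seq y <- L x | y != a] else L x.
have sub x : x \in w :: p -> x \in s by move=> xp; rewrite -mem inE xp orbT.
have vp : v \notin w :: p by case/andP: up.
have F1 : F :\ v = [set x in w :: p].
  apply/setP => x; rewrite in_setD1 [x \in F]inE [RHS]inE -mem [x \in v :: _]inE.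
  by case: (eqVneq x v) => [->|] //=; rewrite (negbTE vp).
case: (@path_coloring T q C q_sym q_irr c0 w p L').
- by case/andP: up.
- have := s_cycle; rewrite -(rot_cycle i) Ei /= rcons_path.
  by case/and3P.
- move=> x xp; rewrite /L'; case: ifP => _; last exact: L_uniq (sub _ xp).
  by apply: filter_uniq; apply: L_uniq (sub _ xp).
- move=> x xp; rewrite -F1; have := L_size (sub _ xp); rewrite (degin_rem q x vF) q_sym /L'.
  case: (eqVneq x w) => [->|xw].
    have qvw : q v w.
      by have := s_cycle; rewrite -(rot_cycle i) Ei /= => /andP[].
    rewrite qvw addn1 add1n; have -> : [seq y <- L w | y != a] = L w; last by [].
    by apply/all_filterP/allP => y yL; apply: contraNneq anw => <-.
  rewrite addn0; case: ifP => _ //; rewrite add1n => H; rewrite -ltnS.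
  exact: leq_trans H (size_filter_neq a (L_uniq (sub _ xp))).
rewrite -F1 => f [fL fq]; exists (fun x => if x == v then a else f x); split.
  move=> x xF; case: eqVneq => [->//|xv]; have := fL x; rewrite !inE xv /L'.
  by rewrite inE in xF; rewrite xF => /(_ isT); case: ifP => // _; rewrite mem_filter => /andP[].
have aux y : y \in F -> y != v -> q v y -> f y != a.
  move=> yF yv qvy; have := fL y; rewrite in_setD1 yv yF /L' qvy => /(_ isT).
  by rewrite mem_filter => /andP[].
move=> x y xF yF; case: (eqVneq x v) => [->|xv]; case: (eqVneq y v) => [->|yv].
- by rewrite q_irr.
- by move=> ?; rewrite eq_sym; apply: aux.
- by rewrite q_sym => ?; apply: aux.
- by apply: fq; rewrite in_setD1 ?xv ?yv.
Qed.

Hypothesis uncolorable : ~ colorable_on q F L.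
Hypothesis s_size : 3 <= size s.

Let n := size s.

Let next_neq v : v \in s -> next s v != v.
Proof.
move=> vs; case: (rot_to vs) => i p Ei; rewrite -(next_rot i s_uniq) Ei.
have : uniq (v :: p) by rewrite -Ei rot_uniq.
have : size (v :: p) = size s by rewrite -Ei size_rot.
case: p {Ei} => [|w p] /=; first by move=> E; move: s_size; rewrite -E.
by move=> _ /andP[]; rewrite inE negb_or eqxx eq_sym => /andP[].
Qed.

Let size_deg v : v \in s -> size (L v) = degin q F v.
Proof.
move=> vs; apply/eqP; rewrite eqn_leq L_size // andbT leqNgt; apply/negP.
by move/(cycle_slack_coloring vs)/uncolorable.
Qed.

(** By [cycle_diff_coloring] each list is contained in the next one, and containment goes all the
    way round the cycle, so all lists have the same elements. *)
Lemma cycle_lists_eq v w : v \in s -> w \in s -> {subset L v <= L w}.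
Proof.
pose r := [rel v w | all (mem (L w)) (L v)].
have r_tr : transitive r by move=> y x z /allP xy /allP yz; apply/allP => a /xy /yz.
have cr : cycle r s.
  apply: cycle_from_next => // x xs; apply/allP => a ax; apply/negPn/negP => an.
  exact: uncolorable (cycle_diff_coloring xs (next_neq xs) ax an).
move=> vs ws; case: (rot_to vs) => i p Ei.
have : w \in v :: p by rewrite -Ei mem_rot.
rewrite inE => /orP[/eqP->//|wp].
move: cr; rewrite -(rot_cycle i) Ei /= rcons_path => /andP[pr _].
by have /allP := order_path_min r_tr pr => /(_ w wp) /allP.
Qed.

Lemma cycle_regular v w : v \in s -> w \in s -> degin q F v = degin q F w.
Proof.
move=> vs ws; rewrite -!size_deg //; apply/eqP; rewrite eqn_leq.
by rewrite !uniq_leq_size ?L_uniq //; apply: cycle_lists_eq.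
Qed.

Lemma cycle_nth x0 i : i.+1 < n -> q (nth x0 s i) (nth x0 s i.+1).
Proof.
rewrite /n; case: (s) s_cycle => // x p /=; rewrite rcons_path ltnS => /andP[/(pathP x0) pp _] lt.
exact: pp.
Qed.

Lemma cycle_nth_last x0 : q (nth x0 s n.-1) (nth x0 s 0).
Proof.
rewrite nth_last; case: (s) s_cycle s_size => // x p /=.
by rewrite rcons_path => /andP[_].
Qed.

Lemma degin_gt2 v y1 y2 y3 : y1 \in s -> y2 \in s -> y3 \in s ->
  q v y1 -> q v y2 -> q v y3 -> y1 != y2 -> y1 != y3 -> y2 != y3 -> 2 < degin q F v.
Proof.
move=> s1 s2 s3 q1 q2 q3 n12 n13 n23.
have <- : #|[set y1; y2; y3]| = 3.
  by rewrite setUC cardsU1 cards2 !inE negb_or eq_sym n13 eq_sym n23 n12.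
apply/subset_leq_card/subsetP => x; rewrite !inE.
by case/orP => [/orP[]|] /eqP->; apply/andP.
Qed.

(** Otherwise [q] has on [s] only the edges of the cycle itself; as the cycle is even and its lists
    coincide, two colors of the common list alternate along it. *)
Lemma cycle_degin_gt2 : exists2 v, v \in s & 2 < degin q F v.
Proof.
have [x0 x0s] : exists x, x \in s by case: (s) s_size => // x l; exists x; rewrite inE eqxx.
case: (boolP [exists v, (v \in s) && (2 < degin q F v)]) => [/existsP[v /andP[]]|]; first by exists v.
move/existsPn => d2; case: uncolorable.
have ns i : i < n -> nth x0 s i \in s by exact: mem_nth.
have neq i j : i < n -> j < n -> i != j -> nth x0 s i != nth x0 s j.
  by move=> *; rewrite nth_uniq.
have deg3 v y1 y2 y3 : v \in s -> y1 \in s -> y2 \in s -> y3 \in s ->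
  q v y1 -> q v y2 -> q v y3 -> y1 != y2 -> y1 != y3 -> y2 != y3 -> False.
  move=> vs s1 s2 s3 q1 q2 q3 n12 n13 n23.
  by have := d2 v; rewrite vs (degin_gt2 s1 s2 s3 q1 q2 q3 n12 n13 n23).
have odd_gap i j : i < j -> j < n -> q (nth x0 s i) (nth x0 s j) -> odd (j - i).
  move=> ij jn qij; have i1n : i.+1 < n by apply: leq_ltn_trans jn.
  have iN : i < n by apply: ltnW.
  case: (eqVneq j i.+1) => [->|ji]; first by rewrite subSnn.
  case: i ij qij i1n iN ji => [|i] ij qij i1n iN ji.
    (* The closing edge joins positions 0 and n - 1, whose difference is odd since n is even. *)
    case: (eqVneq j n.-1) => [->|jl].
      by rewrite subn0 /n; move: s_even s_size; case: (size s) => //= m; rewrite negbK.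
    exfalso; apply: (deg3 (nth x0 s 0) (nth x0 s 1) (nth x0 s j) (nth x0 s n.-1));
      rewrite ?ns ?neq ?cycle_nth ?[q _ (nth x0 s n.-1)]q_sym ?cycle_nth_last //; clear -ij ji jl jn i1n iN; lia.
  exfalso; apply: (deg3 (nth x0 s i.+1) (nth x0 s i) (nth x0 s i.+2) (nth x0 s j));
    rewrite ?ns ?neq ?cycle_nth ?[q _ (nth x0 s i)]q_sym ?cycle_nth //; clear -ij ji jn i1n iN; lia.
have x0L : 1 < size (L x0).
  rewrite size_deg //; case: (rot_to x0s) => i p Ei.
  have : size (x0 :: p) = size s by rewrite -Ei size_rot.
  have : uniq (x0 :: p) by rewrite -Ei rot_uniq.
  have := s_cycle; rewrite -(rot_cycle i) Ei.
  have mem x : (x \in x0 :: p) = (x \in s) by rewrite -Ei mem_rot.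
  case: p {Ei} mem => [|y [|z p]] mem /=; [by move=> _ _ E; move: s_size; rewrite -E..|].
  rewrite rcons_path => /and3P[qy _ /andP[_ qz]] /and4P[_ yn _ _] _.
  have <- : #|[set y; last z p]| = 2.
    rewrite cards2; case: eqP => // E; move: yn; rewrite E inE.
    by have := mem_last z p; rewrite inE => ->.
  apply/subset_leq_card/subsetP => x; rewrite !inE -mem.
  case/orP => /eqP->; first by rewrite qy !inE eqxx orbT.
  by rewrite q_sym qz; have := mem_last z p; rewrite !inE => ->; rewrite !orbT.
case E : (L x0) x0L => [|a [|b l]] // _.
have ab : a != b.
  by have := L_uniq x0s; rewrite E /= inE negb_or => /andP[/andP[]].
exists (fun x => if odd (index x s) then a else b); split.
  move=> x; rewrite inE => xs; apply: (cycle_lists_eq x0s xs); rewrite E.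
  by case: ifP; rewrite !inE eqxx ?orbT.
have main x y : x \in s -> y \in s -> index x s < index y s -> q x y -> odd (index x s) != odd (index y s).
  move=> xs ys lt; rewrite -{1}(nth_index x0 xs) -{1}(nth_index x0 ys) => qxy.
  have := odd_gap _ _ lt; rewrite index_mem => /(_ ys qxy).
  by rewrite oddB 1?ltnW //; case: odd; case: odd.
move=> x y; rewrite !inE => xs ys qxy.
have : odd (index x s) != odd (index y s).
  case: (ltngtP (index x s) (index y s)) => [lt|lt|E']; first exact: main.
    by rewrite eq_sym; apply: main => //; rewrite q_sym.
  by move: qxy; rewrite -(nth_index x0 xs) E' nth_index // q_irr.
by case: odd; case: odd => //= _; rewrite // eq_sym.
Qed.

(* A non-adjacent pair at minimal distance g along the cycle has the vertex at
   position g - 1 as a common neighbour; giving the pair one common colour leaves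
   a graph that can be coloured greedily towards that vertex. *)
Lemma even_cycle_clique : {in s &, forall u v, u != v -> q u v}.
Proof.
move=> u v us vs uv; apply/negPn/negP => nuv.
pose bad g := [exists i : 'I_n, (0 < g < n) && ~~ q (nth u (rot i s) 0) (nth u (rot i s) g)].
have exb : exists g, bad g.
  case: (rot_to us) => i p Ei.
  have mem x : (x \in u :: p) = (x \in s) by rewrite -Ei mem_rot.
  have sz : size (u :: p) = n by rewrite -Ei size_rot.
  have g0 : 0 < index v (u :: p) by rewrite /= (negbTE uv).
  have gn : index v (u :: p) < n by rewrite -sz index_mem mem.
  have nv : nth u (u :: p) (index v (u :: p)) = v by rewrite nth_index ?mem.
  move: g0 gn nv; set g := index _ _ => g0 gn nv; exists g; apply/existsP.
  have [ltin | lein] := ltnP i n; first by exists (Ordinal ltin); rewrite /= Ei nv g0 gn.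
  move: Ei; rewrite rot_oversize // => Ei.
  have n0 : 0 < n by rewrite -sz.
  by exists (Ordinal n0); rewrite /= rot0 Ei nv g0 gn.
case: (ex_minnP exb) => g /existsP[i /andP[/andP[g0 gn] nq]] gmin.
have gap j k : 0 < k < g -> k < n -> q (nth u (rot j s) 0) (nth u (rot j s) k).
  move=> /andP[k0 kg] full_nbr; apply/negPn/negP => nqk.
  have [ltjn | lejn] := ltnP j n.
    have : bad k by apply/existsP; exists (Ordinal ltjn); rewrite k0 full_nbr nqk.
    by move/gmin; rewrite leqNgt kg.
  have n0 : 0 < n by apply: leq_trans full_nbr.
  have : bad k.
    by apply/existsP; exists (Ordinal n0); rewrite k0 full_nbr rot0 /=; move: nqk; rewrite rot_oversize.
  by move/gmin; rewrite leqNgt kg.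
set s' := rot i s in nq.
have us' : uniq s' by rewrite rot_uniq.
have cs' : cycle q s' by rewrite rot_cycle.
have szs' : size s' = n by rewrite size_rot.
have q01 : q (nth u s' 0) (nth u s' 1).
  case E : s' cs' szs' => [|x [|y l]] /= => [_ E'|_ E'|/andP[] //]; by move: s_size; rewrite -/n -E'.
have g1 : 1 < g by case: g g0 nq {gmin gn gap} => [|[|g]] //; rewrite q01.
set a := nth u s' 0 in nq q01; set b := nth u s' g in nq.
have g1n : g.-1 < n by apply: leq_ltn_trans (leq_pred g) _.
have [m Et] : exists m, take g.-1 s' = a :: m.
  have g10 : 0 < g.-1 by move: g1; case: (g) => [|[]].
  have sz1 : size (take g.-1 s') = g.-1 by rewrite size_takel // szs' ltnW.
  have n0 : nth u (take g.-1 s') 0 = a by rewrite nth_take.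
  case E : (take g.-1 s') sz1 n0 => [|a' m] /=; first by move=> E0; rewrite -E0 in g10.
  by move=> _ <-; exists m.
pose w := nth u s' g.-1.
have Ed : drop g.-1 s' = w :: b :: drop g.+1 s'.
  by rewrite (drop_nth u) ?szs' // prednK // (drop_nth u) ?szs'.
have Es : s' = a :: m ++ w :: b :: drop g.+1 s'.
  by rewrite -cat_cons -Et -Ed cat_take_drop.
have qaw : q a w by apply: gap => //; move: g1; case: (g) => [|[|k]] //= _; rewrite ltnSn.
apply: uncolorable; move: Es; set p := drop g.+1 s' => Es.
(* The vertices after [b] must also be colored towards [w]. For g > 2 the entry two places after [w]
   is adjacent to it by minimality of g. For g = 2 a third neighbour of [w] comes from
   [cycle_degin_gt2] and regularity, and it lies in [p] because [m] is empty. *)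
have wt : p = [::] \/ exists2 t, t \in p & q w t.
  case Ep : p => [|t p']; [by left | right].
  have [g2 | g2] := leqP g 2.
    have {g1 g2} E2 : g = 2 by apply/eqP; rewrite eqn_leq g2 g1.
    have : 2 < degin q F w.
      have [y ys] := cycle_degin_gt2; rewrite (@cycle_regular y w) //.
      by rewrite -(mem_rot i) -/s' Es !inE mem_cat !inE eqxx !orbT.
    rewrite ltnNge => /negP dw; case: (boolP (has (q w) p)) => [/hasP[z zp qz]|np].
      by exists z; rewrite -?Ep.
    case: dw; apply: leq_trans (_ : #|[set a; b]| <= 2); last by rewrite cards2; case: eqP.
    apply/subset_leq_card/subsetP => x; rewrite !inE -(mem_rot i) -/s' Es !inE mem_cat !inE.
    have m0 : m = [::].
      by move: (congr1 size Et); rewrite size_takel ?szs' 1?ltnW // E2; case: (m).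
    rewrite m0 /= => /andP[] /or4P[->//|/eqP->|->|xp]; rewrite ?q_irr ?orbT //.
    by move=> qwx; case/hasP: np; exists x.
  exists t; first by rewrite inE eqxx.
  have ltgn : g.+1 < n.
    rewrite -szs' ltnNge; apply/negP => h; move: Ep; by rewrite /p drop_oversize.
  have [j Ej] : exists j, rot g.-1 s' = rot j s.
    by eexists; rewrite /s' rot_add_mod // -?szs' ?size_rot ltnW // (ltnW ltgn).
  have := @gap j 2; rewrite g2 -Ej => /(_ isT).
  rewrite /rot Ed -/p Ep /= => H; apply: H.
  by apply: leq_trans ltgn; rewrite !ltnS.
have {wt} [t wt] : exists t, p = [::] \/ t \in p /\ q w t.
  by case: wt => [->|[t]]; [exists a; left | exists t; right].
have memF x : (x \in F) = [|| x == a, x \in m, x == w, x == b | x \in p].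
  by rewrite inE -(mem_rot i) -/s' Es inE mem_cat !inE.
have := us'; rewrite Es /= mem_cat !inE !negb_or cat_uniq /= negb_or -!andbA !inE !negb_or -!andbA.
move=> /and4P[am aw ab /and4P[ap um wm /and4P[bm /hasPn pm wb /and3P[wp bp up]]]].
have := cs'; rewrite Es /= rcons_cat cat_path /= => /and4P[pam qmw qwb].
rewrite rcons_path => /andP[pp _].
(* All parent chains end at [w], of rank 0: along [m] towards its last vertex, which is adjacent to
   [w], and along [p] from both sides towards [t], a neighbour of [w]. *)
pose rk x := if x \in p then ((index x p - index t p) + (index t p - index x p)).+1
             else size m - index x m.
have rkp x : x \in p -> rk x = ((index x p - index t p) + (index t p - index x p)).+1.
  by rewrite /rk => ->.
have rkn x : x \notin p -> rk x = size m - index x m by rewrite /rk => /negbTE->.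
have aF : a \in F by rewrite memF eqxx.
have wF : w \in F by rewrite memF eqxx !orbT.
have bF : b \in F by rewrite memF eqxx !orbT.
have as' : a \in s by rewrite inE in aF.
have [c cLa] : exists c, c \in L a.
  have := size_deg as'; case: (L a) => [/esym/eqP|c l _]; last by exists c; rewrite inE eqxx.
  have : w \in [set z in F | q a z] by rewrite inE wF.
  by move=> wN; rewrite cards_eq0 => /eqP N0; rewrite N0 inE in wN.
apply: (@subset_same_coloring T q C q_sym q_irr c0 F L a b w rk c) => //.
- by rewrite q_sym.
- by move=> x; rewrite inE => xs; apply: (cycle_lists_eq as' xs).
- by move=> x; rewrite inE; apply: L_uniq.
- by move=> x; rewrite inE; apply: L_size.
move=> x; rewrite !in_setD1 memF => /and3P[xb xa]; rewrite (negbTE xa) (negbTE xb) /= => xF xw.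
move: xF; rewrite (negbTE xw) /= => /orP[xm|xp].
  have xp : x \notin p by apply: contraL xm => /pm.
  have ix : index x m < size m by rewrite index_mem.
  exists (nth w m (index x m).+1).
    have [lt | ge] := ltnP (index x m).+1 (size m).
      have ym : nth w m (index x m).+1 \in m by exact: mem_nth.
      rewrite !in_setD1 memF ym !orbT andbT.
      by rewrite (contraNneq _ bm) 1?(contraNneq _ am) // => <-.
    by rewrite nth_default // !in_setD1 wF wb eq_sym aw.
  have [lt | ge] := ltnP (index x m).+1 (size m).
    have ym : nth w m (index x m).+1 \in m by exact: mem_nth.
    rewrite !rkn //; last by apply: contraL ym => /pm.
    rewrite index_uniq // ltn_sub2l // andbT.
    by have /(pathP w) /(_ _ lt) := pam; rewrite /= nth_index.
  rewrite nth_default // !rkn // memNindex // subnn subn_gt0 ix andbT.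
  have E : (index x m).+1 = size m by apply/eqP; rewrite eqn_leq ix ge.
  by move: qmw; rewrite -nth_last -E /= (set_nth_default w) // nth_index.
case: wt => [p0|[tp qwt]]; first by rewrite p0 in xp.
have ix : index x p < size p by rewrite index_mem.
have it : index t p < size p by rewrite index_mem.
have par j : j < size p -> nth a p j \in F :\ a :\ b.
  move=> lt; have ym : nth a p j \in p by exact: mem_nth.
  rewrite !in_setD1 memF ym !orbT andbT.
  by rewrite (contraNneq _ bp) 1?(contraNneq _ ap) // => <-.
have rkj j : j < size p -> rk (nth a p j) = ((j - index t p) + (index t p - j)).+1.
  by move=> lt; rewrite rkp ?mem_nth // index_uniq.
case: (ltngtP (index x p) (index t p)) => [lt|gt|E].
- have lt' := leq_ltn_trans lt it.
  exists (nth a p (index x p).+1); first exact: par.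
  rewrite rkj // rkp //; apply/andP; split; last by clear -lt; lia.
  by have /(pathP a) /(_ _ lt') := pp; rewrite /= nth_index.
- case Ei : (index x p) gt ix => [//|i'] gt ix.
  have lt' : i' < size p by apply: ltnW.
  exists (nth a p i'); first exact: par.
  rewrite rkj // rkp // Ei; apply/andP; split; last by clear -gt; lia.
  by have /(pathP a) /(_ _ ix) := pp; rewrite /= -Ei nth_index // q_sym.
- have -> : x = t by rewrite -(nth_index a xp) E nth_index.
  exists w; first by rewrite !in_setD1 wF wb eq_sym aw.
  by rewrite q_sym qwt rkn // rkp // memNindex // subnn.
Qed.

End EvenCycle.

(** * Minimal counterexamples *)

Section Square.
Variables (V : finType) (e : rel V).
Hypothesis e_sym : symmetric e.

Definition square : rel V := [rel v w | (v != w) && adj_or_common_neighbor e v w].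

Lemma square_sym : symmetric square.
Proof.
move=> v w; rewrite /square /= eq_sym /adj_or_common_neighbor e_sym; congr (_ && (_ || _)).
by apply: eq_existsb => x; rewrite andbC e_sym [e x v]e_sym.
Qed.

Lemma square_irr : irreflexive square.
Proof. by move=> v; rewrite /square /= eqxx. Qed.

Lemma degree_gt0 v w : e v w -> 0 < degree e v.
Proof. by move=> evw; apply/card_gt0P; exists w. Qed.

(** A square neighbour of [v] is a neighbour [w] or one of the deg w - 1 further vertices seen from
    some [w]; the filter [P] is kept only for the former. *)
Lemma square_card (P : pred V) v :
  #|[set x | P x & square v x]| <= \sum_(w | e v w) (P w + (degree e w).-1).
Proof.
have sub : [set x | P x & square v x] \subset
    \bigcup_(w | e v w) ([set x | (x == w) && P w] :|: [set x | e w x] :\ v).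
  apply/subsetP => x; rewrite inE => /and3P[Px vx /orP[evx|/existsP[w /andP[evw ewx]]]].
    by apply/bigcupP; exists x => //; rewrite !inE eqxx Px.
  by apply/bigcupP; exists w => //; rewrite !inE ewx [x == v]eq_sym vx orbT.
apply: leq_trans (subset_leq_card sub) _.
apply: leq_trans (_ : \sum_(w | e v w) #|[set x | (x == w) && P w] :|: [set x | e w x] :\ v| <= _).
  elim/big_rec2: _ => [|w m A _ h]; first by rewrite cards0.
  by apply: leq_trans (leq_card_setU _ _) _; rewrite leq_add2l.
apply: leq_sum => w evw; apply: leq_trans (leq_card_setU _ _) _; apply: leq_add.
  apply: leq_trans (_ : #|if P w then [set w] else set0| <= _).
    by apply/subset_leq_card/subsetP => x; rewrite !inE => /andP[/eqP-> ->]; rewrite inE.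
  by case: (P w); rewrite ?cards1 ?cards0.
have := cardsD1 v [set x | e w x]; rewrite inE e_sym evw cardsE add1n.
by rewrite /degree => ->.
Qed.

End Square.

Definition del_edge (V : eqType) (e : rel V) (u v : V) : rel V :=
  [rel x y | e x y && ~~ ((x == u) && (y == v) || (x == v) && (y == u))].

Section MinimalCounterexample.
Variables (V : finType) (e : rel V) (k : nat) (C : eqType) (L : V -> seq C).
Hypothesis e_sym : symmetric e.
Hypothesis e_deg : forall v, degree e v <= k.
Hypothesis L_uniq : forall v, uniq (L v).
Hypothesis L_size : forall v, size (L v) = k.+2.
Hypothesis uncolorable : ~ exists c : V -> C,
  (forall v, c v \in L v) /\ two_distance_coloring e c.
Hypothesis edge_critical : forall u v, e u v -> exists c : V -> C,
  (forall x, c x \in L x) /\ two_distance_coloring (del_edge e u v) c.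

Local Notation deg := (degree e).
Local Notation q := (square e).

Definition degree_sum v := \sum_(w | e v w) deg w.
Definition light v := degree_sum v <= k.+1.
(* Bounds the number of vertices within distance 2 of v that constrain its color
   when the light vertices are coloured last. *)
Definition heavy_sum v := \sum_(w | e v w) (deg w - light w).

Lemma square_wdeg v : #|[set x | q v x]| <= degree_sum v.
Proof.
have := square_card e_sym predT v; rewrite /degree_sum.
have -> : [set x | predT x & q v x] = [set x | q v x] by apply/setP => x; rewrite !inE.
move/leq_trans; apply; apply: leq_sum => w evw /=.
by rewrite add1n prednK // (@degree_gt0 _ _ w v) // e_sym.
Qed.

Lemma square_hdeg v : #|[set x | ~~ light x & q v x]| <= heavy_sum v.
Proof.
apply: leq_trans (square_card e_sym _ v) _; apply: leq_sum => w evw.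
have : 0 < deg w by rewrite (@degree_gt0 _ _ w v) // e_sym.
by case: (deg w) => // m _; case: (light w); rewrite /= ?subn1 ?subn0 ?add0n ?add1n.
Qed.

Lemma residual_lists (U : {set V}) (c0 : V -> C) :
  (forall v, c0 v \in L v) ->
  (forall x y, x \notin U -> y \notin U -> q x y -> c0 x != c0 y) ->
  exists L' : V -> seq C, [/\ forall w, uniq (L' w),
    forall w, k.+2 <= size (L' w) + #|[set x | (x \notin U) && q w x]| &
    ~ colorable_on q U L'].
Proof.
move=> c0L c0q; pose bad w a := [exists x, [&& x \notin U, q w x & c0 x == a]].
exists (fun w => [seq a <- L w | ~~ bad w a]); split=> [w|w|[f [fL fq]]].
- by rewrite filter_uniq.
- rewrite -(L_size w) size_filter -(count_predC (bad w) (L w)) addnC.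
  rewrite -(eq_count (a1 := predC (bad w)) (a2 := fun a => ~~ bad w a)) // leq_add2l.
  rewrite -size_filter; set A := [set x | _].
  have -> : #|A| = size (map c0 (enum A)) by rewrite size_map cardE.
  apply: uniq_leq_size; first by rewrite filter_uniq.
  move=> a; rewrite mem_filter => /andP[/existsP[x /and3P[xU qx /eqP<-]] _].
  by apply: map_f; rewrite mem_enum inE xU.
- apply: uncolorable; exists (fun x => if x \in U then f x else c0 x); split.
    by move=> v; case: ifP => // vU; have := fL v vU; rewrite mem_filter => /andP[].
  have mixed x y : x \in U -> y \notin U -> q x y -> f x != c0 y.
    move=> xU yU qxy; have := fL x xU; rewrite mem_filter => /andP[nb _].
    by apply: contra nb => /eqP E; apply/existsP; exists y; rewrite yU qxy -E eqxx.
  move=> x y xy a; have qxy : q x y by rewrite /square /= xy.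
  case: ifP => xU; case: ifP => yU.
  + exact: fq.
  + by apply: mixed; rewrite ?yU.
  + by rewrite eq_sym; apply: mixed; rewrite ?xU // square_sym.
  + by apply: c0q; rewrite ?xU ?yU.
Qed.

(** A walk of length at most 2 that uses the edge [uv] has [u] or [v] as an end. *)
Lemma del_edge_sq u v x y : x \notin [set u; v] -> y \notin [set u; v] ->
  adj_or_common_neighbor e x y -> adj_or_common_neighbor (del_edge e u v) x y.
Proof.
rewrite !inE !negb_or => /andP[/negbTE xu /negbTE xv] /andP[/negbTE yu /negbTE yv].
rewrite /adj_or_common_neighbor /del_edge /= xu xv /= andbT => /orP[->//|/existsP[w /andP[xw wy]]].
by apply/orP; right; apply/existsP; exists w; rewrite xw wy yu yv !andbF.
Qed.

Lemma edge_residual (U : {set V}) u v : e u v -> u \in U -> v \in U ->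
  exists L' : V -> seq C, [/\ forall w, uniq (L' w),
    forall w, k.+2 <= size (L' w) + #|[set x | (x \notin U) && q w x]| &
    ~ colorable_on q U L'].
Proof.
move=> euv uU vU; have [c0 [c0L c0q]] := edge_critical euv.
apply: (@residual_lists U c0) => // x y xU yU /andP[xy a].
apply: c0q => //; apply: del_edge_sq a; rewrite !inE negb_or.
  by rewrite (contraNneq _ xU) 1?(contraNneq _ xU) // => ->.
by rewrite (contraNneq _ yU) 1?(contraNneq _ yU) // => ->.
Qed.

(** The vertices of [A] have more colors than square neighbours in the whole set, so they can be
    colored after [F] in any order. *)
Lemma extend_coloring (F A : {set V}) (L' : V -> seq C) : colorable_on q F L' ->
  (forall v, uniq (L' v)) -> {in A, forall v, degin q (F :|: A) v < size (L' v)} -> colorable_on q (F :|: A) L'.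
Proof.
elim: {A}#|A| {-2}A (erefl #|A|) => [|n IH] A cA colF unL slack.
  by rewrite (cards0_eq cA) setU0.
have [v vA] : exists v, v \in A by apply/set0Pn; rewrite -card_gt0 cA.
have [vF | vF] := boolP (v \in F).
  have E : F :|: A = F :|: A :\ v.
    by apply/setP => x; rewrite !inE; case: eqP => [->|]; rewrite ?vF.
  rewrite E; apply: IH => //; first by move: cA; rewrite (cardsD1 v) vA => -[].
  by move=> x; rewrite inE -E => /andP[_ /slack].
have E : (F :|: A) :\ v = F :|: A :\ v.
  by apply/setP => x; rewrite !inE; case: eqP => [->|]; rewrite ?(negbTE vF).
have vFA : v \in F :|: A by rewrite inE vA orbT.
case: (IH (A :\ v)).
- by move: cA; rewrite (cardsD1 v) vA => -[].
- exact: colF.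
- exact: unL.
- move=> x; rewrite !inE => /andP[xv xA]; apply: leq_ltn_trans (slack x xA).
  by rewrite -E (degin_rem q x vFA) leq_addl.
move=> f [fL fq]; rewrite -E in fL fq.
have [a aL anew] : exists2 a, a \in L' v & {in F :|: A, forall x, q v x -> f x != a}.
  case: (boolP (has (fun a => [forall x, (x \in F :|: A) && q v x ==> (f x != a)]) (L' v))).
    case/hasP => a aL /forallP Ha; exists a => // x xFA qvx.
    by have := Ha x; rewrite xFA qvx.
  move/hasPn => no; have := slack v vA; rewrite ltnNge => /negP[].
  have -> : degin q (F :|: A) v = size (map f (enum [set x in F :|: A | q v x])).
    by rewrite size_map -cardE.
  apply: uniq_leq_size => // a aL; have := no a aL; rewrite negb_forall => /existsP[x].
  rewrite negb_imply negbK => /andP[qx /eqP <-]; apply: map_f.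
  by rewrite mem_enum inE.
exists (fun x => if x == v then a else f x); split.
  move=> x xFA; case: eqVneq => [->//|xv]; apply: fL; by rewrite !inE xv -in_setU.
move=> x y xFA yFA; case: (eqVneq x v) => [->|xv]; case: (eqVneq y v) => [->|yv].
- by rewrite square_irr.
- by move=> qvy; rewrite eq_sym; apply: anew.
- by rewrite square_sym // => qvx; apply: anew.
- by apply: fq; rewrite in_setD1 ?xv ?yv.
Qed.

Lemma card_sq_split (F : {set V}) (P : pred V) w : {in F, forall x, P x} ->
  #|[set x | P x & q w x]| = #|[set x | [&& x \notin F, P x & q w x]]| + degin q F w.
Proof.
move=> FP; rewrite -(cardsID F) addnC; congr (_ + _); apply: eq_card => x; rewrite !inE //.
by rewrite andbC; case xF: (x \in F); rewrite //= FP.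
Qed.

(* Light vertices can always be coloured last, so they may be ignored. *)
Lemma critical_residual (F : {set V}) u v : e u v ->
  (u \in F) || light u -> (v \in F) || light v ->
  exists L' : V -> seq C, [/\ forall w, uniq (L' w),
    forall w, k.+2 <= size (L' w) + #|[set x | [&& x \notin F, ~~ light x & q w x]]| &
    ~ colorable_on q F L'].
Proof.
move=> euv uU vU; pose U := F :|: [set x | light x].
have [||L' [unL szL ncol]] := @edge_residual U u v euv; rewrite ?inE //.
exists L'; split=> // [w|colF].
  apply: leq_trans (szL w) _; rewrite leq_add2l; apply/subset_leq_card/subsetP => x.
  by rewrite !inE negb_or -andbA.
apply: ncol; apply: extend_coloring => // w; rewrite inE => lw.
have := szL w; have := card_sq_split (F := U) (P := predT) w => /(_ (fun _ _ => isT)) /= E.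
have EA : [set x | (x \notin U) && q w x] = [set x | [&& x \notin U, true & q w x]].
  by apply/setP => x; rewrite !inE.
rewrite EA => h; have := square_wdeg w; rewrite -/U.
have -> : [set x | q w x] = [set x | true & q w x] by apply/setP => x; rewrite !inE.
rewrite E => h2; have h3 := leq_trans h2 lw.
rewrite -(ltn_add2r #|[set x | [&& x \notin U, true & q w x]]|).
by apply: leq_trans h; rewrite addnC ltnS.
Qed.

(** Both ends may be ignored, so the residual problem lives on the empty set, where it is trivially
    solvable. *)
Lemma light_not_adjacent u v : e u v -> light u -> ~~ light v.
Proof.
move=> euv lu; apply/negP => lv.
have [c0 _] := edge_critical euv.
have [||L' [_ _ []]] := @critical_residual set0 u v euv; rewrite ?lu ?lv ?orbT //.
by exists c0; split=> [x|x y]; rewrite inE.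
Qed.

(** If [v] has a light neighbour [u], criticality of the edge [uv] leaves only [v] to color: its
    list is empty, so k + 2 heavy square neighbours block it. Without light neighbours [heavy_sum]
    is the full degree sum. *)
Lemma nonlight_hdeg v : ~~ light v -> k.+2 <= heavy_sum v.
Proof.
move=> nlv; case: (boolP [exists u, e v u && light u]) => [/existsP[u /andP[evu lu]]|/existsPn no].
  have [||L' [_ szL ncol]] := @critical_residual [set v] v u evu; rewrite ?inE ?eqxx ?lu ?orbT //.
  have := szL v; case E : (L' v) => [|a l]; last first.
    case: ncol; exists (fun=> a); split=> [x|x y]; rewrite !inE => /eqP->; first by rewrite E inE eqxx.
    by move=> /eqP->; rewrite square_irr.
  rewrite add0n => /leq_trans; apply; apply: leq_trans (square_hdeg v).
  by apply/subset_leq_card/subsetP => x; rewrite !inE => /andP[].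
have -> : heavy_sum v = degree_sum v.
  apply: eq_bigr => w evw; have := no w; rewrite evw /= => /negbTE->.
  by rewrite subn0.
by rewrite ltnNge.
Qed.

(** The bound k + 2 on [heavy_sum] leaves each cycle vertex at least as many colors as it has square
    neighbours on the cycle, so [even_cycle_clique] applies. The edge [uv] is the one whose deletion
    provides the partial coloring. *)
Lemma critical_even_cycle (s : seq V) u v :
  uniq s -> cycle q s -> ~~ odd (size s) -> 2 < size s ->
  {in s, forall x, ~~ light x && (heavy_sum x <= k.+2)} ->
  e u v -> (u \in s) || light u -> (v \in s) || light v ->
  {in s &, forall x y, x != y -> q x y}.
Proof.
move=> us cs es szs crit euv uF vF; have [c0 _] := edge_critical euv.
pose F := [set x in s].
have [||L' [unL szL ncol]] := @critical_residual F u v euv; rewrite ?inE //.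
apply: (@even_cycle_clique V q C (square_sym e_sym) (square_irr e) c0 s L') => // w ws.
have /andP[_ hw] := crit w ws.
have FP : {in F, forall x, ~~ light x} by move=> x; rewrite inE => /crit /andP[].
have E := card_sq_split w FP.
have := leq_trans (square_hdeg w) hw; rewrite E => h.
have := leq_trans h (szL w); rewrite addnC leq_add2r //.
Qed.

(** No walk of length 2 between two other vertices passes through a leaf, so deleting its edge
    leaves only the leaf to color; it is blocked by at most deg w <= k square neighbours. *)
Lemma degree_neq1 v : deg v != 1.
Proof.
apply/negP => /eqP d1; have /card_gt0P[w] : 0 < deg v by rewrite d1.
rewrite inE => evw.
have only x : e v x -> x = w.
  move=> evx; apply/eqP/negPn/negP => xw; have : #|[set x; w]| <= deg v.
    apply/subset_leq_card/subsetP => y; rewrite !inE => /orP[]/eqP->//.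
  by rewrite cards2 xw d1.
have [c0 [c0L c0q]] := edge_critical evw.
have [|L' [unL szL ncol]] := @residual_lists [set v] c0 c0L.
  move=> x y; rewrite !inE => xv yv /andP[xy a]; apply: c0q => //.
  move: a; rewrite /adj_or_common_neighbor /del_edge /= => /orP[exy|/existsP[z /andP[exz ezy]]].
    by rewrite exy (negbTE xv) (negbTE yv) !andbF.
  have zv : z != v.
    apply: contra xy => /eqP zv; rewrite zv in exz ezy.
    by rewrite (only x) 1?e_sym // (only y).
  apply/orP; right; apply/existsP; exists z.
  by rewrite exz ezy (negbTE xv) (negbTE yv) (negbTE zv) !andbF.
have := szL v; case E : (L' v) => [|a l] /=; last first.
  case: ncol; exists (fun=> a); split=> [x|x y]; rewrite !inE => /eqP->; first by rewrite E inE eqxx.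
  by move=> /eqP->; rewrite square_irr.
rewrite add0n => h; have : k.+2 <= degree_sum v.
  apply: leq_trans h (leq_trans _ (square_wdeg v)).
  by apply/subset_leq_card/subsetP => x; rewrite !inE => /andP[].
have -> : degree_sum v = deg w.
  rewrite /degree_sum (bigD1 w) //= big1 ?addn0 // => x /andP[/only->].
  by rewrite eqxx.
by rewrite leqNgt ltnS (leq_trans (e_deg w)).
Qed.

End MinimalCounterexample.

(** * Discharging *)

(* The variables a, b, c, m, g1, g2 are the numbers of neighbours of kinds 0 to 5,
   in the sense of [kind] below; charges are counted in tenths. *)
Lemma deg4_balance k a b c m g1 g2 : 17 <= k -> a + b + c + m + g1 + g2 = 4 ->
  (a + c = 0 \/ k.+2 <= a + 2 * b + 2 * c + 7 * m + 14 * g1 + k * g2) ->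
  30 + (6 * a + 2 * b + c) <= 40 + (6 * g1 + 8 * g2).
Proof. by case: g2 => [|[|g2]] *; lia. Qed.

Lemma deg5_balance k a b c m g1 g2 : 17 <= k -> a + b + c + m + g1 + g2 = 5 ->
  (a + c = 0 \/ k.+2 <= a + 2 * b + 2 * c + 7 * m + 14 * g1 + k * g2) ->
  30 + (6 * a + 4 * b + c) <= 50 + (6 * g1 + 8 * g2).
Proof. by case: g2 => [|[|g2]] *; lia. Qed.

Lemma deg6_balance k a b c m g1 g2 : 17 <= k -> a + b + c + m + g1 + g2 = 6 ->
  (a + c = 0 \/ k.+2 <= a + 2 * b + 2 * c + 7 * m + 14 * g1 + k * g2) ->
  30 + (6 * a + 4 * b + c) <= 60 + (6 * g1 + 8 * g2).
Proof. by case: g2 => [|[|g2]] *; lia. Qed.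

Lemma deg7_balance k a b c m g1 g2 : 17 <= k -> a + b + c + m + g1 + g2 = 7 ->
  (a + c = 0 \/ k.+2 <= a + 2 * b + 2 * c + 7 * m + 14 * g1 + k * g2) ->
  30 + (6 * a + 4 * b + c) <= 70 + (6 * g1 + 8 * g2).
Proof. by case: g2 => [|[|g2]] *; lia. Qed.

(** A vertex of degree 3 starts with charge 0 and can only pass on what it receives. Two light
    neighbours of degree 2 force the third to be of kind 5; the 8 received from it pay 4 to each of
    the two, whence the lower rate. *)
Lemma deg3_balance k a b c m g1 g2 : 17 <= k -> a + b + c + m + g1 + g2 = 3 ->
  k.+2 <= a + 2 * b + 2 * c + 7 * m + 14 * g1 + k * g2 ->
  (if a == 2 then 4 else 6) * a + 2 * b + c <= 6 * g1 + 8 * g2.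
Proof.
case: a => [|[|[|[|a]]]] /=; case: g2 => [|[|g2]] *; lia.
Qed.

Section Discharging.
Variables (V : finType) (e : rel V) (k : nat).
Hypothesis k_ge : 17 <= k.
Hypothesis e_sym : symmetric e.
Local Notation deg := (degree e).
Local Notation light := (light e k).
Local Notation heavy_sum := (heavy_sum e k).
Hypothesis e_deg : forall v, deg v <= k.
Hypothesis deg_neq1 : forall v, deg v != 1.
Hypothesis light_adj : forall u v, e u v -> light u -> ~~ light v.
Hypothesis heavy_hdeg : forall v, ~~ light v -> k.+2 <= heavy_sum v.

Definition twos v := #|[set w | e v w & deg w == 2]|.
Definition light_twos v := [set w | [&& e v w, deg w == 2 & light w]].
Definition weak_threes := [set v | [&& deg v == 3, ~~ light v & #|light_twos v| == 2]].
(* Only the vertices in one of the next three sets can end with negative charge;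
   vertices of degree k compensate for them globally. *)
Definition paired_twos := [set v | (deg v == 2) && [exists w, e v w && (deg w == 2)]].
Definition branch_twos := [set v | (deg v == 2) &&
  [exists w, [&& e v w, deg w == 3, light w & 1 < twos w]]].
Definition weak_light_twos := [set v | [&& deg v == 2, light v & [forall w, e v w ==> (w \in weak_threes)]]].
Definition full_vertices := [set v | deg v == k].

(* The charge sent from v to its neighbour w, when v starts with 10 deg v - 30. *)
Definition sent v w : nat :=
  if 15 <= deg v then 8 else if 8 <= deg v then 6
  else if 4 <= deg v then
    (if deg w == 2 then (if light w then 6 else if deg v == 4 then 2 else 4)
     else ((deg w == 3) && light w : nat))
  else if deg v == 3 then
    if light v then 2 * ((deg w == 2) && (twos v == 1))
    else if deg w == 2 then (if light w then (if v \in weak_threes then 4 else 6) else 2)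
    else ((deg w == 3) && light w : nat)
  else 0.

Lemma deg_ge2 v w : e v w -> 2 <= deg v.
Proof.
move=> /degree_gt0; have := deg_neq1 v; case: (deg v) => [|[|]] //.
Qed.

(** The classification is fine enough for the charge sent to [w], the charge guaranteed from [w] and
    the bound on deg w - light w to depend on the kind alone. *)
Definition kind (w : V) : 'I_6 := inord
  (if deg w == 2 then ~~ light w : nat else if (deg w == 3) && light w then 2
   else if deg w < 8 then 3 else if deg w < 15 then 4 else 5).

Definition nkind v (t : nat) := #|[set w | e v w & kind w == t :> nat]|.

Lemma kindE w : kind w = (if deg w == 2 then ~~ light w : nat else if (deg w == 3) && light w then 2
   else if deg w < 8 then 3 else if deg w < 15 then 4 else 5) :> nat.
Proof. by rewrite /kind inordK //; do !case: ifP => //; case: (light w). Qed.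

Lemma sum_kind v (F : nat -> nat) : \sum_(w | e v w) F (kind w) =
  F 0 * nkind v 0 + F 1 * nkind v 1 + F 2 * nkind v 2 + F 3 * nkind v 3 + F 4 * nkind v 4 + F 5 * nkind v 5.
Proof.
rewrite (partition_big kind predT) //=.
transitivity (\sum_(t < 6) F t * nkind v t).
  apply: eq_bigr => t _; rewrite (eq_bigr (fun=> F t)); last by move=> w /andP[_ /eqP->].
  rewrite sum_nat_const mulnC /nkind; congr (_ * _).
  by apply: eq_card => w; rewrite !inE.
by rewrite !big_ord_recl big_ord0 addn0 !addnA.
Qed.

Lemma deg_kind v : deg v = nkind v 0 + nkind v 1 + nkind v 2 + nkind v 3 + nkind v 4 + nkind v 5.
Proof.
have := sum_kind v (fun=> 1); rewrite !mul1n => <-.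
by rewrite sum1dep_card /degree; apply: eq_card => w; rewrite !inE.
Qed.

(** Each coefficient bounds deg w - light w within its kind. *)
Lemma hdeg_kind v : heavy_sum v <= nkind v 0 + 2 * nkind v 1 + 2 * nkind v 2 + 7 * nkind v 3 +
  14 * nkind v 4 + k * nkind v 5.
Proof.
have := sum_kind v (nth 0 [:: 1; 2; 2; 7; 14; k]); rewrite /= !mul1n => <-.
apply: leq_sum => w evw; rewrite kindE.
have [d2|d2] := eqVneq (deg w) 2; first by rewrite d2; case: (light w).
have [d3|d3] /= := eqVneq (deg w) 3; first by rewrite d3; case: (light w).
case: ifP => [d8|_] /=; first by apply: leq_trans (leq_subr _ _) _.
case: ifP => [d15|_] /=; first by apply: leq_trans (leq_subr _ _) _.
by apply: leq_trans (leq_subr _ _) (e_deg w).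
Qed.

Lemma receive_kind v : 6 * nkind v 4 + 8 * nkind v 5 <= \sum_(w | e v w) sent w v.
Proof.
have := sum_kind v (nth 0 [:: 0; 0; 0; 0; 6; 8]); rewrite /= !mul0n !add0n => <-.
apply: leq_sum => w evw; rewrite kindE /sent.
case d2 : (deg w == 2) => /=; first by case: (light w).
case d3 : ((deg w == 3) && light w) => //=.
case: ltnP => // d8; case: ltnP => // d15; by rewrite d8.
Qed.

Lemma no_light_kind v : light v -> nkind v 0 = 0 /\ nkind v 2 = 0.
Proof.
move=> lv; split; apply/eqP; rewrite cards_eq0; apply/eqP/setP => w; rewrite !inE;
  apply/negP => /andP[/light_adj/(_ lv)/negbTE nl]; rewrite kindE nl andbF.
  by do !case: ifP.
by do !case: ifP.
Qed.

Lemma light_twos_kind v : #|light_twos v| = nkind v 0.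
Proof.
apply: eq_card => w; rewrite !inE kindE; case: (e v w) => //=.
case: (deg w == 2) => /=; first by case: (light w).
by do !case: ifP.
Qed.

Lemma twos_kind v : twos v = nkind v 0 + nkind v 1.
Proof.
rewrite /nkind -cardsUI [X in _ + X](_ : _ = 0) ?addn0; last first.
  apply/eqP; rewrite cards_eq0; apply/eqP/setP => w; rewrite !inE.
  by apply/negP => /andP[/andP[_ /eqP->] /andP[_]].
apply: eq_card => w; rewrite !inE kindE; case: (e v w) => //=.
case: (deg w == 2) => /=; first by case: (light w).
by do !case: ifP.
Qed.

Lemma mid_balance v : 4 <= deg v < 8 ->
  30 + \sum_(w | e v w) sent v w <= 10 * deg v + \sum_(w | e v w) sent w v.
Proof.
move=> /andP[d4 d8].
have out : \sum_(w | e v w) sent v w <= 6 * nkind v 0 + (if deg v == 4 then 2 else 4) * nkind v 1 + nkind v 2.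
  have := sum_kind v (nth 0 [:: 6; (if deg v == 4 then 2 else 4); 1; 0; 0; 0]).
  rewrite /= !mul0n mul1n !addn0 => <-; apply: leq_sum => w evw; rewrite kindE /sent.
  have -> : (15 <= deg v) = false by rewrite leqNgt (leq_trans d8).
  have -> : (8 <= deg v) = false by rewrite leqNgt d8.
  rewrite d4.
  case: (deg w == 2) => /=; first by case: (light w).
  by case: (_ && _).
(* Kinds 0 and 2 consist of light vertices, which a light [v] cannot have as neighbours. *)
have hd : nkind v 0 + nkind v 2 = 0 \/ k.+2 <= heavy_sum v.
  have [lv|/heavy_hdeg] := boolP (light v); last by right.
  by left; have [-> ->] := no_light_kind lv.
have := receive_kind v; have := hdeg_kind v; have := deg_kind v.
move: out hd d4 d8 k_ge.
move: (\sum_(w | _) sent v w) (\sum_(w | _) sent w v) (heavy_sum v) (deg v).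
move: (nkind v 0) (nkind v 1) (nkind v 2) (nkind v 3) (nkind v 4) (nkind v 5).
move=> a b c m g1 g2 o i h d; clear => out hd d4 d8 kge Ed hk rec.
have hd' : a + c = 0 \/ k.+2 <= a + 2 * b + 2 * c + 7 * m + 14 * g1 + k * g2.
  by case: hd => [?|h1]; [left | right; apply: leq_trans h1 hk].
apply: leq_trans (_ : 30 + (6 * a + (if d == 4 then 2 else 4) * b + c) <= _); first by rewrite leq_add2l.
apply: leq_trans (_ : 10 * d + (6 * g1 + 8 * g2) <= _); last by rewrite leq_add2l.
case: d Ed d4 d8 {out} => [|[|[|[|[|[|[|[|d]]]]]]]] //= /esym Ed _ _.
- exact: deg4_balance kge Ed hd'.
- exact: deg5_balance kge Ed hd'.
- exact: deg6_balance kge Ed hd'.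
- exact: deg7_balance kge Ed hd'.
Qed.

Lemma big_balance v : 8 <= deg v ->
  30 + 4 * (v \in full_vertices) + \sum_(w | e v w) sent v w <= 10 * deg v + \sum_(w | e v w) sent w v.
Proof.
move=> d8; apply: leq_trans (leq_addr _ _).
have -> : \sum_(w | e v w) sent v w = (if 15 <= deg v then 8 else 6) * deg v.
  rewrite (eq_bigr (fun=> if 15 <= deg v then 8 else 6)); last by move=> w _; rewrite /sent d8.
  by rewrite sum_nat_const mulnC.
rewrite inE; move: k_ge d8; move: (deg v) => d; clear.
by case: eqP => [->|_]; case: ifP => /= *; lia.
Qed.

Lemma three_balance v : deg v = 3 ->
  30 + \sum_(w | e v w) sent v w <= 10 * deg v + \sum_(w | e v w) sent w v.
Proof.
move=> d3; rewrite d3 leq_add2l.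
have dk := deg_kind v; rewrite d3 in dk.
have [lv | nlv] := boolP (light v).
  have [n0 n2] := no_light_kind lv; rewrite n0 n2 !add0n !addn0 in dk.
  have out : \sum_(w | e v w) sent v w <= 2 * (nkind v 1 == 1).
    have := sum_kind v (nth 0 [:: 0; 2 * (nkind v 1 == 1); 0; 0; 0; 0]).
    rewrite /= !mul0n !addn0 add0n => E; apply: (@leq_trans (2 * (nkind v 1 == 1) * nkind v 1)).
      rewrite -E; apply: leq_sum => w evw; rewrite kindE /sent d3 /= lv twos_kind n0 add0n.
      by rewrite (light_adj evw lv); case: (deg w == 2); rewrite /= ?andbF.
    by case: eqP => [->|].
  (* Every neighbour of degree at least 3 is non-light and sends at least 1; if exactly one
     neighbour has degree 2, the other two cover the 2 sent to it. *)
  have inn : nkind v 3 + nkind v 4 + nkind v 5 <= \sum_(w | e v w) sent w v.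
    have := sum_kind v (nth 0 [:: 0; 0; 0; 1; 1; 1]); rewrite /= !mul0n !add0n !mul1n => <-.
    apply: leq_sum => w evw; have nlw := light_adj evw lv; rewrite kindE /sent d3 lv /=.
    have [d2|d2] := eqVneq (deg w) 2; first by rewrite nlw.
    rewrite (negbTE nlw) andbF /=.
    have w2 : 2 < deg w by rewrite ltn_neqAle eq_sym d2 (@deg_ge2 w v) // e_sym.
    apply: (@leq_trans 1); first by case: ifP => [|_]; [|case: ifP].
    case: ifP => // _; case: ifP => // _; case: ifP => // w4.
    have -> : deg w == 3 by rewrite eqn_leq w2 leqNgt w4.
    by [].
  apply: leq_trans out (leq_trans _ inn); move: dk; clear.
  by case: eqP => [->|] //; lia.
have hv := heavy_hdeg nlv.
have c0 : (v \in weak_threes) = (nkind v 0 == 2) by rewrite inE d3 nlv light_twos_kind.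
apply: leq_trans (receive_kind v).
apply: leq_trans (_ : (if nkind v 0 == 2 then 4 else 6) * nkind v 0 + 2 * nkind v 1 + nkind v 2 <= _).
  have := sum_kind v (nth 0 [:: (if nkind v 0 == 2 then 4 else 6); 2; 1; 0; 0; 0]).
  rewrite /= !mul0n mul1n !addn0 => <-; apply: leq_sum => w evw; rewrite kindE /sent.
  rewrite d3 /= (negbTE nlv) c0.
  case: (deg w == 2) => /=; first by case: (light w).
  by case: (_ && _).
apply: (@deg3_balance k _ _ _ (nkind v 3)) => //.
exact: leq_trans hv (hdeg_kind v).
Qed.

(** The neighbourhood is described by sums over it, the form needed for charges and for [heavy_sum];
    membership is recovered by summing an indicator. *)
Lemma two_nbrs v : deg v = 2 -> exists x w, [/\ e v x, e v w, x != w, deg w <= deg x &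
  forall f : V -> nat, \sum_(y | e v y) f y = f x + f w].
Proof.
move=> d2; have /cards2P[x [w [xw E]]] : #|[set y | e v y]| == 2 by rewrite cardsE -d2.
have mem y : e v y = (y == x) || (y == w).
  by move/setP/(_ y): E; rewrite !inE.
have sumE a b (f : V -> nat) : a != b -> (forall y, e v y = (y == a) || (y == b)) ->
    \sum_(y | e v y) f y = f a + f b.
  move=> ab m; rewrite (bigD1 a) ?m ?eqxx //= (bigD1 b) ?m ?eqxx ?orbT /=; last by rewrite eq_sym.
  rewrite big1 ?addn0 // => y; rewrite m => /andP[/andP[/orP[]/eqP->]]; rewrite eqxx //.
case: (leqP (deg w) (deg x)) => [le|/ltnW le].
  by exists x, w; split; rewrite ?mem ?eqxx ?orbT // => f; apply: sumE.
exists w, x; split; rewrite ?mem ?eqxx ?orbT // 1?eq_sym // => f.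
by apply: sumE => [|y]; [rewrite eq_sym | rewrite mem orbC].
Qed.

(** A neighbour [w] of degree 2 would be non-light with [heavy_sum] at most (2 - 1) + k. *)
Lemma light_two_nbr v w : deg v = 2 -> light v -> e v w -> deg w != 2.
Proof.
move=> d2 lv evw; apply/eqP => dw; have /heavy_hdeg := light_adj evw lv.
have [x [y [ewx ewy xy _ sumE]]] := two_nbrs dw.
rewrite /heavy_sum sumE leqNgt => /negP[].
have bound z : deg z - light z <= k by apply: leq_trans (leq_subr _ _) (e_deg z).
have ewv : e w v by rewrite e_sym.
have : v = x \/ v = y.
  have := sumE (fun z => z == v : nat); rewrite (bigD1 v) //= eqxx.
  by case: eqP => [->|_]; [left | case: eqP => [->|_] //; right].
case=> <-; rewrite d2 lv; have := bound x; have := bound y; move: (deg x - _) (deg y - _); clear; lia.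
Qed.

(** Such a vertex lacks 10. If it is light, each neighbour sends at least 6, or 4 if in
    [weak_threes]. Otherwise the neighbours' degrees add up to at least k + 2 >= 19. A smaller
    degree of at most 4 makes the other at least 15, which sends 8, and 2 are wanted from the
    smaller one; a smaller degree from 5 to 7 gives at least 6 + 4, and above that at least 6 +
    6. *)
Lemma two_balance v : deg v = 2 ->
  30 + \sum_(w | e v w) sent v w <= 10 * deg v + \sum_(w | e v w) sent w v
    + 2 * (v \in paired_twos :|: branch_twos :|: weak_light_twos).
Proof.
move=> d2; rewrite big1 ?addn0 => [|w _]; last by rewrite /sent d2.
have [x [w [evx evw xw dwx sumE]]] := two_nbrs d2.
rewrite d2 sumE -addnA (leq_add2l 20 10).
have d2w y : e v y -> 1 < deg y by move=> evy; rewrite (@deg_ge2 y v) // e_sym.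
have [lv | nlv] := boolP (light v).
  have gy y : e v y -> 4 + 2 * (y \notin weak_threes) <= sent y v.
    move=> evy; have := light_two_nbr d2 lv evy; have := d2w y evy.
    have ny := light_adj evy lv.
    rewrite /sent d2 lv eqxx (negbTE ny).
    case: (ltnP 14 (deg y)) => [|_]; first by case: (y \in weak_threes).
    case: (ltnP 7 (deg y)) => [|_]; first by case: (y \in weak_threes).
    case: (ltnP 3 (deg y)) => [|d3 d1 d2']; first by case: (y \in weak_threes).
    have -> : deg y == 3 by rewrite eqn_leq d3 /= ltn_neqAle eq_sym d2'.
    by case: (y \in weak_threes).
  apply: (@leq_trans (4 + 2 * (x \notin weak_threes) + (4 + 2 * (w \notin weak_threes)) + 2 * (v \in paired_twos :|: branch_twos :|: weak_light_twos))).
    case xC: (x \in weak_threes); last by case: (w \in weak_threes).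
    case wC: (w \in weak_threes) => //.
    suff -> : v \in paired_twos :|: branch_twos :|: weak_light_twos by [].
    rewrite !in_setU; apply/orP; right; rewrite inE d2 lv /=; apply/forallP => y; apply/implyP => evy.
    have := sumE (fun z => z == y : nat); rewrite (bigD1 y) //= eqxx.
    by case: eqP => [<-|_] //; case: eqP => [<-|_].
  by rewrite leq_add2r; apply: leq_add; apply: gy.
have := heavy_hdeg nlv; rewrite /heavy_sum sumE => hv.
have gx : (if 15 <= deg x then 8 else if 8 <= deg x then 6 else 0) <= sent x v.
  by rewrite /sent; case: ifP => // _; case: ifP.
case dw : (deg w) (d2w w evw) => [|[|[|[|[|dw']]]]] // _.
- have -> : v \in paired_twos :|: branch_twos :|: weak_light_twos.
    rewrite !in_setU; apply/orP; left; apply/orP; left; rewrite inE d2 /=.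
    by apply/existsP; exists w; rewrite evw dw.
  move: gx hv; rewrite dw; move: (sent x v) (sent w v) (deg x) k_ge => a b d; clear.
  by move: (light x : nat) (light w : nat) => l1 l2; case: ifP => *; lia.
- have [lw | nlw] := boolP (light w).
    rewrite dw lw in hv.
    have d17 : 14 < deg x by move: hv k_ge; move: (deg x) (light x : nat); clear; lia.
    rewrite d17 in gx; have [t1 | t1] := eqVneq (twos w) 1.
      apply: leq_trans (leq_addr _ _); apply: leq_trans (leq_add gx (leqnn _)).
      by rewrite /sent dw lw d2 t1.
    have -> : v \in paired_twos :|: branch_twos :|: weak_light_twos.
      rewrite !in_setU; apply/orP; left; apply/orP; right; rewrite inE d2 /=.
      apply/existsP; exists w; rewrite evw dw lw /= ltn_neqAle eq_sym t1 /=.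
      by apply/card_gt0P; exists v; rewrite inE e_sym evw d2.
    by rewrite -[10]/(8 + 0 + 2); apply: leq_add => //; apply: leq_add.
  have d17 : 14 < deg x by move: hv k_ge; rewrite dw; move: (deg x) (light x : nat) (light w : nat); clear; lia.
  rewrite d17 in gx; apply: leq_trans (leq_addr _ _); apply: leq_trans (leq_add gx (leqnn _)).
  by rewrite /sent dw (negbTE nlw) d2 (negbTE nlv).
- have d17 : 14 < deg x by move: hv k_ge; rewrite dw; move: (deg x) (light x : nat) (light w : nat); clear; lia.
  rewrite d17 in gx; apply: leq_trans (leq_addr _ _); apply: leq_trans (leq_add gx (leqnn _)).
  by rewrite /sent dw d2 (negbTE nlv).
apply: leq_trans (leq_addr _ _); have [d8 | d8] := ltnP 7 (deg w).
  have gw : 6 <= sent w v by rewrite /sent; case: ifP => // _; rewrite d8.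
  have dx8 := leq_trans d8 dwx; rewrite dx8 in gx.
  by apply: leq_trans (leq_add gx gw); case: ifP.
have d12 : 7 < deg x by move: hv k_ge d8; move: (deg w) (deg x) (light x : nat) (light w : nat); clear; lia.
rewrite d12 in gx; apply: (@leq_trans (6 + 4)) => //; apply: leq_add.
  by apply: leq_trans gx; case: ifP.
rewrite /sent d2 (negbTE nlv) dw; rewrite dw in d8.
by clear dw; case: dw' d8 => [|[|[|dw']]].
Qed.

(** Over the non-isolated vertices the initial charges add up to at most -30, and moving charge
    preserves the total. Final charges are at least 4 times the indicator of [full_vertices] minus
    twice that of the defects. *)
Theorem discharge : \sum_v deg v + 3 <= 3 * #|[set v | [exists w, e v w]]| ->
  4 * #|full_vertices| < 2 * #|paired_twos :|: branch_twos :|: weak_light_twos|.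
Proof.
set S := [set v | _]; set W := _ :|: _ => sparse.
have bal v : v \in S -> 30 + 4 * (v \in full_vertices) + \sum_(w | e v w) sent v w <=
    10 * deg v + \sum_(w | e v w) sent w v + 2 * (v \in W).
  rewrite inE => /existsP[w evw]; have d2 := deg_ge2 evw.
  have [d8 | d8] := leqP 8 (deg v).
    by apply: leq_trans (leq_addr _ _); apply: big_balance.
  have -> : (v \in full_vertices) = false.
    by rewrite inE; apply: contraTF d8 => /eqP->; rewrite -leqNgt (leq_trans _ k_ge).
  rewrite muln0 addn0; have [d4 | d4] := leqP 4 (deg v).
    by apply: leq_trans (leq_addr _ _); apply: mid_balance; rewrite d4.
  have [E3|n3] := eqVneq (deg v) 3; first by apply: leq_trans (leq_addr _ _); apply: three_balance.
  by apply: two_balance; apply/eqP; rewrite eqn_leq d2 andbT -ltnS ltn_neqAle n3.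
have outS v : v \notin S -> deg v = 0 /\ forall f : V -> nat, \sum_(w | e v w) f w = 0.
  rewrite inE => /existsPn no; split; last by move=> f; rewrite big1 // => w; rewrite (negbTE (no w)).
  by apply: eq_card0 => w; rewrite !inE (negbTE (no w)).
have bal' v : 30 * (v \in S) + 4 * (v \in full_vertices) + \sum_(w | e v w) sent v w <=
    10 * deg v + \sum_(w | e v w) sent w v + 2 * (v \in W).
  have [/bal//|vS] := boolP (v \in S).
  have [d0 s0] := outS v vS; rewrite !s0 d0 inE d0.
  by move: k_ge; case: (k).
have split3 (f g h : V -> nat) : \sum_v (f v + g v + h v) = \sum_v f v + \sum_v g v + \sum_v h v.
  by rewrite !big_split.
have := @leq_sum V (index_enum V) predT _ _ (fun v _ => bal' v).
rewrite (split3 (fun v => 30 * (v \in S))) (split3 (fun v => 10 * deg v)).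
have cnt (D : {set V}) : \sum_v (v \in D) = #|D| by rewrite -sum1_card [RHS]big_mkcond /=.
have cntM a (D : {set V}) : \sum_v a * (v \in D) = a * #|D| by rewrite -cnt big_distrr.
rewrite !cntM -(big_distrr 10) /=.
have -> : \sum_v \sum_(w | e v w) sent w v = \sum_v \sum_(w | e v w) sent v w.
  rewrite (exchange_big_dep predT) //=; apply: eq_bigr => v _; apply: eq_bigl => w.
  by rewrite e_sym.
move: sparse; move: #|S| #|full_vertices| #|W| (\sum_v deg v) (\sum_v _); clear; lia.
Qed.

End Discharging.

(** * Counting the defects of a minimal counterexample *)

(** Extend a path at its head [x] while possible. When both neighbours of [x] lie on the path, one
    of them is not the vertex next to [x], and it closes a cycle of length at least 3. *)
Lemma exists_cycle (T : finType) (r : rel T) (P : {set T}) (x0 : T) :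
  symmetric r -> irreflexive r -> x0 \in P ->
  {in P, forall x, exists y z, [/\ y \in P, z \in P, y != z, r x y & r x z]} ->
  exists c, [/\ uniq c, 2 < size c, cycle r c & {subset c <= P}].
Proof.
move=> r_sym r_irr x0P deg.
have grow n : (exists c, [/\ uniq c, 2 < size c, cycle r c & {subset c <= P}]) \/
    (exists x p, [/\ uniq (x :: p), path r x p, {subset x :: p <= P} & size p = n]).
  elim: n => [|n [|[x [p [up pp sP szp]]]]]; [right|by left|].
    by exists x0, [::]; split=> // y; rewrite inE => /eqP->.
  have [y [z [yP zP yz rxy rxz]]] := deg x (sP x (mem_head x p)).
  have ext w : w \in P -> r x w -> w \notin p -> exists x p, [/\ uniq (x :: p), path r x p, {subset x :: p <= P} & size p = n.+1].
    move=> wP rxw wp; exists w, (x :: p); split=> //=.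
    - rewrite inE negb_or wp andbT /=; move: up => /= ->; rewrite andbT.
      by apply: contraTneq rxw => ->; rewrite r_irr.
    - by rewrite r_sym rxw.
    - by move=> u; rewrite inE => /orP[/eqP->|/sP].
    - by rewrite szp.
  have [yp | ynp] := boolP (y \in p); last by right; apply: ext rxy ynp.
  have [zp | znp] := boolP (z \in p); last by right; apply: ext rxz znp.
  left.
  have close w : w \in p -> r x w -> 0 < index w p ->
      exists c, [/\ uniq c, 2 < size c, cycle r c & {subset c <= P}].
    move=> wp rxw i0; have ltw : index w p < size p by rewrite index_mem.
    have szt : size (take (index w p).+1 p) = (index w p).+1 by rewrite size_takel.
    exists (x :: take (index w p).+1 p); split.
    - move: up => /= /andP[xp up]; rewrite take_uniq // andbT.
      by apply: contra xp => /mem_take.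
    - by rewrite /= szt.
    - rewrite /= rcons_path take_path //= -nth_last szt /= nth_take // (set_nth_default w) //.
      by rewrite nth_index // r_sym.
    - by move=> u; rewrite inE => /orP[/eqP->|/mem_take up']; apply: sP; rewrite inE ?eqxx ?up' ?orbT.
  have [iy | iy] := posnP (index y p); last exact: close yp rxy iy.
  have [iz | iz] := posnP (index z p); last exact: close zp rxz iz.
  by move: yz; rewrite -(nth_index y yp) -(nth_index y zp) iy iz eqxx.
case: (grow #|T|) => // -[x [p [up _ _ sz]]].
have := max_card (mem (x :: p)); rewrite (card_uniqP up) /= sz.
by rewrite ltnn.
Qed.

Lemma next_next_neq (T : eqType) (c : seq T) x :
  uniq c -> 2 < size c -> x \in c -> next c (next c x) != x.
Proof.
move=> uc sz xc; case: (rot_to xc) => i p Ei.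
rewrite -!(next_rot i uc) Ei.
have : uniq (x :: p) by rewrite -Ei rot_uniq.
have : size (x :: p) = size c by rewrite -Ei size_rot.
case: p {Ei} => [|y [|z p]] /=; [by move=> E; rewrite -E in sz|by move=> E; rewrite -E in sz|].
move=> _; rewrite !inE !negb_or !eqxx => /and4P[/and3P[xy xz xp] _ _ _].
by rewrite [y == x]eq_sym (negbTE xy) eq_sym.
Qed.

(** * Links between the classes of [full_nbr], and the forest they form *)

Section Links.
Variables (V : finType) (q : rel V) (Bd : {set V}) (full_nbr : V -> V).
Hypothesis q_sym : symmetric q.

(** Square adjacency that is not due to a common full neighbour; vertices of one class of [full_nbr]
    are square-adjacent anyway. *)
Definition link : rel V := [rel v w | [&& v \in Bd, w \in Bd, q v w & full_nbr v != full_nbr w]].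

Hypothesis same_kn : {in Bd &, forall v w, v != w -> full_nbr v = full_nbr w -> q v w}.
Hypothesis link_degree : forall v, #|[set w | link v w]| <= 2.
Hypothesis even_clique : forall (s : seq V) x y,
  uniq s -> cycle q s -> ~~ odd (size s) -> 2 < size s -> {subset s <= Bd} ->
  x \in s -> y \in s -> link x y -> {in s &, forall v w, v != w -> q v w}.

Lemma link_relation_sym : symmetric link.
Proof. by move=> v w; rewrite /link /= q_sym [full_nbr v == _]eq_sym; do !bool_congr. Qed.

Lemma link_neq v w : link v w -> v != w.
Proof. by case/and4P => _ _ _; apply: contraNneq => ->. Qed.

(* The vertices lying in a 4-clique of q that meets two classes of full_nbr in two
   vertices each: these cliques are the only even cycles that may be uncolorable. *)
Definition square_core : {set V} := [set v | [exists v', [exists w, [exists w',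
  [&& v' \in Bd, v' != v, full_nbr v' == full_nbr v, w != w' &
   [&& full_nbr w == full_nbr w', link v w, link v w', link v' w & link v' w']]]]]].

(** In the clique given by [even_clique], a vertex is linked to everything outside its own class,
    hence at most two vertices lie outside. Applied to [x] and [y], whose classes are disjoint, this
    leaves two classes of two vertices each. *)
Lemma even_cycle_core (s : seq V) x y :
  uniq s -> cycle q s -> ~~ odd (size s) -> 2 < size s -> {subset s <= Bd} ->
  x \in s -> y \in s -> link x y -> {subset s <= square_core}.
Proof.
move=> us cs es szs sB xs ys lxy; have cl := even_clique us cs es szs sB xs ys lxy.
pose F := [set z in s]; pose cls v := [set z in F | full_nbr z == full_nbr v].
have cF : #|F| = size s by rewrite cardsE (card_uniqP us).
have split v : v \in s -> #|F| <= #|cls v| + 2.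
  move=> vs; rewrite -(cardsID [set z | full_nbr z == full_nbr v]) leq_add //.
    by apply/subset_leq_card/subsetP => z; rewrite !inE.
  apply: leq_trans (link_degree v); apply/subset_leq_card/subsetP => z; rewrite !inE => /andP[nk zs].
  rewrite /link /= !sB // [full_nbr v == _]eq_sym nk andbT; apply: cl => //.
  by apply: contraNneq nk => ->.
have kxy : full_nbr x != full_nbr y by case/and4P: lxy.
have disj : #|cls x| + #|cls y| <= #|F|.
  rewrite -cardsUI [X in _ + X](_ : _ = 0) ?addn0.
    by apply/subset_leq_card/subsetP => z; rewrite !inE => /orP[]/andP[].
  apply/eqP; rewrite cards_eq0; apply/eqP/setP => z; rewrite !inE; apply/negP.
  by move=> /andP[/andP[_ /eqP E] /andP[_]]; rewrite E (negbTE kxy).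
have [c4 [c2x c2y]] : #|F| = 4 /\ #|cls x| = 2 /\ #|cls y| = 2.
  have := split x xs; have := split y ys; move: disj szs es; rewrite -cF.
  move: #|F| #|cls x| #|cls y| => f a b; clear; lia.
have cover z : z \in s -> (full_nbr z == full_nbr x) || (full_nbr z == full_nbr y).
  move=> zs; have E : cls x :|: cls y = F.
    apply/eqP; rewrite eqEcard; apply/andP; split.
      by apply/subsetP => t; rewrite !inE => /orP[]/andP[].
    have E0 : cls x :&: cls y = set0.
      apply/setP => t; rewrite !inE; apply/negP.
      by move=> /andP[/andP[_ /eqP E] /andP[_]]; rewrite E (negbTE kxy).
    by rewrite cardsU E0 cards0 subn0 c2x c2y c4.
  by have : z \in F by [rewrite inE]; rewrite -E !inE zs.
have lkF v w : v \in s -> w \in s -> full_nbr v != full_nbr w -> link v w.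
  move=> vs ws k; rewrite /link /= !sB // cl //=; apply: contraNneq k => ->; exact: eqxx.
have fin a b v : a \in s -> b \in s -> full_nbr a != full_nbr b -> #|cls a| = 2 -> #|cls b| = 2 ->
    v \in s -> full_nbr v == full_nbr a -> v \in square_core.
  move=> as' bs kab c2a c2b vs /eqP va.
  have [v' v'c v'v] : exists2 v', v' \in cls a & v' != v.
    have : 0 < #|cls a :\ v|.
      by have := cardsD1 v (cls a); rewrite c2a !inE vs va eqxx /=; case: #|_|.
    by case/card_gt0P => v'; rewrite in_setD1 => /andP[h1 h2]; exists v'.
  move/eqP: c2b => /cards2P[w [w' [ww' E]]].
  have /andP[ws /eqP wb] : (w \in s) && (full_nbr w == full_nbr b).
    by have : w \in cls b by [rewrite E !inE eqxx]; rewrite !inE.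
  have /andP[w's /eqP w'b] : (w' \in s) && (full_nbr w' == full_nbr b).
    by have : w' \in cls b by [rewrite E !inE eqxx orbT]; rewrite !inE.
  move: v'c; rewrite !inE => /andP[v's /eqP v'a].
  apply/existsP; exists v'; apply/existsP; exists w; apply/existsP; exists w'.
  by rewrite sB // v'v ww' v'a va wb w'b !eqxx /= !lkF ?v'a ?va ?wb ?w'b.
move=> v vs; case/orP: (cover v vs) => k; first exact: (fin x y v).
by apply: (fin y x v) => //; rewrite eq_sym.
Qed.

(** A third vertex [z] of the class would give the 4-cycle v, z, v', w; by [even_clique] it would be
    linked to [w], which already has the links [v] and [v']. *)
Lemma core_class v : v \in square_core ->
  #|[set z in Bd | full_nbr z == full_nbr v]| <= 2 /\ {in Bd, forall z, full_nbr z = full_nbr v -> z \in square_core}.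
Proof.
rewrite inE => /existsP[v' /existsP[w /existsP[w' /and5P[v'B v'v /eqP kv' ww']]]].
case/and5P => /eqP kw lvw lvw' lv'w lv'w'.
have vB : v \in Bd by case/and4P: lvw.
have wB : w \in Bd by case/and4P: lvw.
have only z : z \in Bd -> full_nbr z = full_nbr v -> z = v \/ z = v'.
  move=> zB kz; have [->|zv] := eqVneq z v; first by left.
  have [->|zv'] := eqVneq z v'; first by right.
  have zw : z != w.
    by apply: contraTneq lvw => zw; rewrite /link /= -kz zw eqxx !andbF.
  have wv := link_neq lvw; have wv' := link_neq lv'w.
  have us : uniq [:: v; z; v'; w].
    by rewrite /= !inE !negb_or [v == z]eq_sym zv [v == v']eq_sym v'v wv zv' zw wv'.
  have q1 : q v z by apply: same_kn => //; rewrite eq_sym.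
  have q2 : q z v' by apply: same_kn => //; rewrite kz.
  have q3 : q v' w by case/and4P: lv'w.
  have q4 : q w v by rewrite q_sym; case/and4P: lvw.
  have sB : {subset [:: v; z; v'; w] <= Bd}.
    by move=> x; rewrite !inE => /or4P[]/eqP->.
  have cl := @even_clique _ v w us _ isT isT sB _ _ lvw.
  have lzw : link z w.
    rewrite /link /= zB wB kz; case/and4P: lvw => _ _ _ ->; rewrite andbT /=.
    by apply: cl => //; rewrite /= ?inE ?eqxx ?orbT ?q1 ?q2 ?q3 ?q4.
  have : #|[set z; v; v']| <= 2.
    apply: leq_trans (link_degree w); apply/subset_leq_card/subsetP => x; rewrite !inE.
    by case/orP => [/orP[]|] /eqP->; rewrite link_relation_sym.
  by rewrite setUC cardsU1 cards2 !inE negb_or [v' == z]eq_sym zv' v'v zv.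
split.
  apply: (@leq_trans #|[set v; v']|); last by rewrite cards2; case: eqP.
  by apply/subset_leq_card/subsetP => z; rewrite !inE => /andP[zB /eqP/(only z zB)[]->]; rewrite eqxx ?orbT.
move=> z zB kz; case: (only z zB kz) => ->; rewrite inE; apply/existsP.
  exists v'; apply/existsP; exists w; apply/existsP; exists w'.
  by rewrite v'B v'v kv' eqxx ww' kw eqxx lvw lvw' lv'w lv'w'.
exists v; apply/existsP; exists w; apply/existsP; exists w'.
by rewrite vB eq_sym v'v kv' eqxx ww' kw eqxx lvw lvw' lv'w lv'w'.
Qed.

(** Both links of [v] already lie inside its 4-clique, in which the two classes play symmetric
    roles. *)
Lemma core_lk v z : v \in square_core -> link v z -> z \in square_core.
Proof.
rewrite inE => /existsP[v' /existsP[w /existsP[w' /and5P[v'B v'v /eqP kv' ww']]]].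
case/and5P => /eqP kw lvw lvw' lv'w lv'w' lvz.
have wB : w \in Bd by case/and4P: lvw.
have w'B : w' \in Bd by case/and4P: lvw'.
have [zw | zw] := eqVneq z w; last have [zw' | zw'] := eqVneq z w'.
- rewrite zw inE; apply/existsP; exists w'; apply/existsP; exists v; apply/existsP; exists v'.
  by rewrite w'B eq_sym ww' kw eqxx eq_sym v'v kv' eqxx ![link w _]link_relation_sym ![link w' _]link_relation_sym lvw lvw' lv'w lv'w'.
- rewrite zw' inE; apply/existsP; exists w; apply/existsP; exists v; apply/existsP; exists v'.
  by rewrite wB ww' kw eqxx eq_sym v'v kv' eqxx ![link w _]link_relation_sym ![link w' _]link_relation_sym lvw lvw' lv'w lv'w'.
have : #|[set z; w; w']| <= 2.
  apply: leq_trans (link_degree v); apply/subset_leq_card/subsetP => x; rewrite !inE.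
  by case/orP => [/orP[]|] /eqP->.
by rewrite setUC cardsU1 cards2 !inE negb_or ![_ == z]eq_sym zw' ![w' == _]eq_sym ww' zw.
Qed.

(** An odd number of steps means an even number of vertices, so a cycle composed of such paths in
    disjoint connectors has even length. *)
Definition linkable (c : {set V}) : Prop := {in c &, forall a z, a != z ->
  exists p, [/\ uniq (a :: p), path link a p, last a p = z, odd (size p) & {subset p <= c}]}.

Section Peeling.
Variable P : {set {set V}}.
Hypothesis P_triv : trivIset P.
Hypothesis P_0 : set0 \notin P.
Hypothesis P_sub : forall c, c \in P -> c \subset Bd :\: square_core.
Hypothesis P_link : forall c, c \in P -> linkable c.

Let blk := pblock P.

Let blkP v : v \in cover P -> [/\ blk v \in P, v \in blk v & v \in Bd].
Proof.
move=> vP; have bP : blk v \in P by rewrite pblock_mem.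
have vb : v \in blk v by rewrite mem_pblock.
by split=> //; have /subsetP/(_ v vb) := P_sub bP; rewrite inE => /andP[].
Qed.

(** A pair holds the vertices where a walk enters and leaves one block; [rho] lets the walk pass to
    the next block inside a class of [full_nbr]. *)
Let ok (pr : V * V) := [&& pr.1 \in cover P, pr.2 \in cover P, pr.1 != pr.2 & blk pr.1 == blk pr.2].
Let rho : rel (V * V) := [rel x y | full_nbr x.2 == full_nbr y.1].

(** Odd link paths through the blocks are joined by square steps inside classes. The last clause
    records that [pr.1] is linked to some [y] on the path, which is the end point if the path has
    one step; [no_closed] uses it to exclude a degenerate cycle. *)
Let splice pr ps : all ok (pr :: ps) -> path rho pr ps -> uniq [seq blk x.1 | x <- pr :: ps] ->
  exists s, [/\ uniq (pr.1 :: s), path q pr.1 s, last pr.1 s = (last pr ps).2, odd (size s) &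
    {in pr.1 :: s, forall x, x \in cover P /\ blk x \in [seq blk y.1 | y <- pr :: ps]} /\
    exists2 y, y \in s & link pr.1 y /\ (size s = 1 -> y = last pr.1 s)].
Proof.
elim: ps pr => [|pr' ps IH] [a z] /=.
  rewrite andbT => /and4P[/= aP zP az /eqP bz] _ _.
  have [bP ab aB] := blkP aP; have [_ zb _] := blkP zP; rewrite -bz in zb.
  have [p [up pp lp op sp]] := P_link bP ab zb az.
  exists p; split=> //; [|split].
  - by apply: sub_path pp => x y /and4P[].
  - move=> x xp; have xb : x \in blk a by move: xp; rewrite inE => /orP[/eqP->//|/sp].
    split; first by apply/bigcupP; exists (blk a).
    by rewrite mem_seq1; apply/eqP; exact: (def_pblock P_triv bP xb).
  - by case: p up pp lp op sp => //= y p _ /andP[ay _] _ _ _; exists y; rewrite ?inE ?eqxx //; split=> // -[/size0nil->].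
case/and3P => ok1 ok2 okps /andP[/eqP kz pps] /andP[nb ub].
have [s [us ps' ls os [ins _]]] := IH pr' (introT andP (conj ok2 okps)) pps ub.
case/and4P: ok1 => /= aP zP az /eqP bz.
have [bP ab aB] := blkP aP; have [_ zb zB] := blkP zP; rewrite -bz in zb.
have [p [up pp lp op sp]] := P_link bP ab zb az.
have inb x : x \in a :: p -> x \in cover P /\ blk x = blk a.
  move=> xp; have xb : x \in blk a by move: xp; rewrite inE => /orP[/eqP->//|/sp].
  split; first by apply/bigcupP; exists (blk a).
  exact: (def_pblock P_triv bP xb).
have disj x : x \in pr'.1 :: s -> x \notin a :: p.
  by move=> /ins[_ bx]; apply: contra nb => /inb[_ <-].
exists (p ++ pr'.1 :: s); split; last split.
- rewrite -[_ && _]/(uniq ((a :: p) ++ pr'.1 :: s)) cat_uniq up us andbT /=.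
  have := disj pr'.1; rewrite mem_head => /(_ isT) d1; rewrite negb_or d1 /=.
  by apply/hasPn => x xs; apply: disj; rewrite inE xs orbT.
- rewrite cat_path lp /= ps' andbT; apply/andP; split.
    by apply: sub_path pp => x y /and4P[].
  have [pP' _] := ins _ (mem_head _ _); have [_ _ pB] := blkP pP'.
  apply: same_kn => //; have := disj pr'.1 (mem_head _ _).
  by apply: contraNneq => <-; rewrite -lp mem_last.
- by rewrite last_cat /= ls.
- by rewrite size_cat /= oddD op /= os.
- move=> x; rewrite -cat_cons mem_cat => /orP[/inb[xP ->]|/ins[xP bx]]; split=> //.
    by rewrite inE eqxx.
  by rewrite inE bx orbT.
- case: p {inb disj} up pp lp op sp => //= y p _ /andP[ay _] _ _ _; exists y; rewrite ?inE ?eqxx //.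
  by split=> //; rewrite size_cat /= addnS => -[].
Qed.

(** Equal classes at the two ends close the path into an even cycle of the square, which
    [even_cycle_core] puts inside the core, while blocks avoid the core. *)
Let no_closed pr ps : all ok (pr :: ps) -> path rho pr ps -> uniq [seq blk x.1 | x <- pr :: ps] ->
  full_nbr (last pr ps).2 = full_nbr pr.1 -> False.
Proof.
move=> okps pps ub close; have [s [us pp ls os [ins [y ys [ly sz1]]]]] := splice okps pps ub.
have sB : {subset pr.1 :: s <= Bd} by move=> x /ins[/blkP[]].
have s0 : s != [::] by case: (s) os.
have szs : 2 < size (pr.1 :: s).
  case: (s) os sz1 ly ls => [|x [|x' l]] //= _ /(_ erefl) -> /and4P[_ _ _ k] ls.
  by rewrite ls close eqxx in k.
have cyc : cycle q (pr.1 :: s).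
  rewrite /= rcons_path pp /=.
  have lB : last pr.1 s \in Bd by apply: sB; rewrite mem_last.
  apply: (same_kn lB); [by rewrite sB ?mem_head | | by rewrite ls].
  case/andP: us => + _; apply: contraNneq => E; rewrite -{1}E.
  by case: (s) s0 => // x l _ /=; rewrite mem_last.
have y' : y \in pr.1 :: s by rewrite inE ys orbT.
have := @even_cycle_core _ pr.1 y us cyc _ szs sB (mem_head _ _) y' ly pr.1 (mem_head _ _).
rewrite /= os => /(_ isT) core; have [prP _] := ins _ (mem_head _ _).
have [bP vb _] := blkP prP; have /subsetP/(_ _ vb) := P_sub bP.
by rewrite inE core.
Qed.

(* If the bipartite incidence graph between the blocks of P and the values of full_nbr
   contained a cycle, splicing odd link paths through its blocks would yield an
   even q-cycle outside the core. *)
Lemma link_forest : \sum_(c in P) (#|c| - 1) <= #|full_nbr @: cover P|.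
Proof.
rewrite leqNgt; apply/negP => big.
(* A vertex v of the cover is an edge of the bipartite graph, from [blk v] to [full_nbr v]; a big
   set has more edges than end points. The cover has as many elements as the sum of the |c| - 1 plus
   |P|, so it is big, and a minimal big set has no end point of degree 1. *)
pose bigset (S : {set V}) := (S \subset cover P) && (#|full_nbr @: S| + #|blk @: S| < #|S|).
have big0 : bigset (cover P).
  rewrite /bigset subxx /=.
  have cP : #|cover P| = \sum_(c in P) (#|c| - 1) + #|P|.
    rewrite -(eqP P_triv) -sum1_card -big_split /=; apply: eq_bigr => c cP.
    by rewrite subnK // card_gt0; apply: contraNneq P_0 => <-.
  rewrite cP -addSn; apply: leq_add; first exact: big.
  apply/subset_leq_card/subsetP => c /imsetP[v vP ->]; by have [] := blkP vP.
case: (arg_minnP (fun S : {set V} => #|S|) big0) => S /andP[SP bigS] minS.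
have drop v : v \in S -> (full_nbr v \notin full_nbr @: (S :\ v)) || (blk v \notin blk @: (S :\ v)) -> False.
  move=> vS nv; have SE : S = v |: S :\ v by rewrite setD1K.
  have cS : #|S| = #|S :\ v|.+1 by rewrite (cardsD1 v S) vS.
  suff /minS : bigset (S :\ v) by rewrite cS ltnn.
  rewrite /bigset (subset_trans (subsetDl _ _) SP) /= -ltnS -cS.
  apply: leq_ltn_trans bigS; rewrite {3 4}SE !imsetU1 !cardsU1.
  by case/orP: nv => ->; rewrite ?add1n ?addSn ?addnS ltnS ?leq_add2l ?leq_add2r ?leq_add ?leq_addl.
have other_kn v : v \in S -> exists w, [/\ w \in S, w != v & full_nbr w = full_nbr v].
  move=> vS; case: (boolP (full_nbr v \in full_nbr @: (S :\ v))) => [/imsetP[w]|nv].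
    by rewrite !inE => /andP[wv wS] E; exists w.
  by exfalso; apply: (drop v vS); rewrite nv.
have other_blk v : v \in S -> exists w, [/\ w \in S, w != v & blk w = blk v].
  move=> vS; case: (boolP (blk v \in blk @: (S :\ v))) => [/imsetP[w]|nv].
    by rewrite !inE => /andP[wv wS] E; exists w.
  by exfalso; apply: (drop v vS); rewrite nv orbT.
have SP' v : v \in S -> v \in cover P by apply: (subsetP SP).
have [v0 v0S] : exists v, v \in S by apply/set0Pn; rewrite -card_gt0; apply: leq_trans bigS.
(* Walk backwards through the minimal big set, prepending a pair for each new block; the blocks are
   finitely many, so one is met again, which closes the walk. *)
have grow n : exists pr ps, [/\ all ok (pr :: ps), path rho pr ps,
    uniq [seq blk x.1 | x <- pr :: ps], pr.1 \in S & size ps = n].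
  elim: n => [|n [[a z] [ps [okps pps ub aS szp]]]].
    have [w [wS wv bw]] := other_blk v0 v0S.
    by exists (v0, w), [::]; split; rewrite //= /ok /= !SP' // eq_sym wv bw eqxx.
  have [a' [a'S a'a ka']] := other_kn a aS.
  have [y [yS ya' by']] := other_blk a' a'S.
  have [inb | nb] := boolP (blk a' \in [seq blk x.1 | x <- (a, z) :: ps]); last first.
    exists (y, a'), ((a, z) :: ps); split=> //.
    - by rewrite /= in okps *; rewrite okps /ok /= !SP' // ya' by' eqxx.
    - by apply/andP; split=> //; apply/eqP.
    - by rewrite map_cons cons_uniq by' nb.
    - by rewrite /= szp.
  exfalso; case/mapP: inb => -[ai zi] inps /= bi.
  have aP := SP' a aS; have a'P := SP' a' a'S.
  move: inps; rewrite inE => /orP[/eqP[E1 _]|].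
    apply: (@no_closed (a, a') [::]) => //=; rewrite andbT /ok /= aP a'P eq_sym a'a bi E1.
    exact: eqxx.
  move=> inps; case/splitPr: inps okps pps ub szp => l r okps pps ub _.
  move: okps; rewrite /= all_cat /= => /andP[ok1 /andP[okl /andP[oki _]]].
  move: pps; rewrite cat_path /= => /andP[pl /andP[/eqP ki _]].
  have ub' : uniq [seq blk x.1 | x <- (a, z) :: rcons l (ai, a')].
    move: ub; rewrite !map_cons map_cat map_cons map_rcons -cat_rcons -cat_cons cat_uniq.
    by case/and3P.
  (* The walk meets the block of [ai] again at [a']: that block is crossed from [ai] to [a'], or
     left out when the two coincide. *)
  have [E | ne] := eqVneq ai a'.
    apply: (@no_closed (a, z) l) => //=; first by rewrite ok1 okl.
      by move: ub; rewrite map_cons map_cat -cat_cons cat_uniq => /and3P[].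
    by rewrite ki E ka'.
  apply: (@no_closed (a, z) (rcons l (ai, a'))) => //=.
  - rewrite all_rcons ok1 okl /= andbT /ok /= a'P ne bi eqxx /= andbT.
    by case/and4P: oki.
  - by rewrite rcons_path pl; apply/eqP; exact: ki.
  - by rewrite last_rcons.
have [pr [ps [_ _ ub _ szp]]] := grow #|{set V}|.
have := max_card (mem [seq blk x.1 | x <- pr :: ps]).
by rewrite (card_uniqP ub) size_map /= szp ltnn.
Qed.

End Peeling.
End Links.

(** * The connectors of a minimal counterexample *)

Section Global.
Variables (V : finType) (e : rel V) (k : nat).
Hypothesis k_ge : 17 <= k.
Hypothesis e_sym : symmetric e.
Hypothesis e_irr : irreflexive e.
Local Notation deg := (degree e).
Local Notation light := (light e k).
Local Notation heavy_sum := (heavy_sum e k).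
Local Notation q := (square e).
Hypothesis e_deg : forall v, deg v <= k.
Hypothesis light_adj : forall u v, e u v -> light u -> ~~ light v.
Hypothesis heavy_hdeg : forall v, ~~ light v -> k.+2 <= heavy_sum v.
Hypothesis even_cycle : forall s u v, uniq s -> cycle q s -> ~~ odd (size s) -> 2 < size s ->
  {in s, forall x, ~~ light x && (heavy_sum x <= k.+2)} ->
  e u v -> (u \in s) || light u -> (v \in s) || light v ->
  {in s &, forall x y, x != y -> q x y}.
Hypothesis no_triangle : forall x y z, e x y -> e y z -> e z x -> False.
Hypothesis no_square : forall a b c d, a != c -> b != d ->
  e a b -> e b c -> e c d -> e d a -> False.

Local Notation A := (paired_twos e).
Local Notation B := (branch_twos e k).
Local Notation C := (weak_threes e k).
Local Notation CL := (weak_light_twos e k).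
Local Notation light_twos := (light_twos e k).

Definition bad : {set V} := A :|: B :|: C.

Lemma nbr_of_two v w : deg v = 2 -> e v w -> exists x, [/\ x != w, e v x,
  (forall y, e v y -> y = x \/ y = w) & forall f : V -> nat, \sum_(y | e v y) f y = f x + f w].
Proof.
move=> d2 evw; have [x [y [evx evy xy _ sumE]]] := two_nbrs d2.
have mem z : e v z -> z = x \/ z = y.
  move=> evz; have := sumE (fun t => t == z : nat); rewrite (bigD1 z) //= eqxx.
  by case: eqP => [->|_]; [left | case: eqP => [->|_] //; right].
case: (mem w evw) => ->; [exists y | exists x]; split=> //.
- by rewrite eq_sym.
- by move=> z /mem[]; [right | left].
- by move=> f; rewrite sumE addnC.
Qed.

Lemma sub_light_le w : deg w - light w <= deg w.
Proof. exact: leq_subr. Qed.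

(** With a neighbour of degree 2, reaching k + 2 takes degree k at the other one and equality
    throughout. So these vertices are tight, as [even_cycle] requires; the same happens in
    [B_struct] and [C_struct]. *)
Lemma A_struct v : v \in A -> exists b p, [/\ deg v = 2, ~~ light v, heavy_sum v <= k.+2 &
  [/\ b != p, e v b, e v p, deg b = k & deg p = 2 /\ forall y, e v y -> y = b \/ y = p]].
Proof.
rewrite inE => /andP[/eqP d2 /existsP[p /andP[evp /eqP dp]]].
have [b [bp evb mem sumE]] := nbr_of_two d2 evp.
have nlv : ~~ light v.
  apply/negP => lv; have := light_two_nbr e_sym e_deg light_adj heavy_hdeg d2 lv evp.
  by rewrite dp.
exists b, p; have := heavy_hdeg nlv; rewrite /heavy_sum sumE dp => hv.
have := e_deg b; have := sub_light_le b.
have : 2 - light p <= 2 by apply: leq_subr.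
move: (2 - _) (deg b - _) hv => l2 l1 hv h1 h2 h3.
have db : deg b = k by move: hv h1 h2 h3; move: (deg b); clear; lia.
split=> //; first by move: h1 h2 h3; move: (deg b); clear; lia.
Qed.

Lemma B_struct v : v \in B -> exists b w, [/\ deg v = 2, ~~ light v, heavy_sum v <= k.+2 &
  [/\ b != w, e v b, e v w, deg b = k & [/\ deg w = 3, light w & forall y, e v y -> y = b \/ y = w]]].
Proof.
rewrite inE => /andP[/eqP d2 /existsP[w /and4P[evw /eqP dw lw _]]].
have [b [bw evb mem sumE]] := nbr_of_two d2 evw.
have nlv : ~~ light v by apply: light_adj lw; rewrite e_sym.
exists b, w; have := heavy_hdeg nlv; rewrite /heavy_sum sumE dw lw => hv.
have := e_deg b; have := sub_light_le b.
move: (deg b - _) hv => l1 hv h1 h2.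
have db : deg b = k by move: hv h1 h2; move: (deg b); clear; lia.
by split=> //; move: h1 h2; move: (deg b); clear; lia.
Qed.

Lemma C_struct v : v \in C -> exists b u1 u2, [/\ deg v = 3, ~~ light v, heavy_sum v <= k.+2 &
  [/\ e v b, deg b = k, light_twos v = [set u1; u2], u1 != u2 &
      forall y, e v y -> y = b \/ y = u1 \/ y = u2]].
Proof.
rewrite inE => /and3P[/eqP d3 nlv /cards2P[u1 [u2 [u12 E]]]].
have mem u : u \in [set u1; u2] -> [&& e v u, deg u == 2 & light u] by rewrite -E inE.
have /and3P[e1 /eqP d1 l1] : [&& e v u1, deg u1 == 2 & light u1] by rewrite mem // !inE eqxx.
have /and3P[e2 /eqP d2 l2] : [&& e v u2, deg u2 == 2 & light u2] by rewrite mem // !inE eqxx orbT.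
have [b Nb] : exists b, [set y | e v y] :\ u1 :\ u2 = [set b].
  have cN : #|[set y | e v y]| = 3 by rewrite cardsE -[LHS]/(deg v).
  have c1 := cardsD1 u1 [set y | e v y]; have c2 := cardsD1 u2 ([set y | e v y] :\ u1).
  apply/cards1P; move: c1 c2; rewrite cN !inE e1 e2 [u2 == u1]eq_sym u12 !add1n => c1 c2.
  by move: c1; rewrite c2 => -[<-].
have memb y : e v y -> y = b \/ y = u1 \/ y = u2.
  move=> evy; have [->|n1] := eqVneq y u1; first by right; left.
  have [->|n2] := eqVneq y u2; first by right; right.
  by left; apply/set1P; rewrite -Nb !inE n1 n2.
have /and3P[b2 b1 evb] : [&& b != u2, b != u1 & e v b].
  by have := set11 b; rewrite -Nb !inE.
have := heavy_hdeg nlv; rewrite /heavy_sum (bigD1 b) //= (bigD1 u1) /=; last by rewrite e1 eq_sym.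
rewrite (bigD1 u2) /=; last by rewrite e2 eq_sym b2 eq_sym u12.
rewrite big1 => [|y /andP[/andP[/andP[/memb[->|[]->]]]]]; rewrite ?eqxx ?andbF //.
rewrite d1 l1 d2 l2 => hv.
exists b, u1, u2; have := e_deg b; have := sub_light_le b.
move: (deg b - _) hv => l hv h1 h2.
have db : deg b = k by move: hv h1 h2; move: (deg b); clear; lia.
by split=> //; move: h1 h2; move: (deg b); clear; lia.
Qed.

(* The junk value v is never taken on [bad], where v has a unique neighbour of degree k. *)
Definition full_nbr v := odflt v [pick b | e v b && (deg b == k)].

Lemma full_nbrE v b : e v b -> deg b = k -> (forall y, e v y -> y = b \/ deg y <= 3) -> full_nbr v = b.
Proof.
move=> evb db mem; rewrite /full_nbr; case: pickP => [y /andP[/mem[//|d3] /eqP dy]|/(_ b)].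
  by move: d3; rewrite dy leqNgt (leq_trans _ k_ge).
by rewrite evb db eqxx.
Qed.

Lemma A_kn v : v \in A -> exists p, [/\ e v (full_nbr v), deg (full_nbr v) = k, e v p, deg p = 2 &
  forall y, e v y -> y = full_nbr v \/ y = p].
Proof.
move=> /A_struct[b [p [_ _ _ [_ evb evp db [dp mem]]]]]; exists p.
have -> : full_nbr v = b by apply: full_nbrE => // y /mem[->|->]; [left | right; rewrite dp].
by split.
Qed.

Lemma B_kn v : v \in B -> exists w, [/\ e v (full_nbr v), deg (full_nbr v) = k, e v w, deg w = 3 &
  light w /\ forall y, e v y -> y = full_nbr v \/ y = w].
Proof.
move=> /B_struct[b [w [_ _ _ [_ evb evw db [dw lw mem]]]]]; exists w.
have -> : full_nbr v = b by apply: full_nbrE => // y /mem[->|->]; [left | right; rewrite dw].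
by split.
Qed.

Lemma C_kn v : v \in C -> exists u1 u2, [/\ e v (full_nbr v), deg (full_nbr v) = k, u1 != u2,
  light_twos v = [set u1; u2] & forall y, e v y -> y = full_nbr v \/ y = u1 \/ y = u2].
Proof.
move=> /C_struct[b [u1 [u2 [_ _ _ [evb db E u12 mem]]]]]; exists u1, u2.
have d2 u : u \in [set u1; u2] -> deg u <= 3 by rewrite -E inE => /and3P[_ /eqP->].
have -> : full_nbr v = b.
  apply: full_nbrE => // y /mem[->|[]->]; [by left | right | right]; apply: d2; rewrite !inE eqxx ?orbT //.
by split.
Qed.

Lemma bad_deg v : v \in bad -> deg v <= 3.
Proof.
rewrite !in_setU => /orP[/orP[]|] => [/A_struct[b [p [->]]]|/B_struct[b [w [->]]]|/C_struct[b [u1 [u2 [->]]]]] //.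
Qed.

Lemma bad_heavy v : v \in bad -> ~~ light v && (heavy_sum v <= k.+2).
Proof.
rewrite !in_setU => /orP[/orP[]|] => [/A_struct[b [p [_ -> -> _]]]|/B_struct[b [w [_ -> -> _]]]|/C_struct[b [u1 [u2 [_ -> -> _]]]]] //.
Qed.

Lemma not_deg_k y : deg y <= 3 -> deg y <> k.
Proof. by move=> d3 E; move: k_ge; rewrite -E leqNgt ltnS (leq_trans d3). Qed.

Lemma bad_kn v : v \in bad -> [/\ e v (full_nbr v), deg (full_nbr v) = k &
  forall y, e v y -> deg y = k -> y = full_nbr v].
Proof.
rewrite !in_setU => /orP[/orP[/A_kn[p [e1 d1 _ dp mem]]|/B_kn[w [e1 d1 _ dw [_ mem]]]]|/C_kn[u1 [u2 [e1 d1 _ E mem]]]];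
  split=> // y /mem.
- by case=> -> // dk; case: (@not_deg_k p) => //; rewrite dp.
- by case=> -> // dk; case: (@not_deg_k w) => //; rewrite dw.
have d2 u : u \in [set u1; u2] -> deg u = k -> u = full_nbr v.
  by rewrite -E inE => /and3P[_ /eqP du _] dk; case: (@not_deg_k u) => //; rewrite du.
by case=> [->|[]->] // dk; apply: d2; rewrite ?inE ?eqxx ?orbT.
Qed.

Local Notation link := (link q bad full_nbr).

Lemma same_kn : {in bad &, forall v w, v != w -> full_nbr v = full_nbr w -> q v w}.
Proof.
move=> v w vB wB vw E; rewrite /square /= vw /=; apply/orP; right; apply/existsP; exists (full_nbr v).
have [e1 _ _] := bad_kn vB; have [e2 _ _] := bad_kn wB.
by rewrite e1 E e_sym e2.
Qed.

Lemma A_nbr v p : v \in A -> e v p -> deg p = 2 -> p \in A.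
Proof.
rewrite !inE => /andP[/eqP d2 _] evp dp; rewrite dp /=; apply/existsP; exists v.
by rewrite e_sym evp d2.
Qed.

Lemma square_adj x y : x != y -> e x y -> q x y.
Proof. by move=> xy exy; rewrite /square /= xy /adj_or_common_neighbor exy. Qed.

Lemma square_common x y z : x != y -> e x z -> e z y -> q x y.
Proof.
move=> xy exz ezy; rewrite /square /= xy /adj_or_common_neighbor; apply/orP; right.
by apply/existsP; exists z; rewrite exz.
Qed.

Lemma e_neq x y : e x y -> x != y.
Proof. by apply: contraTneq => ->; rewrite e_irr. Qed.

Lemma A_link v p : v \in A -> e v p -> deg p = 2 -> link v p.
Proof.
move=> vA evp dp; have pA := A_nbr vA evp dp.
have vB : v \in bad by rewrite !in_setU vA.
have pB : p \in bad by rewrite !in_setU pA.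
rewrite /link /= vB pB (square_adj (e_neq evp) evp) /=; apply/negP => /eqP E.
have [e1 _ _] := bad_kn vB; have [e2 _ _] := bad_kn pB.
by apply: (no_triangle evp e2); rewrite -E e_sym.
Qed.

Lemma three_two_B w v z : deg w = 3 -> light w -> e w v -> e w z -> v != z ->
  deg v = 2 -> deg z = 2 -> v \in B.
Proof.
move=> dw lw ewv ewz vz dv dz; rewrite inE dv /=; apply/existsP; exists w.
rewrite e_sym ewv dw lw /=; apply: (@leq_trans #|[set v; z]|); first by rewrite cards2 vz.
by apply/subset_leq_card/subsetP => x; rewrite !inE => /orP[]/eqP->; rewrite ?ewv ?ewz ?dv ?dz.
Qed.

(** A shared full neighbour would form a 4-cycle with v, w and z; the bound on deg w keeps [w] apart
    from that neighbour. *)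
Lemma kn_neq w v z : v \in bad -> z \in bad -> e w v -> e w z -> v != z -> deg w <= 3 -> full_nbr v != full_nbr z.
Proof.
move=> vB zB ewv ewz vz dw; apply/negP => /eqP E.
have [e1 d1 _] := bad_kn vB; have [e2 d2 _] := bad_kn zB.
have wk : w != full_nbr z by apply/eqP => wk; apply: (not_deg_k dw); rewrite wk.
have evw : e v w by rewrite e_sym.
have e3 : e (full_nbr z) v by rewrite e_sym -E.
exact: (no_square vz wk evw ewz e2 e3).
Qed.

Lemma B_link w v z : deg w = 3 -> light w -> e w v -> e w z -> v != z ->
  deg v = 2 -> deg z = 2 -> link v z.
Proof.
move=> dw lw ewv ewz vz dv dz; have vB := three_two_B dw lw ewv ewz vz dv dz.
have zv : z != v by rewrite eq_sym.
have zB := three_two_B dw lw ewz ewv zv dz dv.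
have vb : v \in bad by rewrite !in_setU vB orbT.
have zb : z \in bad by rewrite !in_setU zB orbT.
rewrite /link /= vb zb (@square_common v z w) // 1?e_sym //=.
by apply: (kn_neq vb zb ewv ewz) => //; rewrite dw.
Qed.

Lemma CL_nbr u v : u \in CL -> e u v -> v \in C.
Proof. by rewrite inE => /and3P[_ _ /forallP/(_ v)/implyP]. Qed.

Lemma CL_light u : u \in CL -> (deg u = 2) * light u.
Proof. by rewrite inE => /and3P[/eqP]. Qed.

Lemma C_link u v z : u \in CL -> e u v -> e u z -> v != z -> link v z.
Proof.
move=> uCL euv euz vz; have [du lu] := CL_light uCL.
have vb : v \in bad by rewrite !in_setU (CL_nbr uCL euv) orbT.
have zb : z \in bad by rewrite !in_setU (CL_nbr uCL euz) orbT.
rewrite /link /= vb zb (@square_common v z u) // 1?e_sym //=.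
by apply: (kn_neq vb zb euv euz) => //; rewrite du.
Qed.

(** A common neighbour of [v] and [z] cannot have degree k, or the two would be in one class. So the
    link is an edge or runs through one of the few other neighbours listed by the structure
    lemmas. *)
Lemma link_cases v z : link v z ->
  [\/ [/\ v \in A, z \in A & e v z],
      [/\ v \in B, z \in B & exists w, [/\ e v w, e w z, deg w = 3 & light w]] |
      [/\ v \in C, z \in C & exists u, [/\ u \in CL, e u v & e u z]]].
Proof.
case/and4P => vB zB /andP[vz adj] kvz.
have [zh _] := andP (bad_heavy zB); have [vh _] := andP (bad_heavy vB).
have [ez dz kz] := bad_kn zB; have [ev dv kv] := bad_kn vB.
have znk : z != full_nbr v.
  by apply/eqP => E; apply: (@not_deg_k z); [exact: bad_deg | rewrite E].
have through n : e v n -> e n z -> n != full_nbr v.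
  move=> evn enz; apply: contraNneq kvz => nk; rewrite -nk; apply/eqP.
  by apply: kz; [rewrite e_sym | rewrite nk].
move: (vB); rewrite !in_setU => /orP[/orP[vA|vB']|vC].
- have [p [_ _ evp dp mem]] := A_kn vA; have pA := A_nbr vA evp dp.
  have [evz | nevz] := boolP (e v z).
    have zp : z = p by case: (mem z evz) => // E; rewrite E eqxx in znk.
    by constructor 1; split=> //; rewrite zp.
  move: adj; rewrite /adj_or_common_neighbor (negbTE nevz) /= => /existsP[n /andP[evn enz]].
  have np : n = p by case: (mem n evn) => // E; have := through n evn enz; rewrite E eqxx.
  have [p' [e1 d1 _ dp' mem']] := A_kn pA; rewrite np in enz.
  have vp' : v = p'.
    have : e p v by rewrite e_sym.
    case/mem' => // E; case: (@not_deg_k v); first exact: bad_deg.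
    by rewrite E.
  case: (mem' z enz) => E; last by rewrite E -vp' eqxx in vz.
  by case: (@not_deg_k z); [exact: bad_deg | rewrite E].
- have [w [_ _ evw dw [lw mem]]] := B_kn vB'.
  have [evz | nevz] := boolP (e v z).
    case: (mem z evz) => E; first by rewrite E eqxx in znk.
    by rewrite E lw in zh.
  move: adj; rewrite /adj_or_common_neighbor (negbTE nevz) /= => /existsP[n /andP[evn enz]].
  have nw : n = w by case: (mem n evn) => // E; have := through n evn enz; rewrite E eqxx.
  rewrite nw in enz; have ezw : e z w by rewrite e_sym.
  have dv2 : deg v = 2 by have [? [? []]] := B_struct vB'.
  have dz2 : deg z = 2.
    move: (zB); rewrite !in_setU => /orP[/orP[/A_struct|/B_struct]|/C_kn]; try by case=> [? [? []]].
    case=> u1 [u2 [_ _ _ E m]]; case: (m w ezw) => [wk|wu].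
      by case: (@not_deg_k w); [rewrite dw | rewrite wk].
    have : w \in light_twos z by rewrite E !inE; case: wu => ->; rewrite eqxx ?orbT.
    by rewrite inE dw => /and3P[].
  have ewv : e w v by rewrite e_sym.
  constructor 2; split=> //; last by exists w.
  by apply: (three_two_B dw lw enz ewv) => //; rewrite eq_sym.
- have [u1 [u2 [_ _ u12 E mem]]] := C_kn vC.
  have isu y : e v y -> y != full_nbr v -> [&& e v y, deg y == 2 & light y].
    move=> evy yk; have : y \in light_twos v; last by rewrite inE.
    by rewrite E !inE; case: (mem y evy) => [yk'|[]->]; rewrite ?eqxx ?orbT //; rewrite yk' eqxx in yk.
  have [evz | nevz] := boolP (e v z).
    by have /and3P[_ _ lz] := isu z evz znk; rewrite lz in zh.
  move: adj; rewrite /adj_or_common_neighbor (negbTE nevz) /= => /existsP[n /andP[evn enz]].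
  have /and3P[_ /eqP dn ln] := isu n evn (through n evn enz).
  have ezn : e z n by rewrite e_sym.
  have env : e n v by rewrite e_sym.
  have dz3 := light_two_nbr e_sym e_deg light_adj heavy_hdeg dn ln enz.
  have zC : z \in C.
    move: (zB); rewrite !in_setU => /orP[/orP[/A_struct|/B_struct]|//]; by case=> [? [? [E2]]]; rewrite E2 eqxx in dz3.
  constructor 3; split=> //; exists n; split=> //.
  rewrite inE dn ln /=; apply/forallP => y; apply/implyP => eny.
  have [x [xz _ m _]] := nbr_of_two dn enz.
  have vx : v = x by case: (m v env) => // E'; rewrite E' eqxx in vz.
  by case: (m y eny) => ->; rewrite -?vx.
Qed.

Lemma deg3_notAB v : v \in C -> v \notin A :|: B.
Proof.
by move=> /C_struct[b [u1 [u2 [d3]]]]; rewrite !inE d3.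
Qed.

Lemma A_only v : v \in A -> exists2 p, p \in A & link v p /\ forall z, link v z -> z = p.
Proof.
move=> vA; have [p [_ dk evp dp mem]] := A_kn vA.
exists p; first exact: A_nbr vA evp dp.
split=> [|z l]; first exact: A_link.
case: (link_cases l) => [[_ zA /mem[E|//]]|[vB _ _]|[vC _ _]].
- by case: (@not_deg_k z); [apply: bad_deg; rewrite !in_setU zA | rewrite E].
- have [b [x [_ _ _ [_ _ evx _ [dx _ _]]]]] := B_struct vB.
  by case: (mem x evx) => E; [case: (@not_deg_k x); [rewrite dx | rewrite E] | rewrite E dp in dx].
- by have := deg3_notAB vC; rewrite inE vA.
Qed.

Lemma B_only v : v \in B -> exists w, [/\ deg w = 3, light w, e w v &
  forall z, link v z -> e w z /\ z \in B].
Proof.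
move=> vB; have [w [_ dk evw dw [lw mem]]] := B_kn vB.
exists w; split=> // [|z l]; first by rewrite e_sym.
case: (link_cases l) => [[vA _ _]|[_ zB [x [evx exz dx _]]]|[vC _ _]].
- have [p [_ _ evp dp _]] := A_kn vA; case: (mem p evp) => E; last by rewrite E dw in dp.
  by case: (@not_deg_k p); [rewrite dp | rewrite E].
- by case: (mem x evx) => [E|<- //]; case: (@not_deg_k x); [rewrite dx | rewrite E].
- by have := deg3_notAB vC; rewrite inE vB orbT.
Qed.

Lemma link_deg v : #|[set z | link v z]| <= 2.
Proof.
have [vB | nvB] := boolP (v \in bad); last first.
  by rewrite (eq_card (B := pred0)) ?card0 // => z; rewrite !inE /link /= (negbTE nvB).
move: (vB); rewrite !in_setU => /orP[/orP[vA|vB']|vC].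
- have [p _ [_ only]] := A_only vA; apply: (@leq_trans #|[set p]|); last by rewrite cards1.
  by apply/subset_leq_card/subsetP => z; rewrite !inE => /only->.
- have [w [dw _ ewv adj]] := B_only vB'.
  apply: (@leq_trans #|[set y | e w y] :\ v|); last first.
    by have := cardsD1 v [set y | e w y]; rewrite inE ewv cardsE -[X in X = _]/(deg w) dw add1n => -[<-].
  apply/subset_leq_card/subsetP => z; rewrite !inE => l; rewrite eq_sym (link_neq l) /=.
  by have [] := adj z l.
- have [u1 [u2 [_ _ u12 E mem]]] := C_kn vC.
  have prop u : u \in [set u1; u2] -> [&& e v u, deg u == 2 & light u] by rewrite -E inE.
  have one u : u \in [set u1; u2] -> #|[set y | e u y] :\ v| <= 1.
    move=> /prop /and3P[evu /eqP du _].
    by have := cardsD1 v [set y | e u y]; rewrite inE e_sym evu cardsE -[X in X = _]/(deg u) du add1n => -[<-].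
  apply: (@leq_trans #|([set y | e u1 y] :\ v) :|: ([set y | e u2 y] :\ v)|); last first.
    by apply: leq_trans (leq_card_setU _ _) _; apply: (@leq_add _ _ 1 1); apply: one; rewrite !inE eqxx ?orbT.
  apply/subset_leq_card/subsetP => z; rewrite !inE => l; rewrite [z == v]eq_sym (link_neq l) /=.
  have := deg3_notAB vC; rewrite inE negb_or => /andP[/negP nA /negP nB].
  case: (link_cases l) => [[//]|[//]|[_ _ [u [uCL euv euz]]]].
  have [du lu] := CL_light uCL.
  have : u \in light_twos v by rewrite inE e_sym euv du lu.
  by rewrite E !inE => /orP[]/eqP<-; rewrite euz ?orbT.
Qed.

(** Each kind of link comes with an edge whose ends are on the cycle or light, which is what
    [even_cycle] asks for. *)
Lemma link_even_clique (s : seq V) x y :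
  uniq s -> cycle q s -> ~~ odd (size s) -> 2 < size s -> {subset s <= bad} ->
  x \in s -> y \in s -> link x y -> {in s &, forall v w, v != w -> q v w}.
Proof.
move=> us cs es szs sB xs ys l.
have crit : {in s, forall z, ~~ light z && (heavy_sum z <= k.+2)} by move=> z /sB/bad_heavy.
case: (link_cases l) => [[_ _ exy]|[_ _ [w [exw _ _ lw]]]|[_ _ [u [uCL eux _]]]].
- by apply: (even_cycle us cs es szs crit exy); rewrite ?xs ?ys.
- by apply: (even_cycle us cs es szs crit exw); rewrite ?xs ?lw ?orbT.
- have [_ lu] := CL_light uCL.
  by apply: (even_cycle us cs es szs crit eux); rewrite ?xs ?lu ?orbT.
Qed.

Local Notation core := (square_core q bad full_nbr).

(** A core vertex has two links into one class. A vertex of [paired_twos] has only one link, and the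
    links of a vertex of [branch_twos] end at neighbours of one vertex of degree 3, so they lie in
    different classes. *)
Lemma core_sub_C : core \subset C.
Proof.
apply/subsetP => v; rewrite inE => /existsP[v' /existsP[w /existsP[w' /and5P[_ _ _ ww']]]].
case/and5P => /eqP kw l l' _ _.
have vB : v \in bad by case/and4P: l.
have wB : w \in bad by case/and4P: l.
have w'B : w' \in bad by case/and4P: l'.
move: (vB); rewrite !in_setU => /orP[/orP[vA|vB']|//]; exfalso.
- by have [p _ [_ only]] := A_only vA; rewrite (only _ l) (only _ l') eqxx in ww'.
- have [x [dx _ _ adj]] := B_only vB'; have [exw _] := adj w l; have [exw' _] := adj w' l'.
  by have := kn_neq wB w'B exw exw' ww'; rewrite dx kw eqxx => /(_ isT).
Qed.

Lemma sum_bool_card (D : {set V}) (r : pred V) : \sum_(v in D) r v = #|[set v in D | r v]|.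
Proof.
by rewrite -sum1dep_card big_mkcondr; apply: eq_bigr => v _; case: (r v).
Qed.

(** Double counting of edges: two at each vertex of [M], all going to [D], and at most two at each
    vertex of [D], which has exactly two light neighbours of degree 2. *)
Lemma CL_count (D M : {set V}) : D \subset C -> M \subset CL ->
  (forall u w, u \in M -> e u w -> w \in D) -> #|M| <= #|D|.
Proof.
move=> DC MCL MD; rewrite -(leq_pmul2r (isT : 0 < 2)) -!sum_nat_const.
apply: (@leq_trans (\sum_(u in M) \sum_(v in D) e u v)).
  apply: leq_sum => u uM; have [<- _] := CL_light (subsetP MCL u uM).
  rewrite sum_bool_card /degree; apply/subset_leq_card/subsetP => w; rewrite !inE => euw.
  by rewrite (MD u w uM euw).
rewrite exchange_big; apply: leq_sum => v vD.
have := subsetP DC v vD; rewrite inE => /and3P[_ _ /eqP <-].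
rewrite sum_bool_card; apply/subset_leq_card/subsetP => u; rewrite !inE => /andP[uM euv].
have [du lu] := CL_light (subsetP MCL u uM).
by rewrite e_sym euv du lu.
Qed.

Local Notation linkable := (linkable q bad full_nbr).

Lemma link_sym : symmetric link. Proof. exact: link_relation_sym (square_sym e_sym). Qed.

(* Of the two arcs of an odd cycle joining two vertices, one has an odd number of edges. *)
Lemma odd_cycle_linkable (c : seq V) :
  uniq c -> cycle link c -> odd (size c) -> linkable [set x in c].
Proof.
move=> uc cc oc a z; rewrite !inE => ac zc az.
case: (rot_to ac) => i p Ei.
have mem x : x \in a :: p -> x \in c by rewrite -Ei mem_rot.
have up : uniq (a :: p) by rewrite -Ei rot_uniq.
have cp : cycle link (a :: p) by rewrite -Ei rot_cycle.
have op : ~~ odd (size p).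
  by move: oc; rewrite -(size_rot i) Ei.
have zp : z \in p by move: zc; rewrite -(mem_rot i) Ei inE eq_sym (negbTE az).
case/splitPr: zp mem up cp op => p1 p2 mem up cp op.
have arc l1 l2 : uniq (a :: l1 ++ z :: l2) -> cycle link (a :: l1 ++ z :: l2) ->
    {subset l1 ++ z :: l2 <= c} -> odd (size l1).+1 ->
    exists s, [/\ uniq (a :: s), path link a s, last a s = z, odd (size s) & {subset s <= [set x in c]}].
  move=> ul cl sl ol; exists (rcons l1 z); split.
  - by move: ul; rewrite -cat_rcons -cat_cons cat_uniq => /and3P[].
  - by move: cl; rewrite /= rcons_path -cat_rcons cat_path => /andP[/andP[]].
  - by rewrite last_rcons.
  - by rewrite size_rcons.
  - by move=> x xs; rewrite inE; apply: sl; rewrite -cat_rcons mem_cat xs.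
have [o1 | e1] := boolP (odd (size p1).+1).
  by apply: (arc p1 p2) => // x xs; apply: mem; rewrite inE xs orbT.
have rE : rev (a :: p1 ++ z :: p2) = rcons (rev p2 ++ z :: rev p1) a.
  by rewrite rev_cons rev_cat rev_cons cat_rcons.
have rE' : rot 1 (a :: rev p2 ++ z :: rev p1) = rev (a :: p1 ++ z :: p2) by rewrite rot1_cons rE.
apply: (arc (rev p2) (rev p1)).
- by rewrite -(rot_uniq 1) rE' rev_uniq.
- rewrite -(rot_cycle 1) rE' rev_cycle.
  by rewrite (eq_cycle (e' := link)) // => x y; rewrite link_sym.
- move=> x xs; apply: mem; rewrite -mem_rev rE mem_rcons inE xs orbT //.
- rewrite size_rev; move: op e1; rewrite size_cat /= addnS /= oddD.
  by case: (odd (size p1)); case: (odd (size p2)).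
Qed.

Definition same_AB : rel V := [rel v z | (v == z) || link v z].

Lemma link_trans_AB v z z' : v \in A :|: B -> link v z -> link v z' -> z != z' -> link z z'.
Proof.
rewrite in_setU => /orP[/A_only[p _ [_ only]] /only-> /only-> |vB l l' zz']; first by rewrite eqxx.
have [w [dw lw _ adj]] := B_only vB; have [ewz zB] := adj _ l; have [ewz' zB'] := adj _ l'.
have d2 x : x \in B -> deg x = 2 by move=> /B_struct[b [y []]].
by apply: (B_link dw lw) => //; exact: d2.
Qed.

Lemma same_AB_equiv : {in A :|: B & &, equivalence_rel same_AB}.
Proof.
move=> x y z xAB yAB zAB; split; first by rewrite /same_AB /= eqxx.
case/orP => [/eqP-> //|lxy]; rewrite /same_AB /=; have lyx : link y x by rewrite link_sym.
have [<-|xz] := eqVneq x z; first by rewrite [y == x]eq_sym (negbTE (link_neq lxy)) lyx.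
have [<-|yz] := eqVneq y z; first by rewrite lxy.
rewrite /=; apply/idP/idP => l; first exact: (link_trans_AB xAB lxy l).
exact: (link_trans_AB yAB lyx l).
Qed.

(** The classes are the adjacent pairs in [paired_twos] and the sets of degree 2 neighbours of a
    light vertex of degree 3; in each of them all pairs are linked directly. *)
Definition AB_connectors : {set {set V}} := equivalence_partition same_AB (A :|: B).

Lemma AB_partition : partition AB_connectors (A :|: B).
Proof. exact: equivalence_partitionP same_AB_equiv. Qed.

Lemma has_link_AB v : v \in A :|: B -> exists2 z, z \in A :|: B & link v z.
Proof.
rewrite in_setU => /orP[/A_only[p pA [l _]]|vB]; first by exists p; rewrite // in_setU pA.
have [u [_ _ _ adj]] := B_only vB.
move: (vB); rewrite inE => /andP[/eqP dv /existsP[x /and4P[evx /eqP dx lx tx]]].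
have : 0 < #|[set z | e x z & deg z == 2] :\ v|.
  by move: tx; rewrite /twos (cardsD1 v) inE e_sym evx dv eqxx add1n.
case/card_gt0P => z; rewrite in_setD1 inE => /and3P[zv exz /eqP dz].
have l : link v z by apply: (B_link dx lx) => //; rewrite 1?e_sym // eq_sym.
by exists z => //; rewrite in_setU (adj z l).2 orbT.
Qed.

Lemma AB_connectorP c : c \in AB_connectors ->
  [/\ c \subset A :|: B, 1 < #|c| & linkable c].
Proof.
move=> cP; have /and3P[/eqP cov triv n0] := AB_partition.
have sub : c \subset A :|: B by rewrite -cov /cover (bigcup_max c).
have cE v z : v \in c -> z \in A :|: B -> (z \in c) = same_AB v z.
  move=> vc zAB; rewrite -(def_pblock triv cP vc).
  by rewrite (pblock_equivalence_partition same_AB_equiv) // (subsetP sub).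
split=> // [|a z ac zc az].
  have /set0Pn[v vc] : c != set0 by apply: contraNneq n0 => <-.
  have [z zAB l] := has_link_AB (subsetP sub v vc).
  rewrite (cardsD1 v) vc (cardsD1 z) !inE (cE v z vc zAB) /same_AB /= l orbT eq_sym (link_neq l).
  by rewrite !add1n.
move: (zc); rewrite (cE a z ac (subsetP sub z zc)) /same_AB /= (negbTE az) => l.
exists [:: z]; split=> //=; [by rewrite inE az | by rewrite andbT | ].
by move=> x; rewrite inE => /eqP->.
Qed.

Lemma AB_count : #|A :|: B| <= \sum_(c in AB_connectors) 2 * (#|c| - 1).
Proof.
rewrite (card_partition AB_partition); apply: leq_sum => c /AB_connectorP[_ c1 _].
by case: #|c| c1 => [|[|n]] // _; rewrite subn1 mul2n -addnn /= addSnnS leq_addl.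
Qed.

(** Each vertex of [weak_light_twos] acts as an edge joining its two neighbours in [weak_threes];
    these are the edges inside [S], and [CL_touching] picks those that meet [c]. *)
Definition CL_in (S : {set V}) : {set V} := [set u in CL | [forall w, e u w ==> (w \in S)]].

Lemma CL_inP (S : {set V}) u : reflect (u \in CL /\ forall w, e u w -> w \in S) (u \in CL_in S).
Proof.
apply: (iffP setIdP) => -[uCL].
  by move=> /forallP h; split=> // w; apply/implyP.
by move=> h; split=> //; apply/forallP => w; apply/implyP/h.
Qed.

Definition CL_touching (S c : {set V}) : {set V} :=
  [set u in CL_in S | [exists w, e u w && (w \in c)]].

Lemma CL_in_setD (S c : {set V}) : #|CL_in S| <= #|CL_in (S :\: c)| + #|CL_touching S c|.
Proof.
rewrite addnC; apply: leq_trans (leq_card_setU _ _); apply/subset_leq_card/subsetP => u uS.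
rewrite in_setU; apply/orP; have [t|nt] := boolP (u \in CL_touching S c); [by left | right].
have /CL_inP[uCL uw] := uS; apply/CL_inP; split=> // w euw.
rewrite inE uw // andbT; apply: contra nt => wc; apply/setIdP; split=> //.
by apply/existsP; exists w; rewrite euw.
Qed.

Lemma CL_other (S : {set V}) u v : u \in CL_in S -> e u v -> exists z, [/\ z \in S, link v z, e u z &
  forall y, e u y -> y = z \/ y = v].
Proof.
move=> /CL_inP[uCL uS] euv; have [du _] := CL_light uCL.
have [x [xv eux mem _]] := nbr_of_two du euv.
by exists x; split=> //; [exact: uS | apply: C_link euv eux _; rewrite // eq_sym].
Qed.

Definition connectors (S : {set V}) (P : {set {set V}}) : Prop :=
  [/\ trivIset P, set0 \notin P, forall c, c \in P -> c \subset S & forall c, c \in P -> linkable c].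

Lemma connectorsU1 (S c : {set V}) P : c \subset S -> c != set0 -> linkable c -> connectors (S :\: c) P ->
  connectors S (c |: P) /\
  \sum_(d in c |: P) 2 * (#|d| - 1) = 2 * (#|c| - 1) + \sum_(d in P) 2 * (#|d| - 1).
Proof.
move=> cS c0 lc [tP P0 PS Pl].
have dis d : d \in P -> [disjoint c & d].
  move=> dP; rewrite -setI_eq0; apply/eqP/setP => x; rewrite !inE; apply/negP => /andP[xc xd].
  by have := subsetP (PS d dP) x xd; rewrite inE xc.
have [tcP cP] := trivIsetU1 dis tP P0.
split; last by rewrite big_setU1.
split=> //.
- by rewrite in_setU1 eq_sym negb_or c0.
- by move=> d; rewrite in_setU1 => /orP[/eqP->//|/PS h]; apply: subset_trans h (subsetDl _ _).
- by move=> d; rewrite in_setU1 => /orP[/eqP->|/Pl].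
Qed.

Lemma sparse_CL (S : {set V}) v : v \in S -> #|[set z in S | link v z]| = 0 -> CL_touching S [set v] = set0.
Proof.
move=> vS l0; apply/setP => u; rewrite [RHS]inE; apply/negP => /setIdP[uS /existsP[w /andP[euw /set1P wv]]].
rewrite wv in euw; have [z [zS l _ _]] := CL_other uS euw.
by have := card0_eq l0 z; rewrite !inE zS l.
Qed.

(** A vertex has at most 2 links, so connectors can be cut off one by one: a vertex without link in
    [S]; a vertex with a single link, together with its partner; and, when neither is left, a cycle
    of links, which is odd because an even one would lie in the core. They account for at most 0, 2
    and |c| of the counted vertices, always at most 2 (|c| - 1). *)
Lemma C_connectors (S : {set V}) : S \subset C :\: core ->
  exists2 P, connectors S P & #|CL_in S| <= \sum_(c in P) 2 * (#|c| - 1).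
Proof.
elim: {S}_.+1 {-2}S (ltnSn #|S|) => // n IH S Sn SC.
have smaller (c : {set V}) : c \subset S -> c != set0 -> exists2 P, connectors (S :\: c) P &
    #|CL_in (S :\: c)| <= \sum_(c in P) 2 * (#|c| - 1).
  move=> cS c0; apply: IH; last exact: subset_trans (subsetDl _ _) SC.
  rewrite -ltnS; apply: leq_trans Sn; rewrite ltnS; apply: proper_card.
  rewrite properE subsetDl /=; apply/subsetPn; have /set0Pn[x xc] := c0.
  by exists x; rewrite ?(subsetP cS) // inE xc.
have add (c : {set V}) : c \subset S -> c != set0 -> linkable c -> #|CL_touching S c| <= 2 * (#|c| - 1) ->
    exists2 P, connectors S P & #|CL_in S| <= \sum_(c in P) 2 * (#|c| - 1).
  move=> cS c0 lc cc; have [P conP CLP] := smaller c cS c0.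
  have [con sumE] := connectorsU1 cS c0 lc conP; exists (c |: P) => //.
  by rewrite sumE addnC; apply: leq_trans (CL_in_setD S c) (leq_add CLP cc).
have CS x : x \in S -> x \in C by move=> /(subsetP SC); rewrite inE => /andP[].
have [/existsP[v /andP[vS few]]|many] := boolP [exists v, (v \in S) && (#|[set z in S | link v z]| <= 1)].
  move: few; rewrite leq_eqVlt ltnS leqn0 => /orP[/cards1P[z E]|/eqP l0]; last first.
    have v0 : [set v] != set0 by apply/set0Pn; exists v; rewrite inE.
    apply: (add [set v]); rewrite ?sub1set // ?(sparse_CL vS l0) ?cards0 //.
    by move=> a z; rewrite !inE => /eqP-> /eqP->; rewrite eqxx.
  have /andP[zS lvz] : (z \in S) && link v z by have := set11 z; rewrite -E inE.
  apply: (add [set v; z]).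
  - by apply/subsetP => x; rewrite !inE => /orP[]/eqP->.
  - by apply/set0Pn; exists v; rewrite !inE eqxx.
  - have one a b : a \in [set v; z] -> link a b -> b \in [set v; z] -> exists p, [/\ uniq (a :: p), path link a p, last a p = b,
        odd (size p) & {subset p <= [set v; z]}].
      move=> _ lab bvz; exists [:: b]; split=> //=; rewrite ?inE ?lab ?(link_neq lab) //.
      by move=> x; rewrite inE => /eqP->.
    move=> a b avz bvz ab; apply: one => //; move: avz bvz ab; rewrite !inE.
    by case/orP=> /eqP-> /orP[]/eqP->; rewrite ?eqxx // link_sym.
  - rewrite cards2 (link_neq lvz) /=; have := CS z zS; rewrite inE => /and3P[_ _ /eqP l2].
    apply: (@leq_trans #|light_twos z|); last by rewrite l2.
    (* As [z] is the only link of [v] in [S], whatever touches the pair is adjacent to [z]. *)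
    apply/subset_leq_card/subsetP => u /setIdP[uS /existsP[w /andP[euw wc]]].
    have [uCL _] := CL_inP _ _ uS; have [du lu] := CL_light uCL; rewrite inE du lu andbT e_sym.
    move: wc; rewrite !inE => /orP[]/eqP wE; rewrite wE in euw; last by rewrite euw.
    have [z' [z'S l euz' _]] := CL_other uS euw.
    have : z' \in [set z] by rewrite -E inE z'S l.
    by move=> /set1P <-; rewrite euz'.
have [S0|/set0Pn[x0 x0S]] := eqVneq S set0.
  exists set0; first by split=> [|| c | c]; rewrite ?inE //; apply/trivIsetP => a b; rewrite inE.
  rewrite big_set0 leqn0 cards_eq0 S0; apply/eqP/setP => u; rewrite [in RHS]inE; apply/negP => /CL_inP[uCL h].
  have [du _] := CL_light uCL; have : 0 < deg u by rewrite du.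
  by case/card_gt0P => w /h; rewrite inE.
have two v : v \in S -> 1 < #|[set z in S | link v z]|.
  by move=> vS; rewrite ltnNge; move/existsPn: many => /(_ v); rewrite vS.
have irr : irreflexive link by move=> x; apply/negP => /link_neq; rewrite eqxx.
have [x xS|c [uc szc cc cS]] := exists_cycle link_sym irr x0S.
  have /card_gt1P[y [z [yin zin yz]]] := two x xS; exists y, z.
  by move: yin zin; rewrite !inE => /andP[yS ly] /andP[zS lz]; split.
(* The two neighbours of [v] on the cycle exhaust its links. *)
have closed v z : v \in c -> link v z -> z \in c.
  move=> vc l; have pc : prev c v \in c by rewrite mem_prev.
  have E : [set next c v; prev c v] = [set z | link v z].
    apply/eqP; rewrite eqEcard; apply/andP; split.
      apply/subsetP => y; rewrite !inE => /orP[]/eqP->; first exact: next_cycle cc vc.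
      by rewrite link_sym; exact: prev_cycle cc vc.
    have := @next_next_neq _ c (prev c v) uc szc pc; rewrite (next_prev uc) cards2 => ->.
    exact: link_deg.
  have : z \in [set z | link v z] by rewrite inE.
  by rewrite -E !inE => /orP[]/eqP->; rewrite ?mem_next ?mem_prev.
have [v vc] : exists v, v \in c by case: (c) szc => // a l _; exists a; rewrite mem_head.
have CB x : x \in c -> x \in bad by move=> /cS/CS xC; rewrite in_setU xC orbT.
have oc : odd (size c).
  apply/negPn/negP => ev; have cq : cycle q c by apply: sub_cycle cc => x y /and4P[].
  have nc : next c v \in c by rewrite mem_next.
  have := @even_cycle_core _ q bad full_nbr link_deg link_even_clique c v (next c v) uc cq ev szc CB vc nc (next_cycle cc vc).
  by move=> /(_ v vc) core; have := subsetP SC v (cS v vc); rewrite inE core.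
have sc : [set x in c] \subset S by apply/subsetP => x; rewrite inE => /cS.
have cardc : #|[set x in c]| = size c by rewrite cardsE (card_uniqP uc).
apply: (add [set x in c]) => //.
- by rewrite -card_gt0 cardc (leq_trans _ szc).
- exact: odd_cycle_linkable.
- apply: (@leq_trans #|[set x in c]|); last by rewrite cardc; move: szc; clear; lia.
  apply: CL_count.
  + by apply/subsetP => x; rewrite inE => /cS/CS.
  + by apply/subsetP => u /setIdP[/CL_inP[]].
  + move=> u w /setIdP[uS /existsP[x /andP[eux]]]; rewrite inE => xc euw.
    have [z [zS l euz mem]] := CL_other uS eux.
    by rewrite inE; case: (mem w euw) => ->; rewrite ?xc // (closed x z xc l).
Qed.

Lemma core_count : #|core| <= 2 * #|full_nbr @: core|.
Proof.
rewrite -sum1_card (partition_big_imset full_nbr) /= mulnC -sum_nat_const.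
apply: leq_sum => b /imsetP[v vcore ->].
have [c2 _] := core_class (square_sym e_sym) same_kn link_deg link_even_clique vcore.
apply: leq_trans c2; rewrite sum1dep_card.
apply/subset_leq_card/subsetP => z /setIdP[zc E]; apply/setIdP; split=> //.
by rewrite in_setU (subsetP core_sub_C z zc) orbT.
Qed.

(** By [core_lk] a vertex of [weak_light_twos] with one neighbour in the core has both there, and
    [CL_count] bounds the number of such vertices. *)
Lemma CL_core_count : #|CL| <= #|CL_in (C :\: core)| + #|core|.
Proof.
pose M := [set u in CL | [exists w, e u w && (w \in core)]].
have MC : #|M| <= #|core|.
  apply: CL_count core_sub_C _ _; first by apply/subsetP => u /setIdP[].
  move=> u w /setIdP[uCL /existsP[x /andP[eux xc]]] euw.
  have [<- //|xw] := eqVneq x w.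
  by apply: (core_lk (square_sym e_sym) link_deg xc); apply: C_link uCL eux euw xw.
apply: (@leq_trans (#|CL_in (C :\: core)| + #|M|)); last by rewrite leq_add2l.
apply: leq_trans (leq_card_setU _ _); apply/subset_leq_card/subsetP => u uCL.
rewrite in_setU; apply/orP; have [uM|nM] := boolP (u \in M); [by right | left].
apply/CL_inP; split=> // w euw; rewrite inE (CL_nbr uCL euw) andbT.
by apply: contra nM => wc; apply/setIdP; split=> //; apply/existsP; exists w; rewrite euw.
Qed.

(** Outside the core the counts are at most twice the sum of the |c| - 1, which [link_forest] bounds
    by the number of full neighbours of connectors; the core costs at most two per full neighbour of
    its own. The two sets of full neighbours are disjoint since the core contains whole classes. *)
Lemma sparse_defects : #|A :|: B :|: CL| <= 2 * #|full_vertices e k|.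
Proof.
have [PC [tC C0' subC lC] countC] := C_connectors (subxx (C :\: core)).
have /and3P[/eqP covAB tAB AB0] := AB_partition.
pose P := AB_connectors :|: PC.
have disAB v : v \in A :|: B -> v \notin C by move=> vAB; apply: contraL vAB; exact: deg3_notAB.
have covC : cover PC \subset C :\: core by apply/bigcupsP.
have dis : [disjoint cover AB_connectors & cover PC].
  rewrite covAB -setI_eq0; apply/eqP/setP => v; rewrite [RHS]inE in_setI; apply/negP => /andP[/disAB vC].
  by move=> /(subsetP covC); rewrite inE (negbTE vC) andbF.
have tP : trivIset P by apply: trivIsetU.
have P0 : set0 \notin P by rewrite in_setU negb_or AB0.
have subP c : c \in P -> c \subset bad :\: core.
  rewrite in_setU => /orP[/AB_connectorP[sub _ _]|/subC sub]; apply: subset_trans sub _.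
    apply/subsetP => v vAB; rewrite inE in_setU vAB /= andbT; apply: contra (disAB v vAB).
    exact: (subsetP core_sub_C).
  by apply/subsetP => v; rewrite !inE => /andP[-> ->]; rewrite orbT.
have lP c : c \in P -> linkable c by rewrite in_setU => /orP[/AB_connectorP[]|/lC].
have := link_forest same_kn link_deg link_even_clique tP P0 subP lP.
have disP : [disjoint AB_connectors & PC].
  rewrite -setI_eq0; apply/eqP/setP => c; rewrite [RHS]inE in_setI; apply/negP => /andP[cAB cC].
  have /set0Pn[v vc] : c != set0 by apply: contraNneq AB0 => <-.
  have vAB : v \in cover AB_connectors by apply/bigcupP; exists c.
  by have := disjointFr dis vAB; move/negP; apply; apply/bigcupP; exists c.
have sumP : \sum_(c in P) (#|c| - 1) =
    \sum_(c in AB_connectors) (#|c| - 1) + \sum_(c in PC) (#|c| - 1).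
  rewrite -bigU //=; apply: eq_bigl => c; exact: in_setU.
have disX : #|full_nbr @: cover P| + #|full_nbr @: core| <= #|full_vertices e k|.
  have sub : cover P \subset bad :\: core by apply/bigcupsP.
  rewrite -cardsUI (_ : _ :&: _ = set0) ?cards0 ?addn0.
    apply/subset_leq_card/subsetP => b; rewrite in_setU => bU.
    have [v vB ->] : exists2 v, v \in bad & b = full_nbr v.
      case/orP: bU => /imsetP[v vv ->]; exists v => //.
        by have := subsetP sub v vv; rewrite inE => /andP[].
      by rewrite in_setU (subsetP core_sub_C v vv) orbT.
    by have [_ dk _] := bad_kn vB; rewrite inE dk.
  apply/setP => b; rewrite [RHS]inE in_setI; apply/negP => /andP[/imsetP[v vP ->] /imsetP[z zc E]].
  have [_ cl] := core_class (square_sym e_sym) same_kn link_deg link_even_clique zc.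
  have := subsetP sub v vP; rewrite inE => /andP[/negP nv vB]; apply: nv.
  exact: cl vB E.
have := AB_count; move: countC; rewrite -!big_distrr /= => cC cAB.
have [+ _] := leq_card_setU (A :|: B) CL; move: core_count CL_core_count cC cAB disX; rewrite sumP.
move: (\sum_(c in AB_connectors) _) (\sum_(c in PC) _) #|full_nbr @: _| #|full_nbr @: core| #|core| #|_ :|: CL|.
move: #|CL| #|CL_in _| #|A :|: B| #|full_vertices e k|; clear; lia.
Qed.

End Global.

(** Discharging makes the defects more than twice as many as the vertices of degree k, the forest
    bound at most twice. Here the girth enters as the absence of triangles and 4-cycles. *)
Lemma no_critical_sparse (V : finType) (e : rel V) (k : nat) (C : eqType) (L : V -> seq C) :
  17 <= k -> symmetric e -> irreflexive e -> (forall v, degree e v <= k) -> girth_at_least e 6 ->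
  \sum_v degree e v + 3 <= 3 * #|[set v | [exists w, e v w]]| ->
  (forall v, uniq (L v)) -> (forall v, size (L v) = k.+2) ->
  (forall u v, e u v -> exists c : V -> C,
    (forall x, c x \in L x) /\ two_distance_coloring (del_edge e u v) c) ->
  ~ ~ exists c : V -> C, (forall v, c v \in L v) /\ two_distance_coloring e c.
Proof.
move=> k_ge e_sym e_irr e_deg girth sparse L_uniq L_size crit uncol.
have neq x y : e x y -> x != y by apply: contraTneq => ->; rewrite e_irr.
have no_triangle x y z : e x y -> e y z -> e z x -> False.
  move=> exy eyz ezx; suff /girth : graph_cycle e [:: x; y; z] by [].
  by rewrite /graph_cycle /= !inE negb_or (neq _ _ exy) (neq _ _ eyz) eq_sym (neq _ _ ezx) exy eyz ezx.
have no_square a b c d : a != c -> b != d -> e a b -> e b c -> e c d -> e d a -> False.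
  move=> ac bd eab ebc ecd eda; suff /girth : graph_cycle e [:: a; b; c; d] by [].
  rewrite /graph_cycle /= !inE !negb_or (neq _ _ eab) ac bd (neq _ _ ebc) (neq _ _ ecd) eq_sym (neq _ _ eda).
  by rewrite eab ebc ecd eda.
have deg1 := degree_neq1 e_sym e_deg L_uniq L_size uncol crit.
have ladj := light_not_adjacent e_sym L_uniq L_size uncol crit.
have hvy := nonlight_hdeg e_sym L_uniq L_size uncol crit.
have even := critical_even_cycle e_sym L_uniq L_size uncol crit.
have := sparse_defects k_ge e_sym e_irr e_deg ladj hvy even no_triangle no_square.
have := discharge k_ge e_sym e_deg deg1 ladj hvy sparse.
by move: #|full_vertices e k| #|_ :|: _|; clear; lia.
Qed.

From mathcomp Require Import all_order all_algebra.

(** * Euler's inequality for grid minors *)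

Section Algebra.
Import GRing.Theory.
Local Open Scope ring_scope.

Lemma addF2 (x : 'F_2) : x + x = 0.
Proof. by case: x => [[|[|]]] // ?; apply/val_inj. Qed.

Lemma oppF2 (x : 'F_2) : - x = x.
Proof. by case: x => [[|[|]]] // ?; apply/val_inj. Qed.

Lemma F2_neq0 (x : 'F_2) : x != 0 -> x = 1.
Proof. by case: x => [[|[|]]] // ? ?; apply/val_inj. Qed.

(** Terms off the diagonal cancel in pairs. *)
Lemma sum_sym_F2 (I : finType) (P : pred I) (f : I -> I -> 'F_2) :
  (forall x y, f x y = f y x) -> (forall x, f x x = 0) ->
  \sum_(x | P x) \sum_(y | P y) f x y = 0.
Proof.
move=> f_sym f_irr.
rewrite pair_big /= (bigID (fun p => enum_rank p.1 < enum_rank p.2)%N) /=.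
rewrite [X in _ + X](bigID (fun p => p.1 == p.2)) /=.
rewrite [X in _ + (X + _)]big1; last by case=> x y /= /andP[_ /eqP->].
have swap_inj : injective (fun p : I * I => (p.2, p.1)) by move=> [a b] [c d] [-> ->].
rewrite add0r [X in _ + X](reindex_inj swap_inj) /=.
rewrite -[RHS](addF2 (\sum_(p | P p.1 && P p.2 && (enum_rank p.1 < enum_rank p.2)%N) f p.1 p.2)).
congr (_ + _); apply: eq_big => [[x y]|[x y] _] /=; last exact: f_sym.
rewrite -leqNgt [P y && _]andbC -andbA; congr (_ && _).
by rewrite ltn_neqAle andbC (inj_eq val_inj) (inj_eq enum_rank_inj) eq_sym.
Qed.

Section Minor.
(* T is a set of grid points and Sq the set of unit squares; dl p p' is the square
   on the left of the dart (p, p').  The points labelled Some v form the branch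
   set of v in a minor model of e, and pt v w is the end in the branch set of v of
   a grid edge that realizes the edge vw. *)
Variables (V T Sq : finType) (e : rel V) (adj : rel T) (dl : T -> T -> Sq).
Variables (lab : T -> option V) (pt : V -> V -> T).
Hypothesis e_sym : symmetric e.
Hypothesis e_irr : irreflexive e.
Hypothesis adj_sym : symmetric adj.
Hypothesis adj_irr : irreflexive adj.
Hypothesis coboundary_closed : forall (phi : Sq -> 'F_2) p, lab p ->
  \sum_(p' | adj p p') (phi (dl p p') + phi (dl p' p)) = 0.
Hypothesis closed_bounds : forall gam : T -> T -> 'F_2,
  (forall p p', gam p p' = gam p' p) ->
  (forall p p', gam p p' != 0 -> [&& adj p p', lab p : bool & lab p' : bool]) ->
  (forall p, \sum_p' gam p p' = 0) ->
  exists D : Sq -> 'F_2, forall p p', adj p p' -> lab p ->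
    D (dl p p') + D (dl p' p) = gam p p'.

Definition same_lab v : rel T :=
  [rel x y | [&& adj x y, lab x == Some v & lab y == Some v]].
Hypothesis lab_connected : forall v p p',
  lab p = Some v -> lab p' = Some v -> connect (same_lab v) p p'.
Hypothesis pt_lab : forall v w, e v w -> lab (pt v w) = Some v.
Hypothesis pt_adj : forall v w, e v w -> adj (pt v w) (pt w v).

(** A 1-chain mod 2 inside the branch set of [v], as a symmetric function on darts; its boundary at
    [p] is the sum over [p']. *)
Definition is_chain v (g : T -> T -> 'F_2) := (forall p p', g p p' = g p' p) /\
  (forall p p', g p p' != 0 -> same_lab v p p').

Lemma path_chain v x y : connect (same_lab v) x y ->
  exists2 g, is_chain v g & forall p, \sum_p' g p p' = (p == x)%:R + (p == y)%:R.
Proof.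
case/connectP => s; elim: s x => [|z s IH] x /= => [_ ->|/andP[xz pz] yE].
  exists (fun _ _ => 0); first by split=> // p p'; rewrite eqxx.
  by move=> p; rewrite big1 // addF2.
have [g [g_sym g_sup] g_bd] := IH z pz yE.
exists (fun p p' => g p p' + ((p == x) && (p' == z) || (p == z) && (p' == x))%:R).
  split=> p p'; first by rewrite g_sym orbC [_ && (p == z)]andbC [_ && (p == x)]andbC.
  have [/andP[/eqP-> /eqP->] _ //|/=] := boolP ((p == x) && (p' == z)).
  have [/andP[/eqP-> /eqP->] _ _ |/= _ _] := boolP ((p == z) && (p' == x)).
    by move: xz; rewrite /same_lab /= adj_sym => /and3P[-> -> ->].
  by rewrite addr0; apply: g_sup.
move=> p; rewrite big_split /= g_bd.
have xz' : x != z by apply: contraTneq xz => ->; rewrite /same_lab /= adj_irr.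
have -> : \sum_p' ((p == x) && (p' == z) || (p == z) && (p' == x))%:R = (p == x)%:R + (p == z)%:R :> 'F_2.
  case: (eqVneq p x) => [->|px] /=.
    rewrite (negbTE xz') /= addr0 (bigD1 z) //= eqxx big1 ?addr0 // => i /negbTE->.
    by [].
  case: (eqVneq p z) => [_|_] /=; last by rewrite big1 ?addr0.
  by rewrite add0r (bigD1 x) //= eqxx big1 ?addr0 // => i /negbTE->.
by clear; case: (p == x); case: (p == y); case: (p == z); apply/val_inj.
Qed.

(** The [w] with f w = 1 are even in number; joining each [pt v w] to a fixed [pt v w0] gives a
    chain in which the contributions at [pt v w0] cancel. *)
Lemma star_chain v (f : V -> 'F_2) :
  (forall w, f w != 0 -> e v w) -> \sum_w f w = 0 ->
  exists2 g, is_chain v g & forall p, \sum_p' g p p' = \sum_w f w * (p == pt v w)%:R.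
Proof.
move=> f_sup f0.
have [/existsP[w0 w0f] | /existsPn no] := boolP [exists w, f w != 0]; last first.
  exists (fun _ _ => 0); first by split=> // p p'; rewrite eqxx.
  by move=> p; rewrite !big1 // => w _; have := no w; rewrite negbK => /eqP->; rewrite mul0r.
have all_chain w : exists g, f w != 0 -> is_chain v g /\
    forall p, \sum_p' g p p' = (p == pt v w)%:R + (p == pt v w0)%:R.
  have [_|fw] := eqVneq (f w) 0; first by exists (fun _ _ => 0).
  have [|g cg bg] := @path_chain v (pt v w) (pt v w0); last by exists g.
  by apply: lab_connected; rewrite pt_lab // f_sup.
have [g Hg] := fin_all_exists all_chain.
exists (fun p p' => \sum_w f w * g w p p').
  split=> p p'.
    apply: eq_bigr => w _; have [->|fw] := eqVneq (f w) 0; first by rewrite !mul0r.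
    by have [[-> //]] := Hg w fw.
  move=> nz; apply/negPn/negP => nsl; move: nz; rewrite big1 ?eqxx // => w _.
  have [->|fw] := eqVneq (f w) 0; first by rewrite mul0r.
  have [[_ sup] _] := Hg w fw; have [->|/sup] := eqVneq (g w p p') 0; first by rewrite mulr0.
  by move=> sl; rewrite sl in nsl.
move=> p; rewrite exchange_big /=.
transitivity (\sum_w (f w * (p == pt v w)%:R + f w * (p == pt v w0)%:R)).
  apply: eq_bigr => w _; rewrite -big_distrr /= -mulrDr.
  have [->|fw] := eqVneq (f w) 0; first by rewrite !mul0r.
  by have [_ ->] := Hg w fw.
by rewrite big_split /= -big_distrl /= f0 mul0r addr0.
Qed.

(** An even subgraph of [e] becomes a closed grid chain: each edge is replaced by the grid edge that
    realizes it, and the loose ends at [v] are joined within its branch set by [star_chain]. *)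
Lemma lift_chain (z : V -> V -> 'F_2) :
  (forall v w, z v w = z w v) -> (forall v w, z v w != 0 -> e v w) ->
  (forall v, \sum_w z v w = 0) ->
  exists gam : T -> T -> 'F_2, [/\ forall p p', gam p p' = gam p' p,
    forall p p', gam p p' != 0 -> adj p p' /\ (exists v, same_lab v p p') \/
        (exists v w, [/\ e v w, p = pt v w & p' = pt w v]),
    forall p, \sum_p' gam p p' = 0 &
    forall v w, e v w -> gam (pt v w) (pt w v) = z v w].
Proof.
move=> z_sym z_sup z0.
have [g Hc Hb] := fin_all_exists2 (fun v => @star_chain v (z v) (z_sup v) (z0 v)).
pose g0 p p' : 'F_2 := \sum_v \sum_w z v w * ((p == pt v w) && (p' == pt w v))%:R.
have g0_nz p p' : g0 p p' != 0 -> exists v w, [/\ e v w, p = pt v w & p' = pt w v].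
  move=> nz; case: (boolP [exists v, [exists w, [&& e v w, p == pt v w & p' == pt w v]]]).
    by case/existsP => v /existsP[w /and3P[evw /eqP-> /eqP->]]; exists v, w.
  move=> no; move: nz; rewrite /g0 big1 ?eqxx // => v _; rewrite big1 // => w _.
  have [->|nz] := eqVneq (z v w) 0; first by rewrite mul0r.
  case: (boolP ((_ == _) && _)) => [pp'|_]; last by rewrite mulr0.
  by case/existsP: no; exists v; apply/existsP; exists w; rewrite z_sup.
exists (fun p p' => \sum_v g v p p' + g0 p p'); split.
- move=> p p'; congr (_ + _); first by apply: eq_bigr => v _; have [-> _] := Hc v.
  rewrite /g0 exchange_big /=; apply: eq_bigr => v _; apply: eq_bigr => w _.
  by rewrite z_sym andbC.
- move=> p p' nz.
  have [/existsP[v gv] | /existsPn no] := boolP [exists v, g v p p' != 0].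
    left; have [_ sup] := Hc v; have sl := sup _ _ gv.
    by split; [case/and3P: sl | exists v].
  right; apply: g0_nz; move: nz; rewrite big1 ?add0r // => v _.
  by apply/eqP; rewrite -[_ == _]negbK no.
- move=> p; rewrite big_split /= exchange_big /=.
  rewrite (eq_bigr (fun v => \sum_w z v w * (p == pt v w)%:R)); last first.
    by move=> v _; rewrite Hb.
  rewrite [X in _ + X]exchange_big /=.
  rewrite [X in _ + X](eq_bigr (fun v => \sum_w z v w * (p == pt v w)%:R)) ?addF2 // => v _.
  rewrite exchange_big /=; apply: eq_bigr => w _; rewrite -big_distrr /=; congr (_ * _).
  by rewrite (bigD1 (pt w v)) //= eqxx andbT big1 ?addr0 // => p' /negbTE->; rewrite andbF.
- move=> v w evw; rewrite big1 ?add0r; last first.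
    move=> u _; apply/eqP; apply: contraTT isT => nz.
    have [_ sup] := Hc u; have := sup _ _ nz; rewrite /same_lab /= !pt_lab //; last by rewrite e_sym.
    by move=> /and3P[_ /eqP[Ev] /eqP[Ew]]; rewrite Ev Ew e_irr in evw.
  have ewv : e w v by rewrite e_sym.
  rewrite /g0 (bigD1 v) //= (bigD1 w) //= !eqxx mulr1.
  have aux v' w' : (v' != v) || (w' != w) -> z v' w' * ((pt v w == pt v' w') && (pt w v == pt w' v'))%:R = 0.
    move=> ne; have [->|/z_sup e'] := eqVneq (z v' w') 0; first by rewrite mul0r.
    case: (boolP (_ && _)) => [/andP[/eqP E1 /eqP E2]|_]; last by rewrite mulr0.
    have := pt_lab e'; rewrite -E1 pt_lab // => -[Ev].
    have e'' : e w' v' by rewrite e_sym.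
    have := pt_lab e''; rewrite -E2 pt_lab // => -[Ew].
    by rewrite Ev Ew !eqxx in ne.
  rewrite big1 => [|w' nw]; last by rewrite aux ?nw ?orbT.
  by rewrite addr0 big1 ?addr0 // => v' nv; rewrite big1 // => w' _; rewrite aux ?nv.
Qed.

Definition in_skeleton : rel T := [rel p p' | adj p p' &&
  ([exists v, same_lab v p p'] ||
   [exists v, [exists w, [&& e v w, p == pt v w & p' == pt w v]]])].

(** The squares on both sides of a grid edge outside the skeleton go to one face. Only edges with a
    labelled end are crossed, as [closed_bounds] controls the bounding 2-chain only there. *)
Definition sq_cross : rel Sq := [rel s s' | [exists p, [exists p',
  [&& adj p p', lab p : bool, ~~ in_skeleton p p', s == dl p p' & s' == dl p' p]]]].

Definition sq_adj : rel Sq := [rel s s' | sq_cross s s' || sq_cross s' s].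

Definition face (s : Sq) : Sq := fingraph.root sq_adj s.

Lemma sq_adj_sym : connect_sym sq_adj.
Proof. by apply: sym_connect_sym => s s'; rewrite /sq_adj /= orbC. Qed.

Lemma face_cross p p' : adj p p' -> lab p -> ~~ in_skeleton p p' ->
  face (dl p p') = face (dl p' p).
Proof.
move=> app' lp nH; apply/eqP; rewrite /face root_connect; last exact: sq_adj_sym.
apply: connect1; rewrite /sq_adj /=; apply/orP; left.
by apply/existsP; exists p; apply/existsP; exists p'; rewrite app' lp nH !eqxx.
Qed.

Definition bd (f : Sq) (v w : V) : 'F_2 :=
  if e v w then (face (dl (pt v w) (pt w v)) == f)%:R +
                (face (dl (pt w v) (pt v w)) == f)%:R else 0.

Lemma bd_sym f v w : bd f v w = bd f w v.
Proof. by rewrite /bd e_sym addrC. Qed.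

(** Sum the coboundary of the indicator of [f] over the branch set of [v]: it vanishes at each
    point, edges inside the branch set cancel in pairs, and an edge leaving it outside the skeleton
    has the same face on both sides. Only the edges realizing [e] at [v] remain. *)
Lemma bd_even f v : \sum_w bd f v w = 0.
Proof.
pose phi (s : Sq) : 'F_2 := (face s == f)%:R.
pose d p p' : 'F_2 := if adj p p' then phi (dl p p') + phi (dl p' p) else 0.
pose B p := lab p == Some v.
have d_sym p p' : d p p' = d p' p by rewrite /d adj_sym addrC.
have tot : \sum_(p | B p) \sum_p' d p p' = 0.
  rewrite big1 // => p /eqP lp.
  by rewrite -[RHS](@coboundary_closed phi p) ?lp // [RHS]big_mkcond.
have in0 : \sum_(p | B p) \sum_(p' | B p') d p p' = 0.
  by apply: sum_sym_F2 => // p; rewrite /d adj_irr.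
have out : \sum_(p | B p) \sum_(p' | ~~ B p') d p p' = 0.
  rewrite -[LHS]add0r -{1}in0 -big_split /= -[RHS]tot; apply: eq_bigr => p _.
  by rewrite [RHS](bigID B).
rewrite -[RHS]out.
transitivity (\sum_(p | B p) \sum_(p' | ~~ B p') \sum_w bd f v w * ((p == pt v w) && (p' == pt w v))%:R); last first.
  apply: eq_bigr => p /eqP lp; apply: eq_bigr => p' lp'.
  have [/existsP[w /and3P[evw /eqP Ep /eqP Ep']] | no] :=
      boolP [exists w, [&& e v w, p == pt v w & p' == pt w v]].
    rewrite (bigD1 w) //= Ep Ep' !eqxx mulr1 big1 ?addr0.
      by rewrite /bd /d evw pt_adj.
    move=> w' nw; rewrite /bd; case: ifP => [evw'|_]; last by rewrite mul0r.
    case: (boolP (_ && _)) => [/andP[_ /eqP E]|_]; last by rewrite mulr0.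
    have := @pt_lab w' v; rewrite e_sym evw' -E pt_lab 1?e_sym // => /(_ isT) [Ew].
    by rewrite Ew eqxx in nw.
  rewrite big1; last first.
    move=> w _; rewrite /bd; case: ifP => [evw|_]; last by rewrite mul0r.
    case: (boolP (_ && _)) => [/andP[Ep Ep']|_]; last by rewrite mulr0.
    by case/existsP: no; exists w; rewrite evw Ep.
  rewrite /d; case: ifP => // app'.
  rewrite /phi face_cross ?addF2 ?lp //; apply/negP => /andP[_ /orP[]].
    case/existsP => u /and3P[_ /eqP lpu /eqP lpu'].
    by move: lp'; rewrite /B lpu' -lpu lp eqxx.
  case/existsP => u /existsP[w /and3P[euw /eqP Ep Ep']].
  case/existsP: no; exists w; move: lp; rewrite Ep pt_lab // => -[<-].
  by rewrite euw eqxx.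
symmetry; under eq_bigr => p _ do rewrite exchange_big /=.
rewrite exchange_big /=; apply: eq_bigr => w _.
rewrite /bd; case: ifP => [evw|_]; last by rewrite big1 // => p _; rewrite big1 // => p' _; rewrite mul0r.
have ewv : e w v by rewrite e_sym.
have Bv : B (pt v w) by rewrite /B pt_lab.
have Bw : ~~ B (pt w v).
  by rewrite /B pt_lab //; apply: contraTneq evw => -[->]; rewrite e_irr.
rewrite (bigD1 (pt v w)) //= (bigD1 (pt w v)) //= !eqxx mulr1.
rewrite big1 ?addr0 => [|p' /andP[_ /negbTE->]]; last by rewrite andbF mulr0.
by rewrite big1 ?addr0 // => p /andP[_ /negbTE->]; rewrite big1 // => p' _; rewrite mulr0.
Qed.

(* The boundaries of the faces generate the cycle space. *)
Lemma bd_span (z : V -> V -> 'F_2) :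
  (forall v w, z v w = z w v) -> (forall v w, z v w != 0 -> e v w) ->
  (forall v, \sum_w z v w = 0) ->
  exists D : Sq -> 'F_2, forall v w, e v w -> z v w = \sum_f D f * bd f v w.
Proof.
move=> z_sym z_sup z0; have [g [g_sym g_sup g0 gz]] := lift_chain z_sym z_sup z0.
have g_skel p p' : g p p' != 0 -> in_skeleton p p'.
  move=> nz; case: (g_sup _ _ nz) => [[app' [v sl]]|[v [w [evw -> ->]]]].
    by rewrite /in_skeleton /= app'; apply/orP; left; apply/existsP; exists v.
  rewrite /in_skeleton /= pt_adj //; apply/orP; right.
  by apply/existsP; exists v; apply/existsP; exists w; rewrite evw !eqxx.
have [D HD] : exists D : Sq -> 'F_2, forall p p', adj p p' -> lab p ->
    D (dl p p') + D (dl p' p) = g p p'.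
  apply: closed_bounds => // p p' nz; case: (g_sup _ _ nz) => [[app' [v]]|[v [w [evw -> ->]]]].
    by move=> /and3P[-> /eqP-> /eqP->].
  by rewrite pt_adj // !pt_lab // e_sym.
(* [D] changes only across the support of [g], which lies in the skeleton, so it is constant on
   faces. *)
have D_cross s s' : sq_cross s s' -> D s = D s'.
  case/existsP => p /existsP[p' /and5P[app' lp nH /eqP-> /eqP->]].
  have [g0'|] := eqVneq (g p p') 0; last by move/g_skel; rewrite (negbTE nH).
  by apply/eqP; rewrite -subr_eq0 oppF2 HD // g0'.
have D_conn s s' : connect sq_adj s s' -> D s = D s'.
  case/connectP => l; elim: l s => [|t l IH] s /= => [_ -> //|/andP[st pl] E].
  by rewrite -(IH t pl E); case/orP: st => /D_cross.
have D_face s : D (face s) = D s by apply/esym/D_conn/connect_root.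
have ind s : \sum_f D f * (face s == f)%:R = D s.
  rewrite (bigD1 (face s)) //= eqxx mulr1 big1 ?addr0 // => f.
  by rewrite eq_sym => /negbTE->; rewrite mulr0.
exists D => v w evw; rewrite -gz // -HD ?pt_adj ?pt_lab // -!ind -big_split /=.
by apply: eq_bigr => f _; rewrite /bd evw mulrDr.
Qed.

Hypothesis girth6 : forall c, uniq c -> (2 < size c)%N -> cycle e c -> (5 < size c)%N.

Definition edges : {set V * V} :=
  [set p | e p.1 p.2 && (enum_rank p.1 < enum_rank p.2)%N].

Definition orient (x y : V) : V * V :=
  if (enum_rank x < enum_rank y)%N then (x, y) else (y, x).

Lemma orient_edges x y : e x y -> orient x y \in edges.
Proof.
move=> exy; rewrite /orient inE; case: ltnP => /= h; first by rewrite exy.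
rewrite e_sym exy ltn_neqAle h andbT (inj_eq val_inj) (inj_eq enum_rank_inj).
by apply: contraTneq exy => ->; rewrite e_irr.
Qed.

Lemma edges_asym x y : (x, y) \in edges -> (y, x) \in edges = false.
Proof. by rewrite !inE /= => /andP[_ h]; rewrite ltnNge ltnW ?andbF. Qed.

Lemma sum_degree : (\sum_v #|[pred w | e v w]| = (#|edges|).*2)%N.
Proof.
under eq_bigr => v _ do rewrite -sum1_card.
rewrite (eq_bigr (fun v => \sum_(w | e v w) 1)%N) // pair_big_dep /=.
rewrite (bigID (fun p => enum_rank p.1 < enum_rank p.2)%N) /= -addnn; congr addn.
  by rewrite -[RHS]sum1_card; apply: eq_bigl => p; rewrite inE.
have swap_inj : injective (fun p : V * V => (p.2, p.1)) by move=> [a b] [c d] [-> ->].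
rewrite (reindex_inj swap_inj) /= -[RHS]sum1_card; apply: eq_bigl => -[x y] /=.
rewrite inE /= e_sym; case exy: (e x y) => //=.
rewrite -leqNgt leq_eqVlt (inj_eq val_inj) (inj_eq enum_rank_inj).
by case: eqP exy => // ->; rewrite e_irr.
Qed.

(** The support is a non-empty even subgraph, so its non-isolated vertices have degree at least 2
    and it contains a cycle. *)
Lemma bd_support f v w : bd f v w != 0 ->
  (5 < #|[set p in edges | bd f p.1 p.2 != 0%R]|)%N.
Proof.
move=> fvw; pose r := [rel x y | e x y && (bd f x y != 0)].
have nz_e x y : bd f x y != 0 -> e x y by rewrite /bd; case: ifP => //; rewrite eqxx.
have r_sym : symmetric r by move=> x y; rewrite /r /= e_sym bd_sym.
have r_irr : irreflexive r by move=> x; rewrite /r /= e_irr.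
pose P := [set x | [exists y, r x y]].
have vP : v \in P by rewrite inE; apply/existsP; exists w; rewrite /r /= nz_e.
have inP x y : r x y -> (x \in P) && (y \in P).
  by move=> rxy; rewrite !inE; apply/andP; split; apply/existsP; [by exists y|by exists x; move: rxy; rewrite /r /= e_sym bd_sym].
have [|c [uc sc cc _]] := exists_cycle r_sym r_irr vP.
  move=> x; rewrite inE => /existsP[y rxy].
  have [/existsP[z /andP[zy rxz]] | /existsPn no] := boolP [exists z, (z != y) && r x z].
    exists y, z; have /andP[_ yP] := inP x y rxy; have /andP[_ zP] := inP x z rxz.
    by split=> //; rewrite eq_sym.
  exfalso; have := bd_even f x; rewrite (bigD1 y) //= big1 ?addr0.
    by move=> E; move: rxy; rewrite /r /= E eqxx andbF.
  move=> z zy; have := no z; rewrite zy /r /= negb_and => /orP[/negbTE ne|].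
    by rewrite /bd ne.
  by rewrite negbK => /eqP.
have ce : cycle e c by apply: sub_cycle cc => x y /andP[].
apply: leq_trans (girth6 uc sc ce) _.
pose h x := orient x (next c x).
have r_next x : x \in c -> r x (next c x) by move=> xc; exact: (next_cycle cc xc).
have h_inj : {in [set x in c] &, injective h}.
  move=> x y; rewrite !inE => xc yc; rewrite /h /orient.
  have ny : next c (next c y) != y by apply: next_next_neq.
  case: ifP => _; case: ifP => _ [E1 E2] //.
    by move: ny; rewrite -E1 E2 eqxx.
  by move: ny; rewrite -E2 E1 eqxx.
rewrite -(card_uniqP uc) -[X in (X <= _)%N](@eq_card _ [set x in c]); last by move=> x; rewrite inE.
rewrite -(card_in_imset h_inj); apply/subset_leq_card/subsetP => p /imsetP[x].
rewrite inE => /r_next /andP[exn nz] ->; rewrite /h inE orient_edges //= /orient.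
by case: ifP => _ //=; rewrite bd_sym.
Qed.

(** The kernel of the incidence matrix [Dm] is the cycle space, spanned by the boundaries in [M], so
    m - (|S| - 1) <= |F|. A face in [F] has at least 6 boundary edges and an edge lies on the
    boundary of at most 2 faces, so 3 |F| <= m; together 2m + 3 <= 3 |S|. *)
Lemma minor_sparse : (0 < #|edges|)%N ->
  (\sum_v #|[pred w | e v w]| + 3 <= 3 * #|[set v | [exists w, e v w]]|)%N.
Proof.
move=> E0; pose S := [set v | [exists w, e v w]].
have eS v w : e v w -> v \in S by move=> evw; rewrite inE; apply/existsP; exists w.
have [s0 s0S] : exists s0, s0 \in S.
  by case/card_gt0P: E0 => p; rewrite inE => /andP[/eS]; exists p.1.
pose S' := S :\ s0; pose m := #|edges|.
pose ed (i : 'I_m) := enum_val i.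
have ed_E i : ed i \in edges by exact: enum_valP.
have ed_e i : e (ed i).1 (ed i).2 by have := ed_E i; rewrite inE => /andP[].
(* Leaving out [s0] does not enlarge the kernel, since the parities at all vertices add up to 0; it
   saves the 1 of Euler's formula. *)
pose Dm : 'M['F_2]_(m, #|S'|) :=
  \matrix_(i, j) (((ed i).1 == enum_val j) || ((ed i).2 == enum_val j))%:R.
pose F := [set f | [exists v, [exists w, bd f v w != 0]]].
pose M : 'M['F_2]_(#|F|, m) := \matrix_(f, i) bd (enum_val f) (ed i).1 (ed i).2.
have ker_M : (kermx Dm <= M)%MS.
  apply/row_subP => k; set r := row k _.
  have r0 : r *m Dm = 0 by apply/sub_kermxP; rewrite row_sub.
  pose z v w : 'F_2 := \sum_i r 0 i * ((ed i == (v, w)) || (ed i == (w, v)))%:R.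
  have z_sym v w : z v w = z w v by apply: eq_bigr => i _; rewrite orbC.
  have z_sup v w : z v w != 0 -> e v w.
    move=> nz; apply/negPn/negP => nevw; move: nz; rewrite /z big1 ?eqxx // => i _.
    case: (boolP (_ || _)) => [/orP[]/eqP E|_]; last by rewrite mulr0.
      by have := ed_e i; rewrite E /= (negbTE nevw).
    by have := ed_e i; rewrite E /= e_sym (negbTE nevw).
  have z_sum v : \sum_w z v w = \sum_i r 0 i * (((ed i).1 == v) || ((ed i).2 == v))%:R.
    rewrite exchange_big /=; apply: eq_bigr => i _; rewrite -big_distrr /=; congr (_ * _).
    have := ed_e i; case: (ed i) => a b /= eab.
    have ab : a != b by apply: contraTneq eab => ->; rewrite e_irr.
    have [av | av] /= := eqVneq a v.
      rewrite (bigD1 b) //= -av !eqxx big1 ?addr0 // => w wb.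
      by rewrite !xpair_eqE eqxx /= eq_sym (negbTE wb) [b == a]eq_sym (negbTE ab) andbF.
    have [bv | bv] /= := eqVneq b v.
      rewrite (bigD1 a) //= -bv !eqxx orbT big1 ?addr0 // => w wa.
      by rewrite !xpair_eqE [a == w]eq_sym (negbTE wa) (negbTE ab).
    by rewrite big1 // => w _; rewrite !xpair_eqE (negbTE av) (negbTE bv) andbF.
  have z0' v : v != s0 -> \sum_w z v w = 0.
    move=> vs0; have [vS | vS] := boolP (v \in S); last first.
      rewrite big1 // => w _; apply/eqP; apply: contraR vS => /z_sup; exact: eS.
    have vS' : v \in S' by rewrite in_setD1 vs0.
    move/rowP/(_ (enum_rank_in vS' v)): r0; rewrite !mxE => E; rewrite z_sum -[RHS]E.
    by apply: eq_bigr => i _; rewrite [Dm _ _]mxE enum_rankK_in.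
  have z0 v : \sum_w z v w = 0.
    have [->|] := eqVneq v s0; last exact: z0'.
    have : \sum_v \sum_w z v w = 0.
      apply: sum_sym_F2 => // x; apply/eqP; apply: contraTT isT => /z_sup.
      by rewrite e_irr.
    by rewrite (bigD1 s0) //= [X in _ + X]big1 ?addr0.
  have [D HD] := @bd_span z z_sym z_sup z0.
  apply/submxP; exists (\row_f D (enum_val f)); apply/rowP => i; rewrite [RHS]mxE.
  have -> : r 0 i = z (ed i).1 (ed i).2.
    rewrite /z (bigD1 i) //= -surjective_pairing eqxx mulr1 big1 ?addr0 // => j ji.
    case: (boolP (_ || _)) => [/orP[]/eqP E|_]; last by rewrite mulr0.
      by move: ji; rewrite -(inj_eq enum_val_inj) -/(ed j) E eqxx.
    by have := ed_E j; rewrite E => /edges_asym; rewrite -surjective_pairing ed_E.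
  rewrite HD // (bigID (mem F)) /= [X in _ + X]big1 ?addr0; last first.
    move=> f; rewrite inE => /existsPn/(_ (ed i).1)/existsPn/(_ (ed i).2).
    by rewrite negbK => /eqP->; rewrite mulr0.
  rewrite big_enum_val /=; apply: eq_bigr => f _; by rewrite !mxE.
have rk : (m <= #|F| + #|S'|)%N.
  have := mxrankS ker_M; rewrite mxrank_ker leq_subLR => h.
  by apply: leq_trans h _; rewrite addnC leq_add ?rank_leq_row ?rank_leq_col.
have cnt : (6 * #|F| <= 2 * m)%N.
  apply: (@leq_trans (\sum_(f in F) #|[set p in edges | bd f p.1 p.2 != 0%R]|)%N).
    rewrite mulnC -sum_nat_const; apply: leq_sum => f; rewrite inE.
    by case/existsP => v /existsP[w]; apply: bd_support.
  under eq_bigr => f _ do rewrite -sum1dep_card.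
  rewrite (exchange_big_dep (mem edges)) /=; last by move=> f p _ /andP[].
  rewrite mulnC -sum_nat_const; apply: leq_sum => p pE; rewrite sum1dep_card.
  apply: leq_trans (_ : #|[set face (dl (pt p.1 p.2) (pt p.2 p.1)); face (dl (pt p.2 p.1) (pt p.1 p.2))]| <= 2)%N; last by rewrite cards2; case: eqP.
  apply/subset_leq_card/subsetP => f; rewrite !inE => /and3P[_ _]; rewrite /bd.
  case: ifP; rewrite ?eqxx // => _; apply: contraR; rewrite negb_or ![f == _]eq_sym.
  by move=> /andP[/negbTE-> /negbTE->]; rewrite addr0.
have := cardsD1 s0 S; rewrite s0S -/S' add1n => ->.
rewrite sum_degree -mul2n -/m mulnS addnC leq_add2l.
rewrite -(leq_add2l m) -{1}[m]mul1n -mulnDl.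
apply: leq_trans (_ : 3 * (#|F| + #|S'|) <= _)%N; first by rewrite leq_mul2l rk.
rewrite mulnDr leq_add2r -(leq_pmul2l (isT : 0 < 2)%N) mulnA; exact: cnt.
Qed.

End Minor.

Lemma F2P (x : 'F_2) : x = 0 \/ x = 1.
Proof. by have [->|/F2_neq0] := eqVneq x 0; [left | right]. Qed.

(** * Chains mod 2 on the grid torus *)

Section Grid.
Variable n : nat.
Local Notation I := 'I_n.+3.
Local Notation T := (I * I)%type.

(* The grid is a torus; a square is named by its lower left corner.  Cutting the
   torus along the column of first coordinate 0 leaves a planar region. *)
Definition gx : T := (1, 0).
Definition gy : T := (0, 1).
Definition dirs : seq T := [:: gx; gy; - gx; - gy].
Definition gadj : rel T := [rel p p' | p' - p \in dirs].
Definition gleft (p p' : T) : T :=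
  if p' - p == gx then p else if p' - p == gy then p - gx
  else if p' - p == - gx then p - gx - gy else p - gy.

(** Side length at least 3 separates 1 from -1, so the four directions differ. *)
Lemma dirs_uniq : uniq dirs.
Proof.
have h0 : (1 : I) != 0 by [].
have h1 : (1 : I) != - 1.
  by rewrite -subr_eq0 opprK; apply/eqP => /(congr1 val) /=; rewrite modn_small.
rewrite /dirs /= !inE !negb_or /gx /gy !xpair_eqE /= oppr0.
by rewrite (negbTE h0) (negbTE h1) oppr_eq0 (negbTE h0) !andbF.
Qed.

Lemma gadj_sym : symmetric gadj.
Proof.
move=> p p'; rewrite /gadj /= -[p - p']opprB !inE !eqr_opp !eqr_oppLR.
by case: (_ == gx); case: (_ == gy); case: (_ == - gx); case: (_ == - gy).
Qed.

Lemma gadj_irr : irreflexive gadj.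
Proof. by move=> p; rewrite /gadj /= subrr !inE ![0 == _]eq_sym !oppr_eq0. Qed.

Lemma gadj_sum (F : T -> 'F_2) p :
  \sum_(p' | gadj p p') F p' = F (p + gx) + F (p + gy) + F (p - gx) + F (p - gy).
Proof.
rewrite (reindex_inj (addrI p)) /=.
rewrite (eq_bigl (mem dirs)); last by move=> d; rewrite /gadj /= addrC addKr.
by rewrite -(big_uniq _ dirs_uniq) /dirs !big_cons big_nil /= addr0 !addrA.
Qed.

Lemma dirs_neq : ((gy == gx) = false) * ((- gx == gx) = false) * ((- gx == gy) = false) *
  ((- gy == gx) = false) * ((- gy == gy) = false) * ((- gy == - gx) = false).
Proof.
have := dirs_uniq; rewrite /dirs cons_uniq !in_cons in_nil orbF !negb_or.
case/andP => /and3P[h1 h2 h3]; rewrite cons_uniq !in_cons in_nil orbF !negb_or.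
case/andP => /andP[h4 h5]; rewrite cons_uniq !in_cons in_nil orbF => /andP[h6 _].
by rewrite ![_ == gx]eq_sym ![_ == gy]eq_sym [- gy == - gx]eq_sym !(negbTE h1, negbTE h2, negbTE h3, negbTE h4, negbTE h5, negbTE h6).
Qed.

Lemma gleft_x p : gleft p (p + gx) = p. Proof. by rewrite /gleft addrC addKr eqxx. Qed.
Lemma gleft_y p : gleft p (p + gy) = p - gx.
Proof. by rewrite /gleft addrC addKr !dirs_neq eqxx. Qed.
Lemma gleft_Nx p : gleft p (p - gx) = p - gx - gy.
Proof. by rewrite /gleft [_ - gx - p]addrC addKr !dirs_neq eqxx. Qed.
Lemma gleft_Ny p : gleft p (p - gy) = p - gy.
Proof. by rewrite /gleft [_ - gy - p]addrC addKr !dirs_neq. Qed.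

Lemma gleft_rx p : gleft (p + gx) p = p - gy.
Proof. by rewrite -{2}(addrK gx p) gleft_Nx addrK. Qed.
Lemma gleft_ry p : gleft (p + gy) p = p.
Proof. by rewrite -{2}(addrK gy p) gleft_Ny addrK. Qed.
Lemma gleft_rNx p : gleft (p - gx) p = p - gx.
Proof. by rewrite -{2}(subrK gx p) gleft_x. Qed.
Lemma gleft_rNy p : gleft (p - gy) p = p - gy - gx.
Proof. by rewrite -{2}(subrK gy p) gleft_y. Qed.

(** Each of the four squares around [p] lies on the left of exactly one dart leaving [p] and of one
    dart entering it. *)
Lemma grid_coboundary (phi : T -> 'F_2) p :
  \sum_(p' | gadj p p') (phi (gleft p p') + phi (gleft p' p)) = 0.
Proof.
rewrite gadj_sum.
rewrite gleft_rx gleft_ry gleft_rNx gleft_rNy.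
rewrite gleft_x gleft_y gleft_Nx gleft_Ny [p - gy - gx]addrAC.
move: (phi p) (phi (p - gx)) (phi (p - gy)) (phi (p - gx - gy)) => a b c d.
by case: (F2P a) => ->; case: (F2P b) => ->; case: (F2P c) => ->; case: (F2P d) => ->; apply/val_inj.
Qed.

Section Bound.
Variable lab : T -> bool.
Hypothesis lab0 : forall p, lab p -> p.1 != 0.
Variable gam : T -> T -> 'F_2.
Hypothesis gam_sym : forall p p', gam p p' = gam p' p.
Hypothesis gam_sup : forall p p', gam p p' != 0 -> [&& gadj p p', lab p & lab p'].
Hypothesis gam_closed : forall p, \sum_p' gam p p' = 0.

(** Parity of the chain edges crossed on the way from the cut column 0 to [s] along its row. *)
Let D (s : T) : 'F_2 := \sum_(i : I | (i <= s.1)%N) gam (i, s.2) (i, s.2 + 1).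

Let val_pred (i : I) : i != 0 -> val (i - 1) = (val i).-1.
Proof.
move=> i0; have {}i0 : (0 < i)%N by rewrite lt0n; apply: contra i0 => /eqP E; apply/eqP/val_inj.
have lti : (i.-1 < n.+3)%N by apply: leq_ltn_trans (leq_pred i) _.
have E : i = Ordinal lti + 1; last by rewrite {1}E addrK.
apply/val_inj => /=; rewrite (modn_small (isT : 1 < n.+3)%N) addn1 prednK //.
by rewrite modn_small.
Qed.

Let D_x s : s.1 != 0 -> D s + D (s - gx) = gam s (s + gy).
Proof.
case: s => i j /= i0; rewrite /D /= subr0.
rewrite (bigD1 i) //= -addrA addrC -addrA.
have -> : \sum_(k : I | (k <= (i - 1)%R)%N) gam (k, j) (k, j + 1) = \sum_(k : I | (k <= i)%N && (k != i)) gam (k, j) (k, j + 1).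
  apply: eq_bigl => k; rewrite val_pred // andbC -(inj_eq val_inj) -ltn_neqAle.
  have : (0 < i)%N by rewrite lt0n; apply: contra i0 => /eqP E; apply/eqP/val_inj.
  by move=> ipos; rewrite -[in LHS]ltnS prednK.
by rewrite addrCA addrA addF2 add0r /gy; congr gam; congr pair; rewrite /= addr0.
Qed.

Let gam_nbrs p : gam p (p + gx) + gam p (p + gy) + gam p (p - gx) + gam p (p - gy) = 0.
Proof.
rewrite -gadj_sum -[RHS](gam_closed p) [RHS](bigID (gadj p)) /= [X in _ = _ + X]big1 ?addr0 // => p' np.
by apply/eqP; apply: contraR np => /gam_sup /and3P[].
Qed.

(** Induction along the row: in column 0 everything vanishes, and closedness of [gam] at [s] carries
    the relation from the edge on the left of [s] to the edge on its right. *)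
Let D_y s : D s + D (s - gy) = gam s (s + gx).
Proof.
elim: {s}(val s.1) {-2}s (erefl (val s.1)) => [|k IH] s Ek.
  have s0 : s.1 = 0 by apply/val_inj.
  have g0 p p' : p.1 = 0 -> gam p p' = 0.
    by move=> p0; apply/eqP; apply: contraT => /gam_sup /and3P[_ /lab0]; rewrite p0 eqxx.
  have E2 : (s - gy).1 = s.1 by apply: subr0.
  rewrite g0 // /D E2 !big1 ?addr0 // => i h;
    by apply: g0; apply/val_inj/eqP; rewrite -[X in _ == X]Ek s0; rewrite s0 leqn0 in h.
have s0 : s.1 != 0 by apply: contra_eqN Ek => /eqP->.
have E1 : val (s - gx).1 = k by rewrite val_pred // Ek.
have := IH _ E1; rewrite subrK; have := D_x s0.
have := @D_x (s - gy); rewrite /= subr0 => /(_ s0); rewrite subrK.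
have := gam_nbrs s; rewrite [gam s (s - gx)]gam_sym [gam s (s - gy)]gam_sym.
have -> : s - gy - gx = s - gx - gy by rewrite addrAC.
move: (gam s (s + gx)) (gam s (s + gy)) (gam (s - gx) s) (gam (s - gy) s) (D s) (D (s - gx)) (D (s - gy)) (D (s - gx - gy)) => a b c d u v w x.
move=> H1 H2 H3 H4.
have {}H1 : a = b + c + d.
  by apply/eqP; rewrite -subr_eq0 oppF2 !addrA H1.
rewrite H1 -H2 -H3 -H4.
case: (F2P u) => ->; case: (F2P v) => ->; case: (F2P w) => ->; case: (F2P x) => ->; exact/val_inj.
Qed.

Lemma grid_bounds : exists D : T -> 'F_2, forall p p', gadj p p' -> lab p ->
  D (gleft p p') + D (gleft p' p) = gam p p'.
Proof.
exists D => p p' app' /lab0 p0.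
have [d dE ->] : exists2 d, d \in dirs & p' = p + d by exists (p' - p); rewrite // addrC subrK.
move: dE; rewrite !inE => /or4P[] /eqP->.
- by rewrite gleft_x gleft_rx D_y.
- by rewrite gleft_y gleft_ry addrC D_x.
- by rewrite gleft_Nx gleft_rNx addrC D_y subrK; apply: gam_sym.
- have E2 : (p - gy).1 = p.1 by apply: subr0.
  by rewrite gleft_Ny gleft_rNy D_x ?E2 // subrK; apply: gam_sym.
Qed.

End Bound.
End Grid.

End Algebra.

From mathcomp Require Import all_classical all_reals all_analysis lra.

(** * From plane drawings to grid minors *)

Section Topology.
Import Order.TTheory GRing.Theory Num.Theory.
Import numFieldNormedType.Exports.
Local Open Scope classical_set_scope.
Local Open Scope ring_scope.

Definition ggraph n (Q : pred ('I_n.+3 * 'I_n.+3)) : rel ('I_n.+3 * 'I_n.+3) :=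
  [rel p p' | [&& @gadj n p p', Q p & Q p']].

Lemma ggraph_sym n (Q : pred ('I_n.+3 * 'I_n.+3)) : connect_sym (ggraph Q).
Proof.
by apply: sym_connect_sym => p p'; rewrite /ggraph /= gadj_sym; congr (_ && _); rewrite andbC.
Qed.

Lemma ggraph_sub n (Q Q' : pred ('I_n.+3 * 'I_n.+3)) p p' :
  (forall x, Q x -> Q' x) -> connect (ggraph Q) p p' -> connect (ggraph Q') p p'.
Proof.
move=> sub; apply: connect_sub => x y /and3P[xy Qx Qy]; apply: connect1.
by rewrite /ggraph /= xy !sub.
Qed.

Lemma ordS_val n (i i' : 'I_n.+3) : val i' = (val i).+1 -> i' = i + 1.
Proof.
move=> E; apply/val_inj; rewrite /= (modn_small (isT : 1 < n.+3)%N) addn1 -E.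
exact/esym/modn_small/ltn_ord.
Qed.

Lemma gadj_x n (i j : 'I_n.+3) : gadj (i, j) (i + 1, j).
Proof.
rewrite /gadj /=; have -> : (i + 1, j) - (i, j) = gx n; last by rewrite inE eqxx.
by rewrite -[LHS]/(i + 1 - i, j - j) subrr [_ - i]addrC addKr.
Qed.

Lemma gadj_y n (i j : 'I_n.+3) : gadj (i, j) (i, j + 1).
Proof.
rewrite /gadj /=; have -> : (i, j + 1) - (i, j) = gy n; last by rewrite !inE eqxx orbT.
by rewrite -[LHS]/(i - i, j + 1 - j) subrr [_ - j]addrC addKr.
Qed.

Lemma line_connect_x n (Q : pred ('I_n.+3 * 'I_n.+3)) (a b j : 'I_n.+3) : (a <= b)%N ->
  (forall i : 'I_n.+3, (a <= i <= b)%N -> Q (i, j)) -> connect (ggraph Q) (a, j) (b, j).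
Proof.
elim: {b}(val b) {-2}b (erefl (val b)) => [|m IH] b Eb ab HQ.
  have -> : a = b by apply/val_inj/eqP; rewrite eqn_leq ab /= [nat_of_ord b]Eb leq0n.
  exact: connect0.
have [Eab | nab] := eqVneq (val a) (val b); first by rewrite (val_inj Eab) connect0.
have {nab}ab' : (a < b)%N by rewrite ltn_neqAle nab ab.
have mN : (m < n.+3)%N by rewrite ltnW // -Eb ltn_ord.
have am : (a <= Ordinal mN)%N by rewrite -ltnS -Eb.
apply: connect_trans (IH (Ordinal mN) erefl am _) _ => [i /andP[ai im]|].
  by apply: HQ; rewrite ai ltnW // Eb ltnS.
apply: connect1; rewrite /ggraph /= !HQ ?ab ?leqnn ?am ?Eb ?leqnSn // !andbT.
by rewrite (@ordS_val n (Ordinal mN) b) // gadj_x.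
Qed.

Lemma line_connect_y n (Q : pred ('I_n.+3 * 'I_n.+3)) (a b i : 'I_n.+3) : (a <= b)%N ->
  (forall j : 'I_n.+3, (a <= j <= b)%N -> Q (i, j)) -> connect (ggraph Q) (i, a) (i, b).
Proof.
elim: {b}(val b) {-2}b (erefl (val b)) => [|m IH] b Eb ab HQ.
  have -> : a = b by apply/val_inj/eqP; rewrite eqn_leq ab /= [nat_of_ord b]Eb leq0n.
  exact: connect0.
have [Eab | nab] := eqVneq (val a) (val b); first by rewrite (val_inj Eab) connect0.
have {nab}ab' : (a < b)%N by rewrite ltn_neqAle nab ab.
have mN : (m < n.+3)%N by rewrite ltnW // -Eb ltn_ord.
have am : (a <= Ordinal mN)%N by rewrite -ltnS -Eb.
apply: connect_trans (IH (Ordinal mN) erefl am _) _ => [j /andP[aj jm]|].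
  by apply: HQ; rewrite aj ltnW // Eb ltnS.
apply: connect1; rewrite /ggraph /= !HQ ?ab ?leqnn ?am ?Eb ?leqnSn // !andbT.
by rewrite (@ordS_val n (Ordinal mN) b) // gadj_y.
Qed.

(** * Lattice points near points and arcs of the plane *)

Section Lattice.
Variables (R : realType) (n : nat) (eps M : R).
Hypothesis eps_gt0 : 0 < eps.
Local Notation T := ('I_n.+3 * 'I_n.+3)%type.

Definition lpos (p : T) : R * R := (eps * p.1%:R - M, eps * p.2%:R - M).

Definition near_pt (rho : R) (x : R * R) : pred T := [pred p | `|lpos p - x| <= rho].

Lemma norm_pair_le (x : R * R) rho : (`|x| <= rho) = (`|x.1| <= rho) && (`|x.2| <= rho).
Proof. by rewrite prod_normE ge_max. Qed.

Lemma between_norm (a b c z rho : R) : a <= c -> c <= b ->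
  `|a - z| <= rho -> `|b - z| <= rho -> `|c - z| <= rho.
Proof.
by move=> ac cb; rewrite !ler_norml => /andP[a1 a2] /andP[b1 b2]; apply/andP; split; lra.
Qed.

(** Balls of the product norm are squares, so moving first horizontally and then vertically stays
    inside. *)
Lemma near_connect rho x p p' : near_pt rho x p -> near_pt rho x p' ->
  connect (ggraph (near_pt rho x)) p p'.
Proof.
have mono (i j : 'I_n.+3) : (i <= j)%N -> eps * i%:R - M <= eps * j%:R - M.
  by move=> ij; rewrite lerD2r ler_pM2l // ler_nat.
case: p p' => a j [b k]; rewrite /near_pt /= !norm_pair_le /= => /andP[ha hj] /andP[hb hk].
apply: (@connect_trans _ _ (b, j)).
  have Hx (a' b' : 'I_n.+3) : (a' <= b')%N -> `|eps * a'%:R - M - x.1| <= rho ->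
     `|eps * b'%:R - M - x.1| <= rho -> connect (ggraph (near_pt rho x)) (a', j) (b', j).
    move=> ab ha' hb'; apply: line_connect_x => // i /andP[ai ib].
    rewrite /near_pt /= norm_pair_le /= hj andbT.
    by apply: between_norm ha' hb'; exact: mono.
  by case: (leqP a b) => [|/ltnW] ab; [|rewrite ggraph_sym]; apply: Hx.
have Hy (a' b' : 'I_n.+3) : (a' <= b')%N -> `|eps * a'%:R - M - x.2| <= rho ->
   `|eps * b'%:R - M - x.2| <= rho -> connect (ggraph (near_pt rho x)) (b, a') (b, b').
  move=> ab ha' hb'; apply: line_connect_y => // i /andP[ai ib].
  rewrite /near_pt /= norm_pair_le /= hb /=.
  by apply: between_norm ha' hb'; exact: mono.
by case: (leqP j k) => [|/ltnW] jk; [|rewrite ggraph_sym]; apply: Hy.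
Qed.

Lemma near_exists x : `|x| <= M -> 2 * M < eps * n.+2%:R -> exists p, near_pt eps x p.
Proof.
rewrite norm_pair_le => /andP[x1 x2] Mn.
have coord (y : R) : `|y| <= M -> exists i : 'I_n.+3, `|eps * i%:R - M - y| <= eps.
  rewrite ler_norml => /andP[y1 y2].
  have z0 : 0 <= (y + M) / eps by apply: divr_ge0; [lra | exact: ltW].
  have /andP[t1 t2] := truncn_itv z0.
  have lt : (Num.truncn ((y + M) / eps) < n.+3)%N.
    rewrite truncn_lt_nat // ltr_pdivrMr //; have h1 : y + M <= 2 * M by rewrite mulr_natl mulr2n lerD2r.
    apply: le_lt_trans h1 (lt_le_trans Mn _).
    by rewrite mulrC ler_pM2r // ler_nat.
  exists (Ordinal lt) => /=.
  rewrite ler_pdivlMr // in t1; rewrite ltr_pdivrMr // -natr1 mulrDl mul1r in t2.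
  by rewrite mulrC ler_norml; apply/andP; split; lra.
have [i hi] := coord _ x1; have [j hj] := coord _ x2.
by exists (i, j); rewrite /near_pt /= norm_pair_le /= hi hj.
Qed.

Definition near_arc (A : set (R * R)) : pred T :=
  [pred p | `[< exists2 x, A x & near_pt (2 * eps) x p >]].

Hypothesis M_large : 2 * M < eps * n.+2%:R.

(** The distance 2 eps is eps for rounding plus eps for moving along the curve: if f s is within eps
    of f t, a lattice point within eps of f t is near both. So the parameters reached from [p] form
    an open and closed subset of [0, 1]. *)
Lemma arc_connect (f : R -> R * R) p p' :
  {within `[0, 1], continuous f} -> (forall t, (`[0, 1]%classic : set R) t -> `|f t| <= M) ->
  near_pt (2 * eps) (f 0) p -> near_pt (2 * eps) (f 1) p' ->
  connect (ggraph (near_arc (f @` `[0, 1]))) p p'.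
Proof.
move=> cf fM; set I := (`[0, 1]%classic : set R); set G := ggraph _ => np np'.
have I0 : I 0 by rewrite /I /= in_itv /= lexx ler01.
have I1 : I 1 by rewrite /I /= in_itv /= lexx ler01.
have loc t q q' : I t -> near_pt (2 * eps) (f t) q -> near_pt (2 * eps) (f t) q' -> connect G q q'.
  move=> It nq nq'; apply: ggraph_sub (near_connect nq nq') => x nx.
  by apply/asboolP; exists (f t) => //; exists t.
pose B := [set t | I t /\ forall q, near_pt (2 * eps) (f t) q -> connect G p q].
have nearI t : I t -> \forall s \near t, I s -> (B s <-> B t).
  move=> It; have [q0 nq0] := near_exists (fM t It) M_large.
  have nq0' : near_pt (2 * eps) (f t) q0.
    by apply: le_trans nq0 _; rewrite mulr_natl mulr2n lerDl ltW.
  have /cvgrPdist_le/(_ _ eps_gt0) : f s @[s --> within I (nbhs t)] --> f t.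
    by move/subspace_continuousP: cf; apply.
  rewrite near_withinE; apply: filterS => s ns Is.
  have nq0s : near_pt (2 * eps) (f s) q0.
    rewrite /near_pt /= -[X in `|X|](subrKA (f t)) mulr_natl mulr2n.
    by apply: le_trans (ler_normD _ _) _; rewrite lerD // ns.
  split=> -[_ HB]; split=> // q nq.
    by apply: connect_trans (HB _ nq0s) _; apply: loc nq0' nq.
  by apply: connect_trans (HB _ nq0') _; apply: loc nq0s nq.
suff EB : B = I by have [_ ->] : B 1 by rewrite EB.
have BI : B `<=` I by move=> t [].
apply: (@segment_connected R 0 1).
- by exists 0; split=> // q nq; apply: loc nq.
(* [segment_connected] wants traces on [0, 1] of an open and of a closed set; interiors of sets that
   contain the complement of [0, 1] provide them. *)
- exists (~` I `|` B)°; first exact: open_interior.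
  apply/seteqP; split=> [t Bt|t [It /interior_subset[|]//]].
  split; first exact: BI.
  have := nearI t (BI _ Bt); apply: filterS => s Hs.
  have [Is|] := pselect (I s); [right; exact/Hs | by left].
- exists (~` (~` I `|` ~` B)°); first by apply: open_closedC; exact: open_interior.
  apply/seteqP; split=> [t Bt|t [It nt]].
    split; first exact: BI.
    by move=> /interior_subset[|]//; apply; exact: BI.
  apply: contrapT => nBt; apply: nt; have := nearI t It; apply: filterS => s Hs.
  have [Is|] := pselect (I s); [right=> Bs; apply: nBt; exact/(Hs Is) | by left].
Qed.

End Lattice.

(** The set of differences x - y is compact, hence closed, and misses 0, so it misses a ball around
    0. *)
Lemma compact_separated (R : realType) (V : normedModType R) (A B : set V) :
  compact A -> compact B -> (forall x, A x -> B x -> False) ->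
  exists2 d : R, 0 < d & forall x y, A x -> B y -> d <= `|x - y|.
Proof.
move=> cA cB AB; pose f (z : V * V) := z.1 - z.2.
have cf : continuous f.
  by move=> z; apply: cvgB; [exact: cvg_fst | exact: cvg_snd].
have cK : compact (f @` (A `*` B)).
  by apply: continuous_compact; [exact: continuous_subspaceT | exact: compact_setX].
have oK : open (~` (f @` (A `*` B))).
  by apply: closed_openC; apply: compact_closed => //; exact: norm_hausdorff.
have K0 : (~` (f @` (A `*` B))) 0.
  move=> [[x y] /= [Ax By]] /eqP; rewrite subr_eq0 => /eqP xy.
  by apply: (AB x) => //; have -> : x = y := xy.
have /nbhs_ballP[d /= d0 Hd] := open_nbhs_nbhs (conj oK K0).
exists d => // x y Ax By; rewrite leNgt; apply/negP => lt.
apply: (Hd (x - y)); last by exists (x, y).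
by rewrite -ball_normE /ball_ /= sub0r normrN.
Qed.

Lemma fin_pos (R : realType) (I : finType) (P : I -> R -> Prop) :
  (forall i, exists2 r, 0 < r & P i r) ->
  (forall i r r', r' <= r -> P i r -> P i r') ->
  exists2 r, 0 < r & forall i, P i r.
Proof.
move=> ex mono; have [f f0 fP] := fin_all_exists2 ex.
exists (\big[Order.min/1]_i f i).
  by apply: lt_bigmin.
by move=> i; apply: mono (fP i); apply: bigmin_le_cond.
Qed.

Lemma connect_component (T : finType) (g : rel T) c p : connect g c p ->
  connect [rel x y | [&& g x y, connect g c x & connect g c y]] c p.
Proof.
set g' := [rel x y | _]; move=> /connectP[s ps ->].
have gen : forall s x, connect g c x -> path g x s -> connect g' x (last x s).
  elim=> [|y l IH] x cx /= => [_|/andP[xy yl]]; first exact: connect0.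
  have cy : connect g c y := connect_trans cx (connect1 xy).
  by apply: connect_trans (IH y cy yl); apply: connect1; rewrite /g' /= xy cx.
exact: gen (connect0 _ _) ps.
Qed.

Lemma connect_cross (T : finType) (g : rel T) (C : pred T) x y :
  connect g x y -> C x -> ~~ C y -> exists a b, [/\ g a b, C a & ~~ C b].
Proof.
case/connectP => s; elim: s x => [|z s IH] x /= => [_ -> ->//|/andP[xz zs] yE Cx nCy].
have [Cz|nCz] := boolP (C z); first exact: IH zs yE Cz nCy.
by exists x, z.
Qed.

(** * The grid minor of a plane drawing *)

Section Drawing.
Variables (R : realType) (V : finType) (e : rel V).
Variables (pos : V -> R * R) (arc : V -> V -> set (R * R)).
Hypothesis e_sym : symmetric e.
Hypothesis e_irr : irreflexive e.
Hypothesis draw : plane_drawing e pos arc.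

Lemma arc_compact u v : e u v -> compact (arc u v).
Proof.
move=> euv; have [f [cf _ _ _ ->]] := drawing_arc draw euv.
by apply: continuous_compact => //; apply: segment_compact.
Qed.

(** The factor 4 leaves room for discs of radius r around the vertices, disjoint from each other and
    from strips along edges that end elsewhere. *)
Lemma vertex_gap : exists2 r : R, 0 < r &
  (forall u w, u != w -> 4 * r <= `|pos u - pos w|) /\
  (forall u v w x, e u v -> w != u -> w != v -> arc u v x -> 4 * r <= `|x - pos w|).
Proof.
have [r1 r10 H1] : exists2 r : R, 0 < r & forall p : V * V, p.1 != p.2 -> r <= `|pos p.1 - pos p.2|.
  apply: fin_pos => [[u w]|p r r' rr' H ne] /=; last exact: le_trans rr' (H ne).
  have [->|ne] := eqVneq u w; first by exists 1.
  exists `|pos u - pos w| => //; rewrite normr_gt0 subr_eq0.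
  by apply: contra ne => /eqP /(drawing_inj draw) ->.
have [r2 r20 H2] : exists2 r : R, 0 < r & forall p : V * V * V, e p.1.1 p.1.2 ->
    p.2 != p.1.1 -> p.2 != p.1.2 -> forall x, arc p.1.1 p.1.2 x -> r <= `|x - pos p.2|.
  apply: fin_pos => [[[u v] w]|p r r' rr' H h1 h2 h3 x Ax] /=; last exact: le_trans rr' (H h1 h2 h3 x Ax).
  case: (boolP [&& e u v, w != u & w != v]) => [/and3P[euv wu wv]|no].
    have [|d d0 Hd] := compact_separated (arc_compact euv) (@compact_set1 _ (pos w)).
      move=> x Ax xE; have := @drawing_avoid _ _ _ _ _ draw u v w euv; rewrite -xE => /(_ Ax).
      by case=> E; move: wu wv; rewrite E eqxx.
    by exists d => // _ _ _ x Ax; apply: Hd.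
  by exists 1 => // h1 h2 h3; rewrite h1 h2 h3 in no.
exists (Order.min r1 r2 / 4); first by rewrite divr_gt0 // lt_min r10.
rewrite mulrC divfK //; split=> [u w uw|u v w x euv wu wv Ax].
  by apply: le_trans (H1 (u, w) uw); rewrite ge_min lexx.
by apply: le_trans (H2 (u, v, w) euv wu wv x Ax); rewrite ge_min lexx orbT.
Qed.

(** Away from the vertices the arcs of distinct edges are disjoint compact sets, by
    [drawing_disjoint]. *)
Lemma arc_gap r : 0 < r -> exists2 d : R, 0 < d &
  forall u v x y a b, e u v -> e x y -> (u, v) != (x, y) -> (u, v) != (y, x) ->
  arc u v a -> (forall w, r <= `|a - pos w|) ->
  arc x y b -> (forall w, r <= `|b - pos w|) -> d <= `|a - b|.
Proof.
move=> r0; pose far := [set a | forall w, r <= `|a - pos w|].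
have far_closed : closed far.
  have -> : far = \bigcap_(w in setT) [set a | r <= `|a - pos w|].
    by apply/seteqP; split=> [a Ha w _|a Ha w]; [exact: Ha | exact: Ha].
  apply: closed_bigI => w _.
  rewrite -[X in closed X]/((fun a => `|a - pos w|) @^-1` [set x | r <= x]).
  apply: preimage_closed; last exact: closed_ge.
  by move=> a _; apply: cvg_norm; apply: cvgB; [exact: cvg_id | exact: cvg_cst].
have [d d0 Hd] : exists2 d : R, 0 < d & forall p : V * V * (V * V), e p.1.1 p.1.2 -> e p.2.1 p.2.2 ->
    p.1 != p.2 -> p.1 != (p.2.2, p.2.1) -> forall a b, arc p.1.1 p.1.2 a -> far a ->
    arc p.2.1 p.2.2 b -> far b -> d <= `|a - b|.
  apply: fin_pos => [[[u v] [x y]]|p s s' ss' H h1 h2 h3 h4 a b h5 h6 h7 h8] /=; last first.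
    exact: le_trans ss' (H h1 h2 h3 h4 a b h5 h6 h7 h8).
  case: (boolP [&& e u v, e x y, (u, v) != (x, y) & (u, v) != (y, x)]) => [/and4P[euv exy n1 n2]|no].
    have [|d d0 Hd] := compact_separated (compact_closedI (arc_compact euv) far_closed) (compact_closedI (arc_compact exy) far_closed).
      move=> a [a1 a2] [a3 _]; have [w _ wE] := drawing_disjoint draw euv exy n1 n2 (conj a1 a3).
      by have := a2 w; rewrite wE subrr normr0 leNgt r0.
    by exists d => // _ _ _ _ a b a1 a2 b1 b2; apply: Hd.
  by exists 1 => // h1 h2 h3 h4; rewrite h1 h2 h3 h4 in no.
by exists d => // u v x y a b euv exy n1 n2 a1 a2 b1 b2; apply: (Hd ((u, v), (x, y))).
Qed.

Lemma drawing_bounded : exists2 M : R, 0 < M &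
  (forall u, `|pos u| <= M) /\ (forall u v x, e u v -> arc u v x -> `|x| <= M).
Proof.
(* [fin_pos] serves conditions that persist when the number decreases, so the bound is stated for
   its inverse. *)
have [r r0 Hr] : exists2 r : R, 0 < r & forall p : V * V,
    r * `|pos p.1| <= 1 /\ (e p.1 p.2 -> forall x, arc p.1 p.2 x -> r * `|x| <= 1).
  apply: fin_pos => [[u v]|p r r' rr' [H1 H2]] /=; last first.
    have le x : r * `|x| <= 1 -> r' * `|x| <= 1 by apply: le_trans; apply: ler_wpM2r.
    by split=> [|euv x Ax]; apply: le; [exact: H1 | exact: H2].
  have bound (A : set (R * R)) : compact A -> exists2 N : R, 0 < N & forall x, A x -> `|x| <= N.
    move=> /compact_bounded[N [_ HN]]; exists (`|N| + 1) => [|x Ax].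
      by rewrite ltr_wpDl.
    by apply: HN => //; rewrite ltr_pwDr // ler_norm.
  have [N1 N10 H1] := bound _ (@compact_set1 _ (pos u)).
  have [N2 N20 H2] : exists2 N : R, 0 < N & e u v -> forall x, arc u v x -> `|x| <= N.
    case: (boolP (e u v)) => [euv|]; last by exists 1.
    by have [N N0 HN] := bound _ (arc_compact euv); exists N.
  exists (N1 + N2)^-1; first by rewrite invr_gt0 addr_gt0.
  split=> [|euv x Ax]; rewrite mulrC ler_pdivrMr ?mul1r ?addr_gt0 //.
    by apply: le_trans (H1 _ erefl) _; rewrite lerDl ltW.
  by apply: le_trans (H2 euv x Ax) _; rewrite lerDr ltW.
have inv x : r * `|x| <= 1 -> `|x| <= r^-1.
  by move=> h; rewrite -[r^-1]mul1r ler_pdivlMr // mulrC.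
exists r^-1; first by rewrite invr_gt0.
split=> [u|u v x euv Ax]; apply: inv; first by have [] := Hr (u, u).
by have [_ /(_ euv x Ax)] := Hr (u, v).
Qed.

(** The region of [u] is a disc around it and, for each edge to a vertex of higher rank, a strip
    along the arc outside both end discs; the branch set is the component of the center. So each
    strip belongs to one end, and the edge is realized where the lattice path along the arc leaves
    the component of [u], which can only happen into the disc of [v]. *)
Theorem planar_grid_minor : exists n (lab : 'I_n.+3 * 'I_n.+3 -> option V)
    (pt : V -> V -> 'I_n.+3 * 'I_n.+3),
  [/\ forall p, lab p -> p.1 != 0,
      forall v p p', lab p = Some v -> lab p' = Some v -> connect (same_lab (@gadj n) lab v) p p',
      forall v w, e v w -> lab (pt v w) = Some v &
      forall v w, e v w -> gadj (pt v w) (pt w v)].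
Proof.
have [r r0 [gapV gapE]] := vertex_gap.
have [d d0 gapA] := @arc_gap (r / 2) ltac:(by rewrite divr_gt0).
have [M0 M00 [boundV boundE]] := drawing_bounded.
(* A strip stays within 2 eps <= r / 4 of its arc: the arc points involved are at least r / 2 away
   from all vertices, and two strips sharing a lattice point would bring two arcs within 4 eps <
   d. *)
pose eps := Order.min (r / 8) (d / 8).
have eps0 : 0 < eps by rewrite lt_min !divr_gt0.
have eps_r : 8 * eps <= r.
  by rewrite mulrC -ler_pdivlMr // ge_min lexx.
have eps_d : 8 * eps <= d.
  by rewrite mulrC -ler_pdivlMr // ge_min lexx orbT.
(* Column 0 lies at first coordinate -M, and labelled points stay within r of the drawing, so the
   margin keeps them off that column. *)
pose M := M0 + 2 * r.
pose n := Num.truncn (2 * M / eps).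
have M_large : 2 * M < eps * n.+2%:R.
  rewrite [eps * _]mulrC -ltr_pdivrMr //; apply: lt_trans (truncnS_gt _) _.
  by rewrite ltr_nat.
have M0M : M0 <= M by rewrite /M; lra.
pose near := @near_pt R n eps M.
pose Sv v := near r (pos v).
have ex_ctr v : exists p, near eps (pos v) p.
  by apply: near_exists => //; apply: le_trans (boundV v) M0M.
have [ctr ctr_near] := fin_all_exists ex_ctr.
have near_le (a b : R) x p : a <= b -> near a x p -> near b x p.
  by move=> ab h; apply: le_trans h ab.
have ctr_S v : Sv v (ctr v) by apply: near_le (ctr_near v); lra.
pose int u v p := [&& @near_arc R n eps M (arc u v) p, ~~ Sv u p & ~~ Sv v p].
pose Reg u := [pred p | Sv u p || [exists v, [&& e u v, (enum_rank u < enum_rank v)%N & int u v p]]].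
have tri (x y z : R * R) (a b : R) : `|x - y| <= a -> `|x - z| <= b -> `|y - z| <= a + b.
  move=> h1 h2; rewrite -(subrKA x) -normrN; rewrite normrN.
  by apply: le_trans (ler_normD _ _) _; rewrite lerD // distrC.
have Sv_disj u v p : Sv u p -> Sv v p -> u = v.
  move=> h1 h2; apply/eqP/negPn/negP => uv.
  have := gapV u v uv; have := tri _ _ _ _ _ h1 h2; lra.
have int_far u v p x : e u v -> ~~ Sv u p -> ~~ Sv v p -> arc u v x -> near (2 * eps) x p ->
    forall w, r / 2 <= `|x - pos w|.
  move=> euv nu nv Ax nx w.
  have aux z : ~~ Sv z p -> r / 2 <= `|x - pos z|.
    rewrite /Sv /near /near_pt /= -ltNge => hz; rewrite leNgt; apply/negP => lt.
    have := @tri x (lpos eps M p) (pos z) (2 * eps) (r / 2); rewrite distrC => /(_ nx (ltW lt)); lra.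
  have [->|wu] := eqVneq w u; first exact: aux.
  have [->|wv] := eqVneq w v; first exact: aux.
  have := gapE u v w x euv wu wv Ax; lra.
have int_S u v w p : e u v -> int u v p -> Sv w p -> False.
  move=> euv /and3P[/asboolP[x Ax nx] nu nv] hw.
  have wu : w != u by apply: contraNneq nu => <-.
  have wv : w != v by apply: contraNneq nv => <-.
  have := gapE u v w x euv wu wv Ax; have := tri _ _ _ _ _ nx hw; lra.
have Reg_disj u v p : Reg u p -> Reg v p -> u = v.
  case/orP => [hu|/existsP[u' /and3P[eu ru iu]]] /orP[hv|/existsP[v' /and3P[ev rv iv]]].
  - exact: Sv_disj hu hv.
  - by have := int_S _ _ _ _ ev iv hu.
  - by have := int_S _ _ _ _ eu iu hv.
  - apply/eqP/negPn/negP => uv.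
    have n1 : (u, u') != (v, v') by apply: contra uv => /eqP[->].
    have n2 : (u, u') != (v', v).
      by apply/eqP => -[E1 E2]; move: ru rv; rewrite E1 E2 => h1; rewrite ltnNge ltnW.
    case/and3P: iu => /asboolP[a Aa na] nu nu'; case/and3P: iv => /asboolP[b Ab nb] nv nv'.
    have := gapA _ _ _ _ _ _ eu ev n1 n2 Aa (int_far _ _ _ _ eu nu nu' Aa na) Ab (int_far _ _ _ _ ev nv nv' Ab nb).
    have := tri _ _ _ _ _ na nb; lra.
pose G u := ggraph (Reg u).
pose comp u p := connect (G u) (ctr u) p.
have comp_Reg u p : comp u p -> Reg u p.
  case/connectP => s; case/lastP: s => [_ ->|s y]; first by apply/orP; left; exact: ctr_S.
  by rewrite rcons_path last_rcons => /andP[_ /and3P[_ _ h]] ->.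
pose lab p := [pick u | comp u p].
have labP u p : lab p = Some u <-> comp u p.
  rewrite /lab; case: pickP => [v cv|no]; last by split=> //; rewrite no.
  split=> [[<-//]|cu]; congr Some; apply: Reg_disj (comp_Reg _ _ cv) (comp_Reg _ _ cu).
have Sv_comp u p : Sv u p -> comp u p.
  move=> hu; apply: ggraph_sub (near_connect eps0 (ctr_S u) hu) => x hx.
  by apply/orP; left.
have touch u v : e u v -> (enum_rank u < enum_rank v)%N -> exists ab,
    [/\ gadj ab.1 ab.2, lab ab.1 = Some u & lab ab.2 = Some v].
  move=> euv ruv; have [f [cf _ f0 f1 fA]] := drawing_arc draw euv.
  have ctr2 w : near (2 * eps) (pos w) (ctr w) by apply: near_le (ctr_near w); lra.
  have cn : connect (ggraph (@near_arc R n eps M (arc u v))) (ctr u) (ctr v).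
    rewrite fA; apply: arc_connect => //; rewrite ?f0 ?f1 // => t It.
    apply: le_trans M0M; apply: (boundE u v) => //; rewrite fA.
    by exists t.
  have cv : ~~ comp u (ctr v).
    apply/negP => /comp_Reg h; have h' : Reg v (ctr v) by apply/orP; left; exact: ctr_S.
    by have := Reg_disj _ _ _ h h' => E; rewrite E e_irr in euv.
  have [a [b [/and3P[ab _ nb] ca ncb]]] := connect_cross cn (connect0 _ _ : comp u (ctr u)) cv.
  exists (a, b); split=> //; apply/labP => //; apply: Sv_comp; apply/negPn/negP => nv.
  case/negP: ncb; apply: (connect_trans ca); apply: connect1.
  apply/and3P; split; [exact: ab | exact: (comp_Reg u a ca) |].
  have [hu|nu] := boolP (Sv u b); apply/orP; [by left | right].
  by apply/existsP; exists v; rewrite euv ruv /int nb nu nv.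
have ex_g (p : V * V) : exists ab, e p.1 p.2 -> (enum_rank p.1 < enum_rank p.2)%N ->
    [/\ gadj ab.1 ab.2, lab ab.1 = Some p.1 & lab ab.2 = Some p.2].
  have [/andP[euv ruv]|no] := boolP (e p.1 p.2 && (enum_rank p.1 < enum_rank p.2)%N).
    by have [ab Hab] := touch _ _ euv ruv; exists ab.
  by exists (ctr p.1, ctr p.1) => euv ruv; rewrite euv ruv in no.
have [g Hg] := fin_all_exists ex_g.
have lt_total u v : e u v -> (enum_rank u < enum_rank v)%N \/
    (enum_rank v < enum_rank u)%N /\ (enum_rank u < enum_rank v)%N = false.
  move=> euv; case: (ltngtP (enum_rank u) (enum_rank v)); [by left | by right |].
  by move/val_inj/enum_rank_inj => E; rewrite E e_irr in euv.
(* One grid edge is chosen per edge of [e], oriented from the end of lower rank, so that [pt v w]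
   and [pt w v] are its two ends. *)
exists n, lab, (fun u v => if (enum_rank u < enum_rank v)%N then (g (u, v)).1 else (g (v, u)).2); split.
- move=> p; case Ep: (lab p) => [u|//] _; have := comp_Reg _ _ (proj1 (labP u p) Ep).
  have pos_x x (rho : R) : `|x| <= M0 -> rho <= r -> near rho x p -> p.1 != 0.
    move=> hx hr; rewrite /near /near_pt /= norm_pair_le => /andP[h1 _].
    have {h1} : `|eps * p.1%:R - M - x.1| <= rho by exact: h1.
    move: hx; rewrite norm_pair_le => /andP[hx _].
    apply: contraTneq => -> /=; rewrite mulr0 sub0r -ltNge.
    move: hx; rewrite ler_norml => /andP[hx _].
    rewrite ltr_normr; apply/orP; right; rewrite /M; lra.
  case/orP => [hu|/existsP[v /and3P[euv _ /and3P[/asboolP[x Ax nx] _ _]]]].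
    exact: pos_x (boundV u) (lexx r) hu.
  by apply: pos_x (boundE u v x euv Ax) _ nx; lra.
- move=> v; have sub p : lab p = Some v -> connect (same_lab (@gadj n) lab v) (ctr v) p.
    move=> /labP /connect_component; apply: connect_sub => x y /and3P[xy cx cy].
    apply: connect1; rewrite /same_lab /=; case/and3P: xy => -> _ _ /=.
    by rewrite (proj2 (labP v x) cx) (proj2 (labP v y) cy) eqxx.
  move=> p p' lp lp'; apply: connect_trans (sub p' lp').
  rewrite sym_connect_sym; first exact: sub.
  by move=> x y; rewrite /same_lab /= gadj_sym; congr (_ && _); rewrite andbC.
- move=> u v euv; have evu : e v u by rewrite e_sym.
  case: (lt_total u v euv) => [ruv|[rvu ->]]; first by rewrite ruv; have [] := Hg (u, v) euv ruv.
  by have [] := Hg (v, u) evu rvu.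
- move=> u v euv; have evu : e v u by rewrite e_sym.
  case: (lt_total u v euv) => [ruv|[rvu nuv]].
    by rewrite ruv ltnNge ltnW //; have [] := Hg (u, v) euv ruv.
  by rewrite nuv rvu gadj_sym; have [] := Hg (v, u) evu rvu.
Qed.

End Drawing.

End Topology.

(** * Induction on the number of edges *)

Theorem planar_sparse (R : realType) (V : finType) (e : rel V) :
  symmetric e -> irreflexive e -> planar R e -> girth_at_least e 6 ->
  (exists u v, e u v) ->
  (\sum_v degree e v + 3 <= 3 * #|[set v | [exists w, e v w]]|)%N.
Proof.
move=> e_sym e_irr [pos [arc draw]] girth [u [v euv]].
have [n [lab [pt [lab0 lab_conn pt_lab pt_adj]]]] := planar_grid_minor e_sym e_irr draw.
apply: (@minor_sparse V _ _ e (@gadj n) (@gleft n) lab pt) => //.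
- exact: gadj_sym.
- exact: gadj_irr.
- by move=> phi p _; apply: grid_coboundary.
- by move=> gam gs gsup g0; apply: (@grid_bounds n (fun p => lab p)).
- by move=> c uc sc cc; apply: girth; rewrite /graph_cycle uc sc cc.
- by apply/card_gt0P; exists (orient u v); apply: orient_edges.
Qed.

Lemma sub_planar (R : realType) (V : finType) (e e' : rel V) :
  subrel e' e -> planar R e -> planar R e'.
Proof.
move=> sub [pos [arc [inj sym ar av dis]]]; exists pos, arc; split=> //.
- by move=> u v /sub; exact: sym.
- by move=> u v /sub; exact: ar.
- by move=> u v w /sub; exact: av.
- by move=> u v x y /sub h /sub; exact: dis.
Qed.

Lemma sub_girth (V : finType) (e e' : rel V) g :
  subrel e' e -> girth_at_least e g -> girth_at_least e' g.
Proof.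
move=> sub girth c /and3P[sc uc cc]; apply: girth; rewrite /graph_cycle sc uc /=.
exact: sub_cycle sub _ cc.
Qed.

(** [k] is just an upper bound on the degrees, so that it and the lists can stay fixed when deleting
    an edge lowers the maximum degree. *)
Lemma planar_colorable (R : realType) (V : finType) (e : rel V) (k : nat) (C : eqType) (L : V -> seq C) :
  (17 <= k)%N -> symmetric e -> irreflexive e -> (forall v, (degree e v <= k)%N) ->
  planar R e -> girth_at_least e 6 ->
  (forall v, uniq (L v)) -> (forall v, size (L v) = k.+2) ->
  exists c : V -> C, (forall v, c v \in L v) /\ two_distance_coloring e c.
Proof.
move=> k_ge e_sym e_irr e_deg pl girth L_uniq L_size.
elim: {e}_.+1 {-2}e (ltnSn #|[set p | e p.1 p.2]|) e_sym e_irr e_deg pl girth => // n IH e En e_sym e_irr e_deg pl girth.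
have [/existsP[u /existsP[v euv]]|no_edge] := boolP [exists u, exists v, e u v]; last first.
  have nadj u v : e u v = false.
    by apply: contraNF no_edge => euv; apply/existsP; exists u; apply/existsP; exists v.
  have pick v : exists x, x \in L v.
    by case E : (L v) (L_size v) => [|x l] // _; exists x; rewrite mem_head.
  have [c cL] := choice pick; exists c; split=> // u v _.
  by rewrite /adj_or_common_neighbor nadj /= => /existsP[w]; rewrite nadj.
apply: contrapT; apply: (no_critical_sparse k_ge e_sym e_irr e_deg girth _ L_uniq L_size).
  by apply: (planar_sparse e_sym e_irr pl girth); exists u, v.
move=> {euv}u {}v euv.
have sub : subrel (del_edge e u v) e by move=> x y /andP[].
apply: IH.
- rewrite -ltnS; apply: leq_trans En; rewrite ltnS; apply: proper_card; apply/properP; split.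
    by apply/fintype.subsetP => p; rewrite !inE => /sub.
  by exists (u, v); rewrite inE /= ?euv // /del_edge /= !eqxx andbF.
- by move=> x y; rewrite /del_edge /= e_sym; congr (_ && ~~ _); rewrite orbC [(y == v) && _]andbC [(y == u) && _]andbC.
- by move=> x; rewrite /del_edge /= e_irr.
- move=> x; apply: leq_trans (e_deg x); apply/subset_leq_card/fintype.subsetP => y; rewrite !inE; exact: sub.
- exact: sub_planar sub pl.
- exact: sub_girth sub girth.
Qed.

Theorem theorem3 (R : realType) (V : finType) (e : rel V)
  (e_sym : symmetric e) (e_irr : irreflexive e)
  (e_planar : planar R e)
  (e_maxdeg : (17 <= max_degree e)%N)
  (e_girth : girth_at_least e 6) :
  list_two_distance_colorable e (max_degree e + 2)%N.
Proof.
move=> C L L_uniq L_size; apply: (planar_colorable e_maxdeg) e_planar e_girth L_uniq _ => //.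
- by move=> v; exact: leq_bigmax.
- by move=> v; rewrite L_size addn2.
Qed.
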